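(* In the interior of a subextremal Kerr--Newman--de Sitter black hole, regard $r$ and $\theta$ as functions of $(r_\star,\theta_\star)$. The functions $r$ and $\frac{\partial\theta}{\partial\theta_\star}$ are $C^\infty$ (in the sense that they have derivatives of all orders with respect to $\partial_{r_\star}$ and $\frac{1}{\sin(2\theta_\star)}\partial_{\theta_\star}$). For every $k\ge2$, for $r_\star\in\mathbb R$ and $\theta_\star\in(0,\frac\pi2)$, $$\sum_{1\le k_1+k_2\le k}\left|(\partial_{r_\star})^{k_1}\left(\tfrac{1}{\sin(2\theta_\star)}\partial_{\theta_\star}\right)^{k_2}r\right|\lesssim|\Delta_r|,\qquad \sum_{1\le k_1\le k}\left|(\partial_{r_\star})^{k_1}\theta\right|\lesssim|\Delta_r|\sin(2\theta_\star),$$ $$\sum_{0\le k_1\le k-1}\left|\left(\tfrac{1}{\sin(2\theta_\star)}\partial_{\theta_\star}\right)^{k_1}\left(\tfrac{\partial\theta}{\partial\theta_\star}\right)\right|\lesssim1,\qquad \sum_{\substack{1\le k_1+k_2\le k-1\\ k_1\ge1}}\left|(\partial_{r_\star})^{k_1}\left(\tfrac{1}{\sin(2\theta_\star)}\partial_{\theta_\star}\right)^{k_2}\left(\tfrac{\partial\theta}{\partial\theta_\star}\right)\right|\lesssim|\Delta_r|.$$ Moreover, the function $L=-GPQ$ satisfies $$\sum_{0\le k_1\le k-1}\left|\left(\tfrac{1}{\sin(2\theta_\star)}\partial_{\theta_\star}\right)^{k_1}L\right|\lesssim1,\qquad \sum_{\substack{1\le k_1+k_2\le k-1\\ k_1\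ge1}}\left|(\partial_{r_\star})^{k_1}\left(\tfrac{1}{\sin(2\theta_\star)}\partial_{\theta_\star}\right)^{k_2}L\right|\lesssim|\Delta_r|.$$
   Context: Parameters: $\Lambda>0$, $M>0$, $a>0$, $e\in\mathbb R$; $\Delta_r=(r^2+a^2)(1-\frac{\Lambda}{3}r^2)-2Mr+e^2$, $\Delta_\theta=1+\frac{\Lambda}{3}a^2\cos^2\theta$. Subextremality (assumed): $\Delta_r$ has four distinct real roots $r_n<0<r_-<r_+<r_c$; hence $\Delta_r<0$ on $(r_-,r_+)$. Set $P(\theta,\theta_\star)=a\sqrt{\sin^2\theta_\star\Delta_\theta-\sin^2\theta}$, $Q(r,\theta_\star)=\sqrt{(r^2+a^2)^2-a^2\sin^2\theta_\star\Delta_r}$. For $r\in[r_-,r_+]$, $\theta\in(0,\frac\pi2)$, $\theta_\star=\theta_\star(r,\theta)\in[\theta,\frac\pi2)$ is the unique solution of $F(r,\theta,\theta_\star):=\int_{\theta_\star}^{\theta}\frac{d\theta'}{P(\theta',\theta_\star)}+\int_r^{r_+}\frac{dr'}{Q(r',\theta_\star)}=0$; $\theta_\star(r,0)=0$, $\theta_\star(r,\frac\pi2)=\frac\pi2$. $G:=\partial_{\theta_\star}F$ (at fixed $r,\theta$). With $f(0)=0$, $f'(\sin^2\theta_\star)=-\int_0^{\theta_\star}\frac{d\theta'}{P(\theta',\theta_\star)}$ and a fixed $r_0\in(r_-,r_+)$, $$r_\star(r,\theta)=\int_{r_0}^r\frac{r'^2+a^2}{\Delta_{r'}}dr'+\int_r^{r_+}\frac{r'^2+a^2-Q(r',\theta_\star)}{\Delta_{r'}}dr'+\int_0^\theta\frac{P(\theta',\theta_\star)}{\Delta_{\theta'}}d\theta'+\frac{a^2}{2}f(\sin^2\theta_\star),\quad\theta_\star=\theta_\star(r,\theta).$$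 The map $(r,\theta)\mapsto(r_\star,\theta_\star)$ is a bijection from $(r_-,r_+)\times[0,\frac\pi2]$ onto $\mathbb R\times[0,\frac\pi2]$, so $r,\theta$ (and $\Delta_r$, $L$) are functions of $(r_\star,\theta_\star)$; everything is extended to $\theta,\theta_\star\in[\frac\pi2,\pi]$ by reflection $\theta\mapsto\pi-\theta$, $\theta_\star\mapsto\pi-\theta_\star$. The notation $A\lesssim B$ means $A\le CB$ with $C$ depending only on $\Lambda,M,a,e$ and $k$ (not on the point). The sums run over nonnegative integers $k_1,k_2$. *)

(* Defs.v *)
From Stdlib Require Import Reals.
From Coquelicot Require Import Coquelicot.
Open Scope R_scope.

Definition Delta_r (Lam M a e r : R) : R :=
  (r ^ 2 + a ^ 2) * (1 - Lam / 3 * r ^ 2) - 2 * M * r + e ^ 2.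

Definition Delta_th (Lam a th : R) : R := 1 + Lam / 3 * a ^ 2 * (cos th) ^ 2.

(* [Delta_r] is a quartic, so these are all of its roots. *)
Definition subextremal (Lam M a e rn rm rp rc : R) : Prop :=
  rn < 0 /\ 0 < rm /\ rm < rp /\ rp < rc /\
  Delta_r Lam M a e rn = 0 /\ Delta_r Lam M a e rm = 0 /\
  Delta_r Lam M a e rp = 0 /\ Delta_r Lam M a e rc = 0.

Definition P_pot (Lam a th ts : R) : R :=
  a * sqrt ((sin ts) ^ 2 * Delta_th Lam a th - (sin th) ^ 2).

Definition Q_pot (Lam M a e r ts : R) : R :=
  sqrt ((r ^ 2 + a ^ 2) ^ 2 - a ^ 2 * (sin ts) ^ 2 * Delta_r Lam M a e r).

Definition F_eik (Lam M a e rp r th ts : R) : R :=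
  RInt (fun th' => / P_pot Lam a th' ts) ts th
  + RInt (fun r' => / Q_pot Lam M a e r' ts) r rp.

Definition G_eik (Lam M a e rp r th ts : R) : R :=
  Derive (fun t => F_eik Lam M a e rp r th t) ts.

Definition is_theta_star (Lam M a e rm rp : R) (thstar : R -> R -> R) : Prop :=
  forall r, rm <= r <= rp ->
    thstar r 0 = 0 /\ thstar r (PI / 2) = PI / 2 /\
    forall th, 0 < th < PI / 2 ->
      (th <= thstar r th < PI / 2 /\ F_eik Lam M a e rp r th (thstar r th) = 0) /\
      (forall t, th <= t < PI / 2 -> F_eik Lam M a e rp r th t = 0 ->
         t = thstar r th).

(* [f'] tends to -oo at 1, so [f 1] is fixed by continuity; the formula for
   [f'] is not imposed at 0, where the integral degenerates. *)
Definition is_f (Lam a : R) (f : R -> R) : Prop :=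
  f 0 = 0 /\
  continuous_on (fun x => 0 <= x <= 1) f /\
  forall ts, 0 < ts < PI / 2 ->
    is_derive f ((sin ts) ^ 2) (- RInt (fun th' => / P_pot Lam a th' ts) 0 ts).

(* The second integrand has a removable singularity at [r' = rp], which does
   not affect the Riemann integral. *)
Definition rstar (Lam M a e rp r0 : R) (f : R -> R) (thstar : R -> R -> R)
    (r th : R) : R :=
  let ts := thstar r th in
  RInt (fun r' => (r' ^ 2 + a ^ 2) / Delta_r Lam M a e r') r0 r
  + RInt (fun r' => (r' ^ 2 + a ^ 2 - Q_pot Lam M a e r' ts)
                    / Delta_r Lam M a e r') r rp
  + RInt (fun th' => P_pot Lam a th' ts / Delta_th Lam a th') 0 th
  + a ^ 2 / 2 * f ((sin ts) ^ 2).

(* [(rr, tt)] is the inverse of [(r, th) |-> (rstar, thstar)], a bijection from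
   (rm, rp) x [0, PI/2] onto R x [0, PI/2], extended to R x [0, PI] by
   reflection; arguments of [rr] and [tt] are in the order [rs], [ts]. *)
Definition is_inverse_coords (Lam M a e rm rp r0 : R) (f : R -> R)
    (thstar rr tt : R -> R -> R) : Prop :=
  (forall r th, rm < r < rp -> 0 <= th <= PI / 2 ->
     let rs := rstar Lam M a e rp r0 f thstar r th in
     let ts := thstar r th in
     rr rs ts = r /\ tt rs ts = th) /\
  (forall rs ts, 0 <= ts <= PI / 2 ->
     let r := rr rs ts in
     let th := tt rs ts in
     rm < r < rp /\ 0 <= th <= PI / 2 /\
     rstar Lam M a e rp r0 f thstar r th = rs /\ thstar r th = ts) /\
  (forall rs ts, PI / 2 <= ts <= PI ->
     rr rs ts = rr rs (PI - ts) /\ tt rs ts = PI - tt rs (PI - ts)).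

Definition coordinates (Lam M a e rm rp r0 : R) (rr tt : R -> R -> R) : Prop :=
  rm < r0 < rp /\
  exists (f : R -> R) (thstar : R -> R -> R),
    is_f Lam a f /\ is_theta_star Lam M a e rm rp thstar /\
    is_inverse_coords Lam M a e rm rp r0 f thstar rr tt.

Definition L_eik (Lam M a e rp : R) (rr tt : R -> R -> R) (rs ts : R) : R :=
  let r := rr rs ts in
  let th := tt rs ts in
  - (G_eik Lam M a e rp r th ts * P_pot Lam a th ts * Q_pot Lam M a e r ts).

Definition D_rs (u : R -> R -> R) : R -> R -> R :=
  fun rs ts => Derive (fun s => u s ts) rs.

Definition D_ts (u : R -> R -> R) : R -> R -> R :=
  fun rs ts => / sin (2 * ts) * Derive (fun t => u rs t) ts.

Definition D_mixed (k1 k2 : nat) (u : R -> R -> R) : R -> R -> R :=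
  Nat.iter k1 D_rs (Nat.iter k2 D_ts u).

Definition dth (tt : R -> R -> R) : R -> R -> R :=
  fun rs ts => Derive (fun t => tt rs t) ts.

(* Derivative relative to a set: one-sided at the end points of an interval. *)
Definition is_derive_in (I : R -> Prop) (f : R -> R) (x l : R) : Prop :=
  filterdiff f (within I (locally x)) (fun h => scal h l).

(* Derivatives of all orders on R x I with respect to d/drs and
   (1 / sin (2 ts)) d/dts.  Writing the second as d/dts g = sin (2 ts) * g'
   makes sense also where sin (2 ts) = 0; there g' is determined by continuity.
   Where sin (2 ts) <> 0 and I is a neighbourhood of ts, [g i j] is
   [D_mixed i j u]. *)
Definition smooth_on (I : R -> Prop) (u : R -> R -> R) : Prop :=
  exists g : nat -> nat -> R -> R -> R,
    (forall rs ts, I ts -> g 0%nat 0%nat rs ts = u rs ts) /\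
    forall i j : nat,
      continuous_on (fun p : R * R => I (snd p))
                    (fun p : R * R => g i j (fst p) (snd p)) /\
      forall rs ts, I ts ->
        is_derive (fun s => g i j s ts) rs (g (S i) j rs ts) /\
        is_derive_in I (fun t => g i j rs t) ts
          (sin (2 * ts) * g i (S j) rs ts).

(* Sum of h k1 k2 over m <= k1 + k2 <= n and k1 >= l, arranged by the value of
   k1 + k2. *)
Definition sum2 (l m n : nat) (h : nat -> nat -> R) : R :=
  sum_n_m (fun s => sum_n_m (fun k1 => h k1 (s - k1)%nat) l s) m n.

(* Main.v *)
(* With s = sin^2 ts, lam = Lam a^2 / 3 and q = tan th / tan ts, the substitution
   th' -> tan th' / tan ts turns the equation F = 0 into J(q, s) = tau(r, s), where
   J(q, s) = int_q^1 dq' / (a sqrt ((1 - s + s q'^2) (1 + lam - q'^2))) and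
   tau(r, s) = int_r^rp dr' / Q.  Unlike the integral of 1/P, the integrand of J is regular
   up to s = 0 and s = 1, because q stays away from 0: the solution for s = 0 is explicit
   and is a lower bound for all s, and it is positive on [rm, rp] since Lam rp^2 / 3 < 1.
   By the implicit function theorem q is a smooth function of (r, s) on a neighbourhood of
   the compact rectangle [rm, rp] x [0, 1], hence so are P / sin (2 ts), Delta_th and
   d th / d ts.

   At fixed ts one finds d rstar / d r = (Q^2 Delta_th + P^2 Delta_r) / (Delta_r Q Delta_th),
   and the choice of f makes d rstar / d ts at fixed r equal to (P / Delta_th) d th / d ts.
   Therefore d/drs = Delta_r Phi d/dr and
   (1 / sin (2 ts)) d/dts = d/ds - Delta_r Phi Ups d/dr with Phi, Ups smooth up to the
   boundary of the rectangle.  Both vector fields preserve the smooth functions and the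
   ideal generated by Delta_r; the first one maps every smooth function into this ideal.
   All estimates follow by compactness, with L = Q d th / d ts (at fixed r). *)

Require Import Defs.
From Stdlib Require Import Reals Lra Lia Psatz ClassicalEpsilon Ranalysis5.
From Coquelicot Require Import Coquelicot.
Open Scope R_scope.
Set Bullet Behavior "Strict Subproofs".

(** * Smooth functions of two variables on a box *)

(** Smoothness up to the boundary is taken as smoothness on an open box around the closed rectangle,
    so that derivatives are two-sided and compactness serves only for bounds. Whatever stands under
    a root or in a denominator is first shown positive on the closed rectangle and then on a box
    with a possibly smaller margin. This gives the nested margins [e0] (for [w1], [w2] and Q), [e1]
    (for the existence of q) and [e2] (for Delta_th and the numerator of d rstar / d r). All of them
    are fixed before [r0], f, [thstar], [rr] and [tt] appear, because the constants of the estimates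
    must not depend on these.

    No regularity of [rr] and [tt] is assumed; it is recovered from the monotonicity of rstar in r
    at fixed ts. The delicate values are ts = 0, PI / 2 and PI: the derivative of f is given only on
    (0, 1), so rstar is differentiated in ts only on (0, PI / 2). At the exceptional values only
    continuity is available, and derivatives there are limits of derivatives at neighbouring
    points. *)

Record box := Box { xl : R; xr : R; yl : R; yr : R }.

Definition inb (B : box) (x y : R) : Prop := xl B < x < xr B /\ yl B < y < yr B.

(** The partial derivatives are quantified instead of being [Derive], so that closure under an
    operation is proved by exhibiting them. Continuity is demanded at order 0 only; at higher order
    it follows from the partials ([Cn_continuous]). *)
Fixpoint Cn (B : box) (n : nat) (f : R -> R -> R) : Prop :=
  match n with
  | O => forall x y, inb B x y -> continuity_2d_pt f x y
  | S m => exists fx fy : R -> R -> R,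
      (forall x y, inb B x y ->
         is_derive (fun t => f t y) x (fx x y) /\ is_derive (fun t => f x t) y (fy x y)) /\
      Cn B m fx /\ Cn B m fy
  end.

Definition smooth (B : box) (f : R -> R -> R) : Prop := forall n, Cn B n f.

Definition d1 (f : R -> R -> R) : R -> R -> R := fun x y => Derive (fun t => f t y) x.
Definition d2 (f : R -> R -> R) : R -> R -> R := fun x y => Derive (fun t => f x t) y.

Lemma open_interval_nbhd (a b x : R) :
  a < x < b -> exists d : posreal, forall u, Rabs (u - x) < d -> a < u < b.
Proof.
  intros H.
  assert (Hd : 0 < Rmin (x - a) (b - x)) by (apply Rmin_glb_lt; lra).
  exists (mkposreal _ Hd); simpl; intros u Hu.
  pose proof (Rmin_l (x - a) (b - x)); pose proof (Rmin_r (x - a) (b - x)).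
  apply Rabs_def2 in Hu; lra.
Qed.

Lemma locally_open_interval (a b x : R) : a < x < b -> locally x (fun u => a < u < b).
Proof.
  intros H; destruct (open_interval_nbhd a b x H) as [d Hd].
  exists d; intros u Hu; apply Hd, Hu.
Qed.

Lemma inb_locally_2d (B : box) (x y : R) : inb B x y -> locally_2d (inb B) x y.
Proof.
  intros [Hx Hy].
  destruct (open_interval_nbhd _ _ _ Hx) as [d Hd], (open_interval_nbhd _ _ _ Hy) as [e He].
  assert (Hm : 0 < Rmin d e) by (apply Rmin_glb_lt; apply cond_pos).
  exists (mkposreal _ Hm); simpl; intros u v Hu Hv.
  pose proof (Rmin_l d e); pose proof (Rmin_r d e).
  split; [apply Hd | apply He]; lra.
Qed.

Lemma inb_locally_x (B : box) (x y : R) : inb B x y -> locally x (fun t => inb B t y).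
Proof.
  intros [Hx Hy]; generalize (locally_open_interval _ _ _ Hx); apply filter_imp.
  intros u Hu; now split.
Qed.

Lemma inb_locally_y (B : box) (x y : R) : inb B x y -> locally y (fun t => inb B x t).
Proof.
  intros [Hx Hy]; generalize (locally_open_interval _ _ _ Hy); apply filter_imp.
  intros u Hu; now split.
Qed.

(** Continuity of one of the two partials is enough for total differentiability. The asymmetry
    matters for [ang_part] and [rho], whose derivative in the second variable is computed but not
    shown to be continuous. *)
Lemma partials_differentiable (B : box) (f fx fy : R -> R -> R) (x y : R) :
  (forall x y, inb B x y ->
     is_derive (fun t => f t y) x (fx x y) /\ is_derive (fun t => f x t) y (fy x y)) ->
  inb B x y -> continuity_2d_pt fx x y ->
  differentiable_pt_lim f x y (fx x y) (fy x y).
Proof.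
  intros Hd Hxy Hc.
  apply filterdiff_differentiable_pt_lim.
  apply (is_derive_filterdiff f x y fx (fy x y)).
  - apply (locally_2d_locally (fun u v => is_derive (fun z => f z v) u (fx u v))).
    destruct (inb_locally_2d _ _ _ Hxy) as [d H]; exists d; intros u v Hu Hv.
    apply Hd; auto.
  - apply Hd, Hxy.
  - apply continuity_2d_pt_filterlim, Hc.
Qed.

Lemma Cn_continuous (B : box) (n : nat) (f : R -> R -> R) (x y : R) :
  Cn B n f -> inb B x y -> continuity_2d_pt f x y.
Proof.
  revert f; induction n as [|n IH]; intros f Hf Hxy.
  - now apply Hf.
  - destruct Hf as (fx & fy & Hd & Hx & Hy).
    apply differentiable_continuity_pt.
    exists (fx x y), (fy x y); apply (partials_differentiable B); auto.
Qed.

Lemma Cn_le (B : box) (n : nat) (f : R -> R -> R) : Cn B (S n) f -> Cn B n f.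
Proof.
  revert f; induction n as [|n IH]; intros f Hf.
  - intros x y Hxy; now apply (Cn_continuous B 1).
  - destruct Hf as (fx & fy & Hd & Hx & Hy); exists fx, fy; auto.
Qed.

Lemma Cn_ext (B : box) (n : nat) (f g : R -> R -> R) :
  (forall x y, inb B x y -> f x y = g x y) -> Cn B n f -> Cn B n g.
Proof.
  revert f g; induction n as [|n IH]; intros f g He Hf.
  - intros x y Hxy; apply (continuity_2d_pt_ext_loc f); [| now apply Hf].
    destruct (inb_locally_2d _ _ _ Hxy) as [d H]; exists d; auto.
  - destruct Hf as (fx & fy & Hd & Hx & Hy); exists fx, fy; split; [|now split].
    intros x y Hxy; split.
    + apply (is_derive_ext_loc (fun t => f t y)); [|now apply Hd].
      generalize (inb_locally_x _ _ _ Hxy); apply filter_imp; auto.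
    + apply (is_derive_ext_loc (fun t => f x t)); [|now apply Hd].
      generalize (inb_locally_y _ _ _ Hxy); apply filter_imp; auto.
Qed.

Lemma Cn_sub (B B' : box) (n : nat) (f : R -> R -> R) :
  (forall x y, inb B' x y -> inb B x y) -> Cn B n f -> Cn B' n f.
Proof.
  intros HB; revert f; induction n as [|n IH]; intros f Hf.
  - intros x y Hxy; auto.
  - destruct Hf as (fx & fy & Hd & Hx & Hy); exists fx, fy; auto.
Qed.

Lemma Cn_const (B : box) (n : nat) (c : R) : Cn B n (fun _ _ => c).
Proof.
  revert c; induction n as [|n IH]; intros c.
  - intros x y _; apply continuity_2d_pt_const.
  - exists (fun _ _ => 0), (fun _ _ => 0); split; [|auto].
    intros x y _; split; apply (is_derive_const c).
Qed.

Lemma Cn_fst (B : box) (n : nat) : Cn B n (fun x _ => x).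
Proof.
  destruct n as [|n].
  - intros x y _; apply continuity_2d_pt_id1.
  - exists (fun _ _ => 1), (fun _ _ => 0); split; [|split; apply Cn_const].
    intros x y _; split.
    + apply (is_derive_id (K := R_AbsRing)).
    + apply (is_derive_const x).
Qed.

Lemma Cn_snd (B : box) (n : nat) : Cn B n (fun _ y => y).
Proof.
  destruct n as [|n].
  - intros x y _; apply continuity_2d_pt_id2.
  - exists (fun _ _ => 0), (fun _ _ => 1); split; [|split; apply Cn_const].
    intros x y _; split.
    + apply (is_derive_const y).
    + apply (is_derive_id (K := R_AbsRing)).
Qed.

Lemma Cn_plus (B : box) (n : nat) (f g : R -> R -> R) :
  Cn B n f -> Cn B n g -> Cn B n (fun x y => f x y + g x y).
Proof.
  revert f g; induction n as [|n IH]; intros f g Hf Hg.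
  - intros x y Hxy; apply continuity_2d_pt_plus; auto.
  - destruct Hf as (fx & fy & Hf & Hfx & Hfy), Hg as (gx & gy & Hg & Hgx & Hgy).
    exists (fun x y => fx x y + gx x y), (fun x y => fy x y + gy x y).
    split; [|auto].
    intros x y Hxy; destruct (Hf x y Hxy), (Hg x y Hxy); split.
    + now apply (is_derive_plus (fun t => f t y) (fun t => g t y)).
    + now apply (is_derive_plus (fun t => f x t) (fun t => g x t)).
Qed.

Lemma Cn_mult (B : box) (n : nat) (f g : R -> R -> R) :
  Cn B n f -> Cn B n g -> Cn B n (fun x y => f x y * g x y).
Proof.
  revert f g; induction n as [|n IH]; intros f g Hf Hg.
  - intros x y Hxy; apply continuity_2d_pt_mult; auto.
  - pose proof (Cn_le _ _ _ Hf) as Hf'; pose proof (Cn_le _ _ _ Hg) as Hg'.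
    destruct Hf as (fx & fy & Hf & Hfx & Hfy), Hg as (gx & gy & Hg & Hgx & Hgy).
    exists (fun x y => fx x y * g x y + f x y * gx x y),
           (fun x y => fy x y * g x y + f x y * gy x y).
    split; [|split; apply Cn_plus; auto].
    intros x y Hxy; destruct (Hf x y Hxy), (Hg x y Hxy); split.
    + apply (is_derive_mult (fun t => f t y) (fun t => g t y)); auto; apply Rmult_comm.
    + apply (is_derive_mult (fun t => f x t) (fun t => g x t)); auto; apply Rmult_comm.
Qed.

Lemma Cn_opp (B : box) (n : nat) (f : R -> R -> R) :
  Cn B n f -> Cn B n (fun x y => - f x y).
Proof.
  intros Hf; apply (Cn_ext _ _ (fun x y => (-1) * f x y)); [intros; ring|].
  apply Cn_mult; auto; apply Cn_const.
Qed.

Lemma Cn_minus (B : box) (n : nat) (f g : R -> R -> R) :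
  Cn B n f -> Cn B n g -> Cn B n (fun x y => f x y - g x y).
Proof. intros Hf Hg; apply Cn_plus; auto; now apply Cn_opp. Qed.

Lemma Cn_inv (B : box) (n : nat) (f : R -> R -> R) :
  (forall x y, inb B x y -> f x y <> 0) -> Cn B n f -> Cn B n (fun x y => / f x y).
Proof.
  intros H0; induction n as [|n IH]; intros Hf.
  - intros x y Hxy; apply continuity_2d_pt_inv; auto.
  - pose proof (IH (Cn_le _ _ _ Hf)) as Hi.
    destruct Hf as (fx & fy & Hf & Hfx & Hfy).
    exists (fun x y => - fx x y * (/ f x y * / f x y)),
           (fun x y => - fy x y * (/ f x y * / f x y)).
    split; [|split; apply Cn_mult; try apply Cn_opp; try apply Cn_mult; auto].
    intros x y Hxy; destruct (Hf x y Hxy) as [Hx Hy]; specialize (H0 x y Hxy); split.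
    + replace (- fx x y * (/ f x y * / f x y)) with (- fx x y / f x y ^ 2) by (field; auto).
      now apply (is_derive_inv (fun t => f t y)).
    + replace (- fy x y * (/ f x y * / f x y)) with (- fy x y / f x y ^ 2) by (field; auto).
      now apply (is_derive_inv (fun t => f x t)).
Qed.

Lemma Cn_div (B : box) (n : nat) (f g : R -> R -> R) :
  (forall x y, inb B x y -> g x y <> 0) -> Cn B n f -> Cn B n g ->
  Cn B n (fun x y => f x y / g x y).
Proof. intros H0 Hf Hg; apply Cn_mult; auto; now apply Cn_inv. Qed.

Lemma Cn_sqrt (B : box) (n : nat) (f : R -> R -> R) :
  (forall x y, inb B x y -> 0 < f x y) -> Cn B n f -> Cn B n (fun x y => sqrt (f x y)).
Proof.
  intros H0; induction n as [|n IH]; intros Hf.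
  - intros x y Hxy; apply continuity_1d_2d_pt_comp; auto.
    apply continuity_pt_sqrt; left; auto.
  - pose proof (IH (Cn_le _ _ _ Hf)) as Hi.
    destruct Hf as (fx & fy & Hf & Hfx & Hfy).
    exists (fun x y => fx x y / (2 * sqrt (f x y))), (fun x y => fy x y / (2 * sqrt (f x y))).
    assert (Hs : forall x y, inb B x y -> 2 * sqrt (f x y) <> 0).
    { intros x y Hxy; pose proof (sqrt_lt_R0 _ (H0 x y Hxy)); lra. }
    split; [|split; apply Cn_div; auto; apply Cn_mult; auto; apply Cn_const].
    intros x y Hxy; destruct (Hf x y Hxy) as [Hx Hy]; specialize (H0 x y Hxy); split.
    + now apply (is_derive_sqrt (fun t => f t y)).
    + now apply (is_derive_sqrt (fun t => f x t)).
Qed.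

Lemma Cn_comp (V B : box) (n : nat) (g p q : R -> R -> R) :
  (forall x y, inb B x y -> inb V (p x y) (q x y)) ->
  Cn V n g -> Cn B n p -> Cn B n q -> Cn B n (fun x y => g (p x y) (q x y)).
Proof.
  intros HV; revert g; induction n as [|n IH]; intros g Hg Hp Hq.
  - intros x y Hxy.
    apply continuity_2d_pt_filterlim.
    pose proof (proj1 (continuity_2d_pt_filterlim _ _ _) (Hp x y Hxy)) as Hp'.
    pose proof (proj1 (continuity_2d_pt_filterlim _ _ _) (Hq x y Hxy)) as Hq'.
    pose proof (proj1 (continuity_2d_pt_filterlim _ _ _) (Hg _ _ (HV x y Hxy))) as Hg'.
    apply (continuous_comp_2 (fun z : R * R => p (fst z) (snd z))
             (fun z : R * R => q (fst z) (snd z)) g (x, y)); auto.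
  - pose proof (Cn_le _ _ _ Hp) as Hp'; pose proof (Cn_le _ _ _ Hq) as Hq'.
    destruct Hg as (gx & gy & Hg & Hgx & Hgy), Hp as (px & py & Hp & Hpx & Hpy),
      Hq as (qx & qy & Hq & Hqx & Hqy).
    exists (fun x y => gx (p x y) (q x y) * px x y + gy (p x y) (q x y) * qx x y),
           (fun x y => gx (p x y) (q x y) * py x y + gy (p x y) (q x y) * qy x y).
    split; [|split; apply Cn_plus; apply Cn_mult; auto].
    intros x y Hxy.
    pose proof (partials_differentiable V g gx gy _ _ Hg (HV x y Hxy)
                  (Cn_continuous V n gx _ _ Hgx (HV x y Hxy))) as Hd.
    split; apply is_derive_Reals.
    + apply (derivable_pt_lim_comp_2d g (fun t => p t y) (fun t => q t y)); auto;
        apply is_derive_Reals; [apply Hp | apply Hq]; auto.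
    + apply (derivable_pt_lim_comp_2d g (fun t => p x t) (fun t => q x t)); auto;
        apply is_derive_Reals; [apply Hp | apply Hq]; auto.
Qed.

Lemma smooth_is_derive (B : box) (f : R -> R -> R) (x y : R) :
  smooth B f -> inb B x y ->
  is_derive (fun t => f t y) x (d1 f x y) /\ is_derive (fun t => f x t) y (d2 f x y).
Proof.
  intros Hf Hxy; destruct (Hf 1%nat) as (fx & fy & Hd & _).
  destruct (Hd x y Hxy) as [Hx Hy].
  split; apply Derive_correct; [exists (fx x y) | exists (fy x y)]; auto.
Qed.

Lemma smooth_d1 (B : box) (f : R -> R -> R) : smooth B f -> smooth B (d1 f).
Proof.
  intros Hf n; destruct (Hf (S n)) as (fx & fy & Hd & Hx & _).
  apply (Cn_ext _ _ fx); auto.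
  intros x y Hxy; symmetry; apply is_derive_unique, Hd, Hxy.
Qed.

Lemma smooth_d2 (B : box) (f : R -> R -> R) : smooth B f -> smooth B (d2 f).
Proof.
  intros Hf n; destruct (Hf (S n)) as (fx & fy & Hd & _ & Hy).
  apply (Cn_ext _ _ fy); auto.
  intros x y Hxy; symmetry; apply is_derive_unique, Hd, Hxy.
Qed.

Lemma smooth_continuous (B : box) (f : R -> R -> R) (x y : R) :
  smooth B f -> inb B x y -> continuity_2d_pt f x y.
Proof. intros Hf; apply (Cn_continuous B 0), Hf. Qed.

Lemma smooth_differentiable (B : box) (f : R -> R -> R) (x y : R) :
  smooth B f -> inb B x y -> differentiable_pt_lim f x y (d1 f x y) (d2 f x y).
Proof.
  intros Hf Hxy; apply (partials_differentiable B); auto.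
  - intros; now apply (smooth_is_derive B).
  - apply (smooth_continuous B); auto; now apply smooth_d1.
Qed.

Lemma smooth_ext (B : box) (f g : R -> R -> R) :
  (forall x y, inb B x y -> f x y = g x y) -> smooth B f -> smooth B g.
Proof. intros He Hf n; apply (Cn_ext _ _ f); auto. Qed.

Lemma smooth_sub (B B' : box) (f : R -> R -> R) :
  (forall x y, inb B' x y -> inb B x y) -> smooth B f -> smooth B' f.
Proof. intros HB Hf n; apply (Cn_sub B); auto. Qed.

Lemma smooth_const (B : box) (c : R) : smooth B (fun _ _ => c).
Proof. intros n; apply Cn_const. Qed.

Lemma smooth_fst (B : box) : smooth B (fun x _ => x).
Proof. intros n; apply Cn_fst. Qed.

Lemma smooth_snd (B : box) : smooth B (fun _ y => y).
Proof. intros n; apply Cn_snd. Qed.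

Lemma smooth_plus (B : box) (f g : R -> R -> R) :
  smooth B f -> smooth B g -> smooth B (fun x y => f x y + g x y).
Proof. intros Hf Hg n; now apply Cn_plus. Qed.

Lemma smooth_mult (B : box) (f g : R -> R -> R) :
  smooth B f -> smooth B g -> smooth B (fun x y => f x y * g x y).
Proof. intros Hf Hg n; now apply Cn_mult. Qed.

Lemma smooth_opp (B : box) (f : R -> R -> R) :
  smooth B f -> smooth B (fun x y => - f x y).
Proof. intros Hf n; now apply Cn_opp. Qed.

Lemma smooth_minus (B : box) (f g : R -> R -> R) :
  smooth B f -> smooth B g -> smooth B (fun x y => f x y - g x y).
Proof. intros Hf Hg n; now apply Cn_minus. Qed.

Lemma smooth_pow (B : box) (f : R -> R -> R) (k : nat) :
  smooth B f -> smooth B (fun x y => f x y ^ k).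
Proof.
  intros Hf; induction k as [|k IH]; [apply (smooth_const B 1) | now apply smooth_mult].
Qed.

Lemma smooth_inv (B : box) (f : R -> R -> R) :
  (forall x y, inb B x y -> f x y <> 0) -> smooth B f -> smooth B (fun x y => / f x y).
Proof. intros H0 Hf n; now apply Cn_inv. Qed.

Lemma smooth_div (B : box) (f g : R -> R -> R) :
  (forall x y, inb B x y -> g x y <> 0) -> smooth B f -> smooth B g ->
  smooth B (fun x y => f x y / g x y).
Proof. intros H0 Hf Hg n; now apply Cn_div. Qed.

Lemma smooth_sqrt (B : box) (f : R -> R -> R) :
  (forall x y, inb B x y -> 0 < f x y) -> smooth B f -> smooth B (fun x y => sqrt (f x y)).
Proof. intros H0 Hf n; now apply Cn_sqrt. Qed.

Lemma smooth_comp (V B : box) (g p q : R -> R -> R) :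
  (forall x y, inb B x y -> inb V (p x y) (q x y)) ->
  smooth V g -> smooth B p -> smooth B q -> smooth B (fun x y => g (p x y) (q x y)).
Proof. intros HV Hg Hp Hq n; now apply (Cn_comp V). Qed.

Ltac smooth_tac :=
  repeat first
    [ assumption | apply smooth_const | apply smooth_fst | apply smooth_snd
    | apply smooth_minus | apply smooth_plus | apply smooth_opp | apply smooth_pow
    | apply smooth_mult ].

(** * Slices of continuous functions and bounds on compact rectangles *)

Lemma continuity_2d_pt_slice1 (f : R -> R -> R) (x y : R) :
  continuity_2d_pt f x y -> continuous (fun t => f t y) x.
Proof.
  intros H; apply continuity_pt_filterlim, continuity_pt_locally; intros eps.
  destruct (H eps) as [d Hd]; exists d; intros u Hu; apply Hd; [exact Hu|].
  rewrite Rminus_eq_0, Rabs_R0; apply cond_pos.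
Qed.

Lemma continuity_2d_pt_swap (f : R -> R -> R) (x y : R) :
  continuity_2d_pt f x y -> continuity_2d_pt (fun u v => f v u) y x.
Proof. intros H eps; destruct (H eps) as [d Hd]; exists d; intros; now apply Hd. Qed.

Lemma continuity_2d_pt_slice2 (f : R -> R -> R) (x y : R) :
  continuity_2d_pt f x y -> continuous (fun t => f x t) y.
Proof.
  intros H; apply (continuity_2d_pt_slice1 (fun u v => f v u)), continuity_2d_pt_swap, H.
Qed.

Lemma abs_RInt_le (f : R -> R) (a b C : R) :
  ex_RInt f a b -> (forall t, Rmin a b <= t <= Rmax a b -> Rabs (f t) <= C) ->
  Rabs (RInt f a b) <= Rabs (b - a) * C.
Proof.
  intros Hf HC; destruct (Rle_dec a b) as [Hab|Hab].
  - rewrite Rmin_left, Rmax_right in HC by lra.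
    rewrite (Rabs_pos_eq (b - a)) by lra; now apply abs_RInt_le_const.
  - rewrite Rmin_right, Rmax_left in HC by lra.
    rewrite <- (opp_RInt_swap f b a) by now apply ex_RInt_swap.
    unfold opp; simpl; rewrite Rabs_Ropp, (Rabs_left (b - a)) by lra.
    replace (- (b - a)) with (a - b) by ring.
    apply abs_RInt_le_const; [lra | now apply ex_RInt_swap | auto].
Qed.

(** Uniform continuity with tolerance 1 gives a radius e. Walking from the corner (a, c) in n steps
    of at most e / 2 in each coordinate changes f by at most n, and n depends only on the size of
    the rectangle. *)
Lemma bounded_on_rectangle (f : R -> R -> R) (a b c d : R) :
  (forall x y, a <= x <= b -> c <= y <= d -> continuity_2d_pt f x y) ->
  exists C, 0 < C /\ forall x y, a <= x <= b -> c <= y <= d -> Rabs (f x y) <= C.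
Proof.
  intros Hf; destruct (uniform_continuity_2d f a b c d Hf (mkposreal 1 Rlt_0_1)) as [e He].
  pose proof (cond_pos e) as He0; simpl in He.
  assert (Hn : forall (n : nat) x y, a <= x <= b -> c <= y <= d ->
            x - a <= INR n * (e / 2) -> y - c <= INR n * (e / 2) ->
            Rabs (f x y) <= Rabs (f a c) + INR n).
  { induction n as [|n IH]; intros x y Hx Hy Hxn Hyn.
    - simpl in *; replace x with a by lra; replace y with c by lra; lra.
    - rewrite S_INR in *; pose proof (pos_INR n) as Hn0.
      (* The predecessor of (x, y) on the walk is its contraction towards (a, c) by the factor n /
         (n + 1); the remaining step is then at most e / 2. *)
      set (k := INR n / (INR n + 1)).
      assert (Hk : 0 <= k <= 1).
      { unfold k; split; [apply Rdiv_le_0_compat; lra|].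
        apply Rmult_le_reg_r with (INR n + 1); [lra|]; field_simplify; lra. }
      assert (Hk' : k * (INR n + 1) = INR n) by (unfold k; field; lra).
      assert (Hscale : forall z w, 0 <= z - w -> z - w <= (INR n + 1) * (e / 2) ->
                w <= w + k * (z - w) <= z /\ k * (z - w) <= INR n * (e / 2) /\
                Rabs (z - (w + k * (z - w))) < e).
      { intros z w Hz Hzw.
        assert (H1 : 0 <= k * (z - w)) by (apply Rmult_le_pos; lra).
        assert (H2 : k * (z - w) <= 1 * (z - w)) by (apply Rmult_le_compat_r; lra).
        assert (H3 : k * (z - w) <= k * ((INR n + 1) * (e / 2)))
          by (apply Rmult_le_compat_l; lra).
        assert (H4 : (1 - k) * (z - w) <= (1 - k) * ((INR n + 1) * (e / 2)))
          by (apply Rmult_le_compat_l; lra).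
        split; [lra|]; split; [nra|].
        rewrite Rabs_pos_eq; nra. }
      destruct (Hscale x a) as (Hx1 & Hx2 & Hx3); try lra.
      destruct (Hscale y c) as (Hy1 & Hy2 & Hy3); try lra.
      set (x' := a + k * (x - a)) in *; set (y' := c + k * (y - c)) in *.
      pose proof (IH x' y' ltac:(lra) ltac:(lra) ltac:(unfold x'; lra) ltac:(unfold y'; lra)).
      pose proof (He x' y' x y ltac:(lra) ltac:(lra) Hx Hy Hx3 Hy3).
      pose proof (Rabs_triang (f x' y') (f x y - f x' y')) as Ht.
      replace (f x' y' + (f x y - f x' y')) with (f x y) in Ht by ring; lra. }
  destruct (INR_unbounded (Rmax (b - a) (d - c) / (e / 2))) as [n Hbig].
  assert (Hmax : Rmax (b - a) (d - c) <= INR n * (e / 2)).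
  { apply Rmult_lt_compat_r with (r := e / 2) in Hbig; [|lra].
    unfold Rdiv at 1 in Hbig; rewrite Rmult_assoc, Rinv_l, Rmult_1_r in Hbig by lra; lra. }
  pose proof (Rmax_l (b - a) (d - c)); pose proof (Rmax_r (b - a) (d - c)).
  exists (Rabs (f a c) + INR n + 1); split.
  - pose proof (Rabs_pos (f a c)); pose proof (pos_INR n); lra.
  - intros x y Hx Hy; pose proof (Hn n x y Hx Hy ltac:(lra) ltac:(lra)); lra.
Qed.

Definition nbox (a b c d e : R) : box := Box (a - e) (b + e) (c - e) (d + e).

Lemma clamp_dist (a b x e : R) : 0 <= e -> a <= b -> a - e < x < b + e ->
  exists x', a <= x' <= b /\ Rabs (x - x') <= e.
Proof.
  intros He Hab Hx; destruct (Rlt_dec x a); [exists a|destruct (Rlt_dec b x); [exists b|exists x]];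
    (split; [lra|]); apply Rabs_le; lra.
Qed.

(** On the compact rectangle 1/f is bounded by some C, so f is at least 1/C there. Uniform
    continuity with tolerance 1/C on a slightly larger closed rectangle then excludes zeros within a
    fixed distance. All margins of the later charts come from here. *)
Lemma positive_near_rectangle (f : R -> R -> R) (a b c d e0 : R) :
  a <= b -> c <= d -> 0 < e0 ->
  (forall x y, inb (nbox a b c d e0) x y -> continuity_2d_pt f x y) ->
  (forall x y, a <= x <= b -> c <= y <= d -> 0 < f x y) ->
  exists e, 0 < e <= e0 /\ forall x y, inb (nbox a b c d e) x y -> 0 < f x y.
Proof.
  intros Hab Hcd He0 Hf Hpos.
  assert (Hin : forall x y, a - e0 / 2 <= x <= b + e0 / 2 -> c - e0 / 2 <= y <= d + e0 / 2 ->
            continuity_2d_pt f x y).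
  { intros x y Hx Hy; apply Hf; split; simpl; lra. }
  destruct (bounded_on_rectangle (fun x y => / f x y) a b c d) as (C & HC & HfC).
  { intros x y Hx Hy; apply continuity_2d_pt_inv; [apply Hin; lra|].
    apply Rgt_not_eq, Hpos; auto. }
  assert (HiC : 0 < / C) by now apply Rinv_0_lt_compat.
  destruct (uniform_continuity_2d f _ _ _ _ Hin (mkposreal _ HiC)) as [g Hg]; simpl in Hg.
  assert (He : 0 < Rmin (g / 2) (e0 / 2)).
  { apply Rmin_glb_lt; [|lra]; pose proof (cond_pos g); lra. }
  pose proof (Rmin_l (g / 2) (e0 / 2)); pose proof (Rmin_r (g / 2) (e0 / 2)).
  pose proof (cond_pos g) as Hg0.
  exists (Rmin (g / 2) (e0 / 2)); split; [lra|].
  set (e := Rmin (g / 2) (e0 / 2)) in *.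
  intros x y [Hx Hy]; simpl in Hx, Hy.
  destruct (clamp_dist a b x e) as (x' & Hx' & Hxx); try lra.
  destruct (clamp_dist c d y e) as (y' & Hy' & Hyy); try lra.
  pose proof (Hg x' y' x y ltac:(lra) ltac:(lra) ltac:(lra) ltac:(lra)
                ltac:(lra) ltac:(lra)) as Hlt.
  pose proof (HfC x' y' Hx' Hy') as Hinv; pose proof (Hpos x' y' Hx' Hy') as Hp.
  rewrite Rabs_pos_eq in Hinv by (left; now apply Rinv_0_lt_compat).
  assert (Hle : / C <= f x' y').
  { rewrite <- (Rinv_inv (f x' y')); apply Rinv_le_contravar; auto.
    now apply Rinv_0_lt_compat. }
  apply Rabs_def2 in Hlt; lra.
Qed.

(** * Integrals depending on a parameter *)

Lemma box_segment (B : box) (x0 x y t : R) :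
  xl B < x0 < xr B -> inb B x y -> Rmin x0 x <= t <= Rmax x0 x -> inb B t y.
Proof.
  intros H0 [Hx Hy] Ht; split; auto.
  revert Ht; unfold Rmin, Rmax; destruct (Rle_dec x0 x); lra.
Qed.

Lemma Cn_ex_RInt (B : box) (n : nat) (k : R -> R -> R) (x0 x y : R) :
  Cn B n k -> xl B < x0 < xr B -> inb B x y -> ex_RInt (fun t => k t y) x0 x.
Proof.
  intros Hk H0 Hxy; apply (ex_RInt_continuous (V := R_CompleteNormedModule)); intros t Ht.
  apply (continuity_2d_pt_slice1 k), (Cn_continuous B n); auto; now apply (box_segment B x0 x).
Qed.

Lemma RInt_primitive_x (B : box) (n : nat) (k : R -> R -> R) (x0 x y : R) :
  Cn B n k -> xl B < x0 < xr B -> inb B x y ->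
  is_derive (fun t => RInt (fun z => k z y) x0 t) x (k x y).
Proof.
  intros Hk H0 Hxy; apply (is_derive_RInt (fun z => k z y) _ x0).
  - generalize (inb_locally_x _ _ _ Hxy); apply filter_imp; intros t Ht.
    apply (RInt_correct (V := R_CompleteNormedModule)).
    now apply (Cn_ex_RInt B n).
  - apply (continuity_2d_pt_slice1 k), (Cn_continuous B n); auto.
Qed.

Lemma RInt_derive_param (B : box) (k ky : R -> R -> R) (x0 x y : R) :
  xl B < x0 < xr B -> Cn B 0 k -> Cn B 0 ky ->
  (forall x y, inb B x y -> is_derive (fun t => k x t) y (ky x y)) -> inb B x y ->
  is_derive (fun v => RInt (fun t => k t v) x0 x) y (RInt (fun t => ky t y) x0 x).
Proof.
  intros H0 Hk Hky Hd Hxy.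
  assert (Hky' : RInt (fun t => ky t y) x0 x =
            RInt (fun t => Derive (fun u => (fun u t => k t u) u t) y) x0 x).
  { apply RInt_ext; intros t Ht; symmetry; apply is_derive_unique.
    apply Hd, (box_segment B x0 x); auto; lra. }
  rewrite Hky'.
  apply (is_derive_RInt_param (fun u t => k t u)).
  - generalize (inb_locally_y _ _ _ Hxy); apply filter_imp; intros v Hv t Ht.
    exists (ky t v); apply Hd, (box_segment B x0 x); auto.
  - intros t Ht.
    assert (Hty : inb B t y) by now apply (box_segment B x0 x).
    apply (continuity_2d_pt_swap (fun v u => Derive (fun z : R => k v z) u)).
    apply (continuity_2d_pt_ext_loc ky); [|now apply Hky].
    destruct (inb_locally_2d _ _ _ Hty) as [d Hdd]; exists d; intros u v Hu Hv.
    symmetry; apply is_derive_unique, Hd; auto.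
  - generalize (inb_locally_y _ _ _ Hxy); apply filter_imp; intros v Hv.
    now apply (Cn_ex_RInt B 0).
Qed.

(** The partial in the upper limit is k itself and the partial in the parameter is the integral of a
    partial of k, so the induction closes. Only the joint continuity at order 0 needs an
    estimate. *)
Lemma Cn_RInt (B : box) (n : nat) (k : R -> R -> R) (x0 : R) :
  xl B < x0 < xr B -> Cn B n k -> Cn B n (fun x y => RInt (fun t => k t y) x0 x).
Proof.
  intros H0; revert k; induction n as [|n IH]; intros k Hk.
  - intros x y Hxy eps.
    pose proof (RInt_primitive_x B 0 k x0 x y Hk H0 Hxy) as Hd.
    assert (Hc : continuous (fun t => RInt (fun z => k z y) x0 t) x).
    { apply (ex_derive_continuous (K := R_AbsRing) (V := R_NormedModule)).
      exists (k x y); exact Hd. }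
    destruct Hxy as [Hx Hy].
    (* Midpoints towards the edges of the box give a closed rectangle inside it, with x0 and x
       strictly between a and b, on which k is uniformly continuous. *)
    set (a := (xl B + Rmin x0 x) / 2); set (b := (xr B + Rmax x0 x) / 2).
    assert (Hab : xl B < a < x0 /\ a < x /\ x0 < b < xr B /\ x < b).
    { unfold a, b, Rmin, Rmax; destruct (Rle_dec x0 x); lra. }
    set (c := (yl B + y) / 2); set (d := (yr B + y) / 2).
    assert (Hcd : yl B < c < y /\ y < d < yr B) by (unfold c, d; lra).
    assert (Heps : 0 < eps / 2 / (b - a)).
    { pose proof (cond_pos eps); repeat apply Rdiv_lt_0_compat; lra. }
    destruct (uniform_continuity_2d k a b c d) with (eps := mkposreal _ Heps) as [g Hg].
    { intros u v Hu Hv; apply Hk; split; lra. }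
    simpl in Hg.
    pose proof (proj1 (continuity_pt_locally _ _)
                  (proj2 (continuity_pt_filterlim _ _) Hc) (pos_div_2 eps)) as [g1 Hg1].
    (* Here [rad_integrand] is a radius around x, not the integrand that bears this name later. *)
    destruct (open_interval_nbhd a b x) as [rad_integrand Hg2]; [lra|].
    destruct (open_interval_nbhd c d y) as [g3 Hg3]; [lra|].
    assert (Hm : 0 < Rmin (Rmin g g1) (Rmin rad_integrand g3)).
    { repeat apply Rmin_glb_lt; apply cond_pos. }
    exists (mkposreal _ Hm); simpl; intros u v Hu Hv.
    apply Rmin_Rgt in Hu; destruct Hu as [Hu1 Hu2].
    apply Rmin_Rgt in Hu1; apply Rmin_Rgt in Hu2.
    apply Rmin_Rgt in Hv; destruct Hv as [Hv1 Hv2].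
    apply Rmin_Rgt in Hv1; apply Rmin_Rgt in Hv2.
    assert (Hu' : a < u < b) by (apply Hg2; lra).
    assert (Hv' : c < v < d) by (apply Hg3; lra).
    assert (Hu1' : Rabs (RInt (fun z => k z y) x0 u - RInt (fun z => k z y) x0 x) < eps / 2).
    { apply (Hg1 u); unfold ball; simpl; unfold AbsRing_ball, abs, minus, plus, opp; simpl.
      apply Hu1. }
    assert (Hi1 : ex_RInt (fun t => k t v) x0 u) by (apply (Cn_ex_RInt B 0); auto; split; lra).
    assert (Hi2 : ex_RInt (fun t => k t y) x0 u) by (apply (Cn_ex_RInt B 0); auto; split; lra).
    assert (Hdiff : Rabs (RInt (fun t => k t v) x0 u - RInt (fun t => k t y) x0 u) <= eps / 2).
    { replace (RInt (fun t => k t v) x0 u - RInt (fun t => k t y) x0 u)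
        with (RInt (fun t => minus (k t v) (k t y)) x0 u)
        by exact (RInt_minus (fun t => k t v) (fun t => k t y) x0 u Hi1 Hi2).
      apply Rle_trans with (Rabs (u - x0) * (eps / 2 / (b - a))).
      - apply abs_RInt_le; [now apply (ex_RInt_minus (V := R_NormedModule))|].
        intros t Ht; left; apply Hg; try lra;
          try (revert Ht; unfold Rmin, Rmax; destruct (Rle_dec x0 u); lra).
        rewrite Rminus_eq_0, Rabs_R0; apply cond_pos.
      - apply Rle_trans with ((b - a) * (eps / 2 / (b - a))).
        + apply Rmult_le_compat_r; [lra|]; apply Rabs_le; lra.
        + right; field; lra. }
    replace (RInt (fun t => k t v) x0 u - RInt (fun t => k t y) x0 x) with
      ((RInt (fun t => k t v) x0 u - RInt (fun t => k t y) x0 u) +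
       (RInt (fun t => k t y) x0 u - RInt (fun t => k t y) x0 x)) by ring.
    eapply Rle_lt_trans; [apply Rabs_triang|]; lra.
  - pose proof (Cn_le _ _ _ Hk) as Hk'; pose proof Hk as (kx & ky & Hd & Hkx & Hky).
    exists k, (fun x y => RInt (fun t => ky t y) x0 x); split; [|auto].
    intros x y Hxy; split; [now apply (RInt_primitive_x B (S n))|].
    apply (RInt_derive_param B k ky); auto.
    + intros u v Huv; now apply (Cn_continuous B n).
    + intros u v Huv; now apply (Cn_continuous B n).
    + intros u v Huv; now apply Hd.
Qed.

Lemma smooth_RInt (B : box) (k : R -> R -> R) (x0 : R) :
  xl B < x0 < xr B -> smooth B k -> smooth B (fun x y => RInt (fun t => k t y) x0 x).
Proof. intros H0 Hk n; now apply Cn_RInt. Qed.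

(** * Implicit functions *)

Lemma implicit_is_derive (H : R -> R -> R) (y : R -> R) (x0 p b : R) :
  differentiable_pt_lim H (y x0) x0 p b -> p <> 0 -> continuous y x0 ->
  locally x0 (fun x => H (y x) x = H (y x0) x0) -> is_derive y x0 (- b / p).
Proof.
  intros HH Hp Hy [d1 Hloc].
  apply is_derive_Reals; intros eps Heps.
  set (k := Rabs (b / p)); assert (Hk : 0 <= k) by apply Rabs_pos.
  assert (Hp' : 0 < Rabs p) by now apply Rabs_pos_lt.
  (* Let D and h be the increments of y and x. The bound e <= 1/2 lets e |D| be absorbed, whence |D|
     <= (2 k + 1) |h|. The error e (|D| + |h|) is then at most e (2 k + 2) |h|, which the constant 2
     k + 3 makes strictly smaller than eps |h|. *)
  set (e := Rmin (1 / 2) (eps / (2 * k + 3))).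
  assert (He : 0 < e /\ e <= 1 / 2 /\ e * (2 * k + 3) <= eps).
  { assert (0 < eps / (2 * k + 3)) by (apply Rdiv_lt_0_compat; lra).
    split; [apply Rmin_glb_lt; lra|]; split; [apply Rmin_l|].
    apply Rle_trans with (eps / (2 * k + 3) * (2 * k + 3)); [|right; field; lra].
    apply Rmult_le_compat_r; [lra | apply Rmin_r]. }
  assert (Hpe : 0 < Rabs p * e) by (apply Rmult_lt_0_compat; lra).
  destruct (HH (mkposreal _ Hpe)) as [d2 Hd2]; simpl in Hd2.
  destruct (proj1 (continuity_pt_locally _ _)
              (proj2 (continuity_pt_filterlim _ _) Hy) d2) as [d3 Hd3].
  assert (Hm : 0 < Rmin d1 (Rmin d2 d3)).
  { repeat apply Rmin_glb_lt; apply cond_pos. }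
  exists (mkposreal _ Hm); simpl; intros h Hh0 Hh.
  apply Rmin_Rgt in Hh; destruct Hh as [Hh1 Hh2]; apply Rmin_Rgt in Hh2.
  assert (Hball : Rabs (x0 + h - x0) = Rabs h) by (f_equal; ring).
  assert (HD : Rabs (y (x0 + h) - y x0) < d2).
  { apply Hd3; unfold ball; simpl; unfold AbsRing_ball, abs, minus, plus, opp; simpl.
    fold (x0 + h - x0); rewrite Hball; lra. }
  assert (Heq : H (y (x0 + h)) (x0 + h) = H (y x0) x0).
  { apply Hloc; unfold ball; simpl; unfold AbsRing_ball, abs, minus, plus, opp; simpl.
    fold (x0 + h - x0); rewrite Hball; lra. }
  specialize (Hd2 (y (x0 + h)) (x0 + h) HD ltac:(rewrite Hball; lra)).
  rewrite Heq, Hball in Hd2; set (D := y (x0 + h) - y x0) in *.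
  assert (Hmax : Rmax (Rabs D) (Rabs h) <= Rabs D + Rabs h).
  { pose proof (Rabs_pos D); pose proof (Rabs_pos h); apply Rmax_lub; lra. }
  assert (Hdk : Rabs (D + b / p * h) <= e * (Rabs D + Rabs h)).
  { apply Rmult_le_reg_l with (Rabs p); auto.
    rewrite <- Rabs_mult, <- Rmult_assoc.
    replace (p * (D + b / p * h)) with (- (H (y x0) x0 - H (y x0) x0 - (p * D + b * (x0 + h - x0))))
      by (field; auto).
    rewrite Rabs_Ropp; eapply Rle_trans; [apply Hd2|].
    apply Rmult_le_compat_l; lra. }
  assert (Hh' : 0 < Rabs h) by now apply Rabs_pos_lt.
  assert (HDk : Rabs D <= (2 * k + 1) * Rabs h).
  { pose proof (Rabs_triang (D + b / p * h) (- (b / p * h))) as Ht.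
    replace (D + b / p * h + - (b / p * h)) with D in Ht by ring.
    rewrite Rabs_Ropp, Rabs_mult in Ht; fold k in Ht.
    pose proof (Rabs_pos D).
    assert (e * (Rabs D + Rabs h) <= 1 / 2 * (Rabs D + Rabs h))
      by (apply Rmult_le_compat_r; lra).
    lra. }
  replace (D / h - - b / p) with ((D + b / p * h) / h) by (field; auto).
  unfold Rdiv at 1; rewrite Rabs_mult, Rabs_inv.
  apply Rmult_lt_reg_r with (Rabs h); auto.
  rewrite Rmult_assoc, Rinv_l, Rmult_1_r by lra.
  eapply Rle_lt_trans; [apply Hdk|].
  apply Rle_lt_trans with (e * ((2 * k + 2) * Rabs h)).
  - apply Rmult_le_compat_l; lra.
  - nra.
Qed.

Lemma mvt_closed (f df : R -> R) (a b : R) :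
  a < b -> (forall x, a <= x <= b -> is_derive f x (df x)) ->
  exists c, a <= c <= b /\ f b - f a = df c * (b - a).
Proof.
  intros Hab H; pose proof (MVT_gen f a b df) as HM; simpl in HM.
  rewrite Rmin_left, Rmax_right in HM by lra; apply HM.
  - intros x Hx; apply H; lra.
  - intros x Hx; apply continuity_pt_filterlim.
    apply (ex_derive_continuous (K := R_AbsRing) (V := R_NormedModule)).
    exists (df x); apply H; lra.
Qed.

Lemma strictly_decreasing_of_derive (f df : R -> R) (a b : R) :
  a < b -> (forall x, a <= x <= b -> is_derive f x (df x) /\ df x < 0) -> f b < f a.
Proof.
  intros Hab H.
  destruct (MVT_gen f a b df) as (c & Hc & E).
  - rewrite Rmin_left, Rmax_right by lra; intros x Hx; apply H; lra.
  - rewrite Rmin_left, Rmax_right by lra; intros x Hx.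
    apply continuity_pt_filterlim, (ex_derive_continuous (K := R_AbsRing) (V := R_NormedModule)).
    exists (df x); apply H; lra.
  - rewrite Rmin_left, Rmax_right in Hc by lra; destruct (H c Hc) as [_ Hn]; nra.
Qed.

Lemma d1_neg_decreasing (V : box) (J : R -> R -> R) (u v y : R) :
  smooth V J -> (forall x y, inb V x y -> d1 J x y < 0) ->
  inb V u y -> inb V v y -> u < v -> J v y < J u y.
Proof.
  intros HJ Hn [Hu Hy] [Hv _] Huv.
  apply (strictly_decreasing_of_derive (fun t => J t y) (fun t => d1 J t y)); auto.
  intros x Hx; assert (inb V x y) by (split; [lra | auto]).
  split; [now apply (smooth_is_derive V) | auto].
Qed.

Lemma d1_neg_reflects_lt (V : box) (J : R -> R -> R) (u v y : R) :
  smooth V J -> (forall x y, inb V x y -> d1 J x y < 0) ->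
  inb V u y -> inb V v y -> J v y < J u y -> u < v.
Proof.
  intros HJ Hn Hu Hv Hlt; destruct (Rtotal_order u v) as [H|[H|H]]; auto.
  - subst; lra.
  - pose proof (d1_neg_decreasing V J v u y HJ Hn Hv Hu H); lra.
Qed.

Lemma d1_neg_injective (V : box) (J : R -> R -> R) (u v y : R) :
  smooth V J -> (forall x y, inb V x y -> d1 J x y < 0) ->
  inb V u y -> inb V v y -> J v y = J u y -> u = v.
Proof.
  intros HJ Hn Hu Hv E; destruct (Rtotal_order u v) as [H|[H|H]]; auto.
  - pose proof (d1_neg_decreasing V J u v y HJ Hn Hu Hv H); lra.
  - pose proof (d1_neg_decreasing V J v u y HJ Hn Hv Hu H); lra.
Qed.

Section Implicit.

Variables (V B : box) (J tau q : R -> R -> R).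
Hypothesis Hyl : yl V = yl B.
Hypothesis Hyr : yr V = yr B.
Hypothesis HJ : smooth V J.
Hypothesis HJn : forall x y, inb V x y -> d1 J x y < 0.
Hypothesis Htau : smooth B tau.
Hypothesis Hq : forall x y, inb B x y -> xl V < q x y < xr V /\ J (q x y) y = tau x y.

Lemma implicit_in_box (x y : R) : inb B x y -> inb V (q x y) y.
Proof. intros Hxy; split; [apply Hq; auto | rewrite Hyl, Hyr; apply Hxy]. Qed.

Lemma implicit_one_side (u x y : R) :
  inb B x y -> xl V < u < xr V ->
  continuity_2d_pt (fun v w => J u w - tau v w) x y.
Proof.
  intros Hxy Hu; apply continuity_2d_pt_minus; [|now apply (smooth_continuous B)].
  apply (smooth_continuous B (fun v w => J u w)); auto.
  apply (smooth_comp V B J (fun _ _ => u) (fun _ w => w)); auto.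
  - intros v w [Hv Hw]; split; [auto|]; rewrite Hyl, Hyr; auto.
  - apply smooth_const.
  - apply smooth_snd.
Qed.

(** Strict monotonicity of J in its first variable does the work: the inequalities J up y < tau x y
    < J dn y persist near (x, y), because both differences are continuous, and they trap q between
    dn and up. *)
Lemma implicit_continuous (x y : R) : inb B x y -> continuity_2d_pt q x y.
Proof.
  intros Hxy eps; destruct (Hq x y Hxy) as [Hr E].
  set (up := Rmin (q x y + eps) ((q x y + xr V) / 2)).
  set (dn := Rmax (q x y - eps) ((q x y + xl V) / 2)).
  pose proof (cond_pos eps) as Heps.
  assert (Hup : q x y < up /\ up <= q x y + eps /\ up < xr V).
  { unfold up, Rmin; destruct (Rle_dec _ _); lra. }
  assert (Hdn : xl V < dn /\ q x y - eps <= dn /\ dn < q x y).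
  { unfold dn, Rmax; destruct (Rle_dec _ _); lra. }
  assert (HyV : yl V < y < yr V) by (rewrite Hyl, Hyr; apply Hxy).
  assert (H1 : J up y - tau x y < 0).
  { rewrite <- E; pose proof (d1_neg_decreasing V J (q x y) up y HJ HJn
      ltac:(split; auto) ltac:(split; [lra|auto]) ltac:(lra)); lra. }
  assert (H2 : 0 < J dn y - tau x y).
  { rewrite <- E; pose proof (d1_neg_decreasing V J dn (q x y) y HJ HJn
      ltac:(split; [lra|auto]) ltac:(split; auto) ltac:(lra)); lra. }
  destruct (implicit_one_side up x y Hxy ltac:(lra)
              (mkposreal (- (J up y - tau x y)) ltac:(lra))) as [e1 He1].
  destruct (implicit_one_side dn x y Hxy ltac:(lra) (mkposreal _ H2)) as [e2 He2].
  destruct (inb_locally_2d _ _ _ Hxy) as [e3 He3]; simpl in He1, He2.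
  assert (Hm : 0 < Rmin e1 (Rmin e2 e3)) by (repeat apply Rmin_glb_lt; apply cond_pos).
  exists (mkposreal _ Hm); simpl; intros u v Hu Hv.
  apply Rmin_Rgt in Hu; destruct Hu as [Hu1 Hu2]; apply Rmin_Rgt in Hu2.
  apply Rmin_Rgt in Hv; destruct Hv as [Hv1 Hv2]; apply Rmin_Rgt in Hv2.
  assert (Huv : inb B u v) by (apply He3; lra).
  specialize (He1 u v ltac:(lra) ltac:(lra)); specialize (He2 u v ltac:(lra) ltac:(lra)).
  apply Rabs_def2 in He1; apply Rabs_def2 in He2.
  destruct (Hq u v Huv) as [Hr' E'].
  assert (HvV : yl V < v < yr V) by (rewrite Hyl, Hyr; apply Huv).
  assert (q u v < up).
  { apply (d1_neg_reflects_lt V J _ _ v); auto; try (split; [lra|auto]); lra. }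
  assert (dn < q u v).
  { apply (d1_neg_reflects_lt V J _ _ v); auto; try (split; [lra|auto]); lra. }
  apply Rabs_def1; lra.
Qed.

Lemma implicit_derive_x (x y : R) :
  inb B x y -> is_derive (fun t => q t y) x (d1 tau x y / d1 J (q x y) y).
Proof.
  intros Hxy; pose proof (implicit_in_box x y Hxy) as HV.
  (* With y frozen, the second variable of [W] is the first variable of tau. *)
  set (W := Box (xl V) (xr V) (xl B) (xr B)).
  set (H := fun u t => J u y - tau t y).
  assert (HW : inb W (q x y) x) by (split; [apply HV | apply Hxy]).
  assert (HH : smooth W H).
  { apply smooth_minus.
    - apply (smooth_comp V W J (fun u _ => u) (fun _ _ => y)); auto.
      + intros u v [Hu _]; split; [exact Hu | apply HV].
      + apply smooth_fst.
      + apply smooth_const.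
    - apply (smooth_comp B W tau (fun _ t => t) (fun _ _ => y)); auto.
      + intros u v [_ Hv]; split; [exact Hv | apply Hxy].
      + apply smooth_snd.
      + apply smooth_const. }
  assert (E1 : d1 H (q x y) x = d1 J (q x y) y).
  { apply is_derive_unique; unfold H.
    replace (d1 J (q x y) y) with (minus (d1 J (q x y) y) 0)
      by (unfold minus, plus, opp; simpl; ring).
    apply (is_derive_minus (fun t => J t y) (fun _ => tau x y)).
    - now apply (smooth_is_derive V).
    - apply (is_derive_const (tau x y)). }
  assert (E2 : d2 H (q x y) x = - d1 tau x y).
  { apply is_derive_unique; unfold H.
    replace (- d1 tau x y) with (minus 0 (d1 tau x y))
      by (unfold minus, plus, opp; simpl; ring).
    apply (is_derive_minus (fun _ => J (q x y) y) (fun t => tau t y)).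
    - apply (is_derive_const (J (q x y) y)).
    - now apply (smooth_is_derive B). }
  pose proof (HJn _ _ HV) as Hn.
  replace (d1 tau x y / d1 J (q x y) y) with (- d2 H (q x y) x / d1 H (q x y) x)
    by (rewrite E1, E2; field; lra).
  apply (implicit_is_derive H (fun t => q t y) x).
  - now apply (smooth_differentiable W).
  - rewrite E1; lra.
  - now apply (continuity_2d_pt_slice1 q), implicit_continuous.
  - generalize (inb_locally_x _ _ _ Hxy); apply filter_imp; intros t Ht; unfold H.
    destruct (Hq t y Ht), (Hq x y Hxy); lra.
Qed.

Lemma implicit_derive_y (x y : R) :
  inb B x y ->
  is_derive (fun t => q x t) y ((d2 tau x y - d2 J (q x y) y) / d1 J (q x y) y).
Proof.
  intros Hxy; pose proof (implicit_in_box x y Hxy) as HV.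
  set (H := fun u t => J u t - tau x t).
  assert (HH : smooth V H).
  { apply smooth_minus; auto.
    apply (smooth_comp B V tau (fun _ _ => x) (fun _ t => t)); auto.
    - intros u v [_ Hv]; split; [apply Hxy | rewrite <- Hyl, <- Hyr; exact Hv].
    - apply smooth_const.
    - apply smooth_snd. }
  assert (E1 : d1 H (q x y) y = d1 J (q x y) y).
  { apply is_derive_unique; unfold H.
    replace (d1 J (q x y) y) with (minus (d1 J (q x y) y) 0)
      by (unfold minus, plus, opp; simpl; ring).
    apply (is_derive_minus (fun t => J t y) (fun _ => tau x y)).
    - now apply (smooth_is_derive V).
    - apply (is_derive_const (tau x y)). }
  assert (E2 : d2 H (q x y) y = d2 J (q x y) y - d2 tau x y).
  { apply is_derive_unique; unfold H.
    apply (is_derive_minus (fun t => J (q x y) t) (fun t => tau x t)).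
    - now apply (smooth_is_derive V).
    - now apply (smooth_is_derive B). }
  pose proof (HJn _ _ HV) as Hn.
  replace ((d2 tau x y - d2 J (q x y) y) / d1 J (q x y) y)
    with (- d2 H (q x y) y / d1 H (q x y) y) by (rewrite E1, E2; field; lra).
  apply (implicit_is_derive H (fun t => q x t) y).
  - now apply (smooth_differentiable V).
  - rewrite E1; lra.
  - now apply (continuity_2d_pt_slice2 q), implicit_continuous.
  - generalize (inb_locally_y _ _ _ Hxy); apply filter_imp; intros t Ht; unfold H.
    destruct (Hq x t Ht), (Hq x y Hxy); lra.
Qed.

(** A bootstrap: the partials of q are expressed through q and smooth functions, so order n for q
    gives order n for its partials. *)
Lemma implicit_smooth : smooth B q.
Proof.
  intros n; induction n as [|n IH].
  - intros x y Hxy; now apply implicit_continuous.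
  - exists (fun x y => d1 tau x y / d1 J (q x y) y),
      (fun x y => (d2 tau x y - d2 J (q x y) y) / d1 J (q x y) y).
    split; [intros x y Hxy; split; [now apply implicit_derive_x | now apply implicit_derive_y]|].
    assert (Hc : forall g, smooth V g -> Cn B n (fun x y => g (q x y) y)).
    { intros g Hg; apply (Cn_comp V B n g q (fun _ y => y)); auto.
      - apply implicit_in_box.
      - apply Cn_snd. }
    assert (H0 : forall x y, inb B x y -> d1 J (q x y) y <> 0).
    { intros x y Hxy; apply Rlt_not_eq, HJn, implicit_in_box, Hxy. }
    split; apply Cn_div; auto.
    + now apply (smooth_d1 B).
    + now apply Hc, smooth_d1.
    + apply Cn_minus; [now apply (smooth_d2 B) | now apply Hc, smooth_d2].
    + now apply Hc, smooth_d1.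
Qed.

End Implicit.

(** * The angular variable *)

Definition w1 (q s : R) : R := 1 - s + s * q ^ 2.

(* [ang (tan th / tan t) t = th]; written with [tan (t - th)] so that it makes sense for
   every [t]. *)
Definition ang (q t : R) : R :=
  t - atan ((1 - q) * (sin t * cos t) / (cos t ^ 2 + q * sin t ^ 2)).

Lemma sin2_cos2_pow (t : R) : sin t ^ 2 + cos t ^ 2 = 1.
Proof. rewrite <- (sin2_cos2 t); unfold Rsqr; ring. Qed.

Lemma sin2_bounds (t : R) : 0 <= sin t ^ 2 <= 1.
Proof.
  pose proof (sin2_cos2_pow t); pose proof (pow2_ge_0 (sin t)); pose proof (pow2_ge_0 (cos t)); lra.
Qed.

Lemma w1_sin (q t : R) : w1 q (sin t ^ 2) = cos t ^ 2 + q ^ 2 * sin t ^ 2.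
Proof. unfold w1; pose proof (sin2_cos2_pow t); nra. Qed.

Lemma ang_den_pos (q t : R) : 0 < q -> 0 < cos t ^ 2 + q * sin t ^ 2.
Proof.
  intros Hq; pose proof (sin2_cos2_pow t); pose proof (pow2_ge_0 (cos t)).
  pose proof (sin2_bounds t).
  destruct (Req_dec (sin t ^ 2) 0) as [E|E]; [rewrite E in *; lra|].
  assert (0 < q * sin t ^ 2) by (apply Rmult_lt_0_compat; lra); lra.
Qed.

Lemma w1_sin_pos (q t : R) : 0 < q -> 0 < w1 q (sin t ^ 2).
Proof. intros Hq; rewrite w1_sin; apply ang_den_pos, pow_lt, Hq. Qed.

(** With s = sin t and c = cos t this rests on (c^2 + q s^2)^2 + (1 - q)^2 s^2 c^2 = (c^2 + q^2 s^2)
    (c^2 + s^2). The left side is 1 / cos (t - ang q t), the form in which [sin_atan] and [cos_atan]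
    produce it. *)
Lemma ang_sqrt (q t : R) : 0 < q ->
  sqrt (1 + ((1 - q) * (sin t * cos t) / (cos t ^ 2 + q * sin t ^ 2))²) =
  sqrt (w1 q (sin t ^ 2)) / (cos t ^ 2 + q * sin t ^ 2).
Proof.
  intros Hq; pose proof (ang_den_pos q t Hq) as Hd; pose proof (w1_sin_pos q t Hq) as Hw.
  rewrite <- (sqrt_pow2 (sqrt (w1 q (sin t ^ 2)) / (cos t ^ 2 + q * sin t ^ 2))).
  - f_equal; unfold Rdiv at 2; rewrite Rpow_mult_distr, pow2_sqrt by lra.
    rewrite w1_sin; unfold Rsqr; pose proof (sin2_cos2_pow t) as Hsc.
    set (c := cos t) in *; set (s := sin t) in *.
    apply Rmult_eq_reg_r with ((c ^ 2 + q * s ^ 2) ^ 2); [|apply pow_nonzero; lra].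
    field_simplify; try lra.
    transitivity ((c ^ 2 + q ^ 2 * s ^ 2) * (s ^ 2 + c ^ 2)); [ring | rewrite Hsc; ring].
  - apply Rdiv_le_0_compat; auto; apply sqrt_pos.
Qed.

Lemma sin_ang (q t : R) : 0 < q -> sin (ang q t) = q * sin t / sqrt (w1 q (sin t ^ 2)).
Proof.
  intros Hq; unfold ang; rewrite sin_minus, sin_atan, cos_atan, ang_sqrt by auto.
  pose proof (ang_den_pos q t Hq) as Hd.
  pose proof (sqrt_lt_R0 _ (w1_sin_pos q t Hq)) as Hw; pose proof (sin2_cos2_pow t) as Hsc.
  set (z := sqrt (w1 q (sin t ^ 2))) in *.
  transitivity (q * sin t * (sin t ^ 2 + cos t ^ 2) / z); [|rewrite Hsc; field; lra].
  field; split; lra.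
Qed.

Lemma cos_ang (q t : R) : 0 < q -> cos (ang q t) = cos t / sqrt (w1 q (sin t ^ 2)).
Proof.
  intros Hq; unfold ang; rewrite cos_minus, sin_atan, cos_atan, ang_sqrt by auto.
  pose proof (ang_den_pos q t Hq) as Hd.
  pose proof (sqrt_lt_R0 _ (w1_sin_pos q t Hq)) as Hw; pose proof (sin2_cos2_pow t) as Hsc.
  set (z := sqrt (w1 q (sin t ^ 2))) in *.
  transitivity (cos t * (sin t ^ 2 + cos t ^ 2) / z); [|rewrite Hsc; field; lra].
  field; split; lra.
Qed.

(** This is the derivative of the relation tan th = q tan t, cleared of tangents so that it also
    holds at t = PI / 2. With [N] / [D] the argument of the arctangent, D^2 + N^2 = w1 turns the
    derivative of the arctangent into D^2 / w1. *)
Lemma is_derive_ang (p z : R -> R) (x dp dz : R) :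
  0 < p x -> is_derive p x dp -> is_derive z x dz ->
  is_derive (fun u => ang (p u) (z u)) x
    ((sin (z x) * cos (z x) * dp + p x * dz) / w1 (p x) (sin (z x) ^ 2)).
Proof.
  intros Hp Hdp Hdz; unfold ang.
  pose proof (ang_den_pos (p x) (z x) Hp) as Hd; pose proof (w1_sin_pos (p x) (z x) Hp) as Hw.
  set (N := fun u => (1 - p u) * (sin (z u) * cos (z u))).
  set (D := fun u => cos (z u) ^ 2 + p u * sin (z u) ^ 2).
  set (q := p x) in *; set (s := sin (z x)) in *; set (c := cos (z x)) in *.
  assert (Ep : Derive (fun u => p u) x = dp) by now apply is_derive_unique.
  assert (Ez : Derive (fun u => z u) x = dz) by now apply is_derive_unique.
  assert (HN : is_derive N x (- dp * (s * c) + (1 - q) * ((c ^ 2 - s ^ 2) * dz))).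
  { unfold N; auto_derive; [repeat split; (now exists dp) || (now exists dz)|].
    rewrite Ep, Ez; fold q s c; ring. }
  assert (HD : is_derive D x (- 2 * (c * s) * dz + dp * s ^ 2 + 2 * q * (s * c) * dz)).
  { unfold D; auto_derive; [repeat split; (now exists dp) || (now exists dz)|].
    rewrite Ep, Ez; fold q s c; ring. }
  assert (Hsc : s ^ 2 + c ^ 2 = 1) by apply sin2_cos2_pow.
  assert (Hdw : D x ^ 2 + N x ^ 2 = w1 q (s ^ 2)).
  { unfold D, N, s; rewrite w1_sin; fold q s c.
    transitivity ((c ^ 2 + q ^ 2 * s ^ 2) * (s ^ 2 + c ^ 2)); [ring | rewrite Hsc; ring]. }
  assert (HDx : 0 < D x) by exact Hd.
  evar_last.
  - apply (is_derive_minus z (fun u => atan (N u / D u))); [exact Hdz|].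
    apply (is_derive_comp atan (fun u => N u / D u)).
    + apply is_derive_Reals, derivable_pt_lim_atan.
    + apply (is_derive_div N D); [exact HN | exact HD | lra].
  - unfold minus, plus, opp, scal; simpl; unfold mult; simpl.
    fold (N x) (D x).
    set (w := w1 q (s * (s * 1))).
    assert (Hww : w = w1 q (s ^ 2)) by reflexivity.
    assert (Hk : / (1 + N x / D x * (N x / D x * 1)) = D x ^ 2 / w).
    { rewrite Hww, <- Hdw; field; split; [lra|]; pose proof (pow2_ge_0 (N x)); nra. }
    rewrite Hk.
    replace ((- dp * (s * c) + (1 - q) * ((c * (c * 1) - s * (s * 1)) * dz)) * D x -
       N x * (-2 * (c * s) * dz + dp * (s * (s * 1)) + 2 * q * (s * c) * dz))
      with ((- dp * (s * c) + dz * (1 - q) * (c ^ 2 - q * s ^ 2)) * (s ^ 2 + c ^ 2))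
      by (unfold N, D; fold q s c; ring).
    rewrite Hsc; apply Rmult_eq_reg_r with w; [|lra].
    transitivity (dz * w + dp * (s * c) - dz * (1 - q) * (c ^ 2 - q * s ^ 2)); [field; lra|].
    transitivity (s * c * dp + q * dz); [|field; lra].
    assert (Hw' : w = c ^ 2 + q ^ 2 * s ^ 2) by apply w1_sin.
    rewrite Hw'; transitivity (s * c * dp + q * dz * (s ^ 2 + c ^ 2)); [ring | rewrite Hsc; ring].
Qed.

Lemma tan_ang (q t : R) : 0 < q -> tan (ang q t) = q * tan t.
Proof.
  intros Hq; unfold tan; rewrite sin_ang, cos_ang by auto.
  pose proof (sqrt_lt_R0 _ (w1_sin_pos q t Hq)) as Hw.
  (* Where cos t = 0 both tangents are 0, since division by 0 yields 0. *)
  destruct (Req_dec (cos t) 0) as [->|Hc]; [|field; split; lra].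
  unfold Rdiv; rewrite !Rmult_0_l, Rinv_0; ring.
Qed.

Lemma ang_reflect (q t : R) : ang q (PI - t) = PI - ang q t.
Proof.
  unfold ang; rewrite sin_PI_x, Rtrigo_facts.cos_pi_minus.
  replace ((1 - q) * (sin t * - cos t) / ((- cos t) ^ 2 + q * sin t ^ 2))
    with (- ((1 - q) * (sin t * cos t) / (cos t ^ 2 + q * sin t ^ 2)))
    by (unfold Rdiv; replace ((- cos t) ^ 2) with (cos t ^ 2) by ring; ring).
  rewrite atan_opp; ring.
Qed.

Lemma ang_0 (q : R) : ang q 0 = 0.
Proof. unfold ang, Rdiv; rewrite sin_0, !Rmult_0_l, Rmult_0_r, Rmult_0_l, atan_0; ring. Qed.

Lemma ang_PI2 (q : R) : ang q (PI / 2) = PI / 2.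
Proof. unfold ang, Rdiv at 2; rewrite cos_PI2, !Rmult_0_r, Rmult_0_l, atan_0; ring. Qed.

Lemma ang_tan (t th : R) :
  0 < t < PI / 2 -> 0 < th < PI / 2 -> ang (tan th / tan t) t = th.
Proof.
  intros Ht Hth.
  assert (Hct : 0 < cos t) by (apply cos_gt_0; lra).
  assert (Hch : 0 < cos th) by (apply cos_gt_0; lra).
  assert (Hst : 0 < sin t) by (apply sin_gt_0; lra).
  assert (Hsh : 0 < sin th) by (apply sin_gt_0; lra).
  assert (Hc : 0 < cos (t - th)) by (apply cos_gt_0; lra).
  unfold ang.
  assert (E : (1 - tan th / tan t) * (sin t * cos t) / (cos t ^ 2 + tan th / tan t * sin t ^ 2)
              = tan (t - th)).
  { unfold tan; rewrite sin_minus, cos_minus in *.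
    assert (0 < cos t * cos th * cos t + cos t * sin th * sin t) by nra.
    field; repeat split; try lra; nra. }
  rewrite E, atan_tan by lra; ring.
Qed.

(** For q <= 1 the subtracted arctangent is nonnegative, which gives the upper bound. A negative
    value would lie in (- PI / 2, 0) and have negative sine, against [sin_ang]. *)
Lemma ang_bounds (q t : R) : 0 < q <= 1 -> 0 <= t <= PI / 2 -> 0 <= ang q t <= t.
Proof.
  intros Hq Ht.
  assert (Hs : 0 <= sin t) by (apply sin_ge_0; lra).
  assert (Hc : 0 <= cos t) by (apply cos_ge_0; lra).
  pose proof (ang_den_pos q t ltac:(lra)) as Hd; unfold ang.
  set (y := (1 - q) * (sin t * cos t) / (cos t ^ 2 + q * sin t ^ 2)).
  assert (Hy : 0 <= y).
  { apply Rdiv_le_0_compat; auto; repeat apply Rmult_le_pos; lra. }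
  assert (Ha : 0 <= atan y).
  { rewrite <- atan_0; destruct Hy as [Hy|<-]; [left; now apply atan_increasing | lra]. }
  pose proof (atan_bound y).
  split; [|lra].
  destruct (Rle_dec 0 (t - atan y)) as [|Hn]; auto.
  assert (Hneg : sin (t - atan y) < 0) by (apply sin_lt_0_var; lra).
  pose proof (sin_ang q t ltac:(lra)) as E; unfold ang in E; fold y in E.
  pose proof (sqrt_lt_R0 _ (w1_sin_pos q t ltac:(lra))) as Hw.
  assert (0 <= q * sin t / sqrt (w1 q (sin t ^ 2))).
  { apply Rdiv_le_0_compat; auto; apply Rmult_le_pos; lra. }
  lra.
Qed.

Lemma ang_bounds_strict (q t : R) : 0 < q < 1 -> 0 < t < PI / 2 -> 0 < ang q t < t.
Proof.
  intros Hq Ht; destruct (ang_bounds q t) as [H1 H2]; try lra.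
  assert (Hct : 0 < cos t) by (apply cos_gt_0; lra).
  assert (Hst : 0 < sin t) by (apply sin_gt_0; lra).
  pose proof (tan_ang q t ltac:(lra)) as E; unfold tan in E.
  assert (Htan : 0 < sin t / cos t) by now apply Rdiv_lt_0_compat.
  split.
  - destruct H1 as [|H1]; auto; rewrite <- H1, sin_0 in E.
    unfold Rdiv at 1 in E; rewrite Rmult_0_l in E; nra.
  - destruct H2 as [|H2]; auto; rewrite H2 in E; nra.
Qed.

Lemma is_derive_sin2 (t : R) : is_derive (fun u => sin u ^ 2) t (2 * (sin t * cos t)).
Proof. auto_derive; auto; ring. Qed.

Lemma sin2_lt (x t1 t : R) : - t1 < x < t1 -> t1 < t < PI / 2 -> sin x ^ 2 < sin t ^ 2.
Proof.
  intros Hx Ht.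
  assert (H1 : - sin t < sin x) by (rewrite <- sin_neg; apply sin_increasing_1; lra).
  assert (H2 : sin x < sin t) by (apply sin_increasing_1; lra).
  nra.
Qed.

Lemma ang_continuity_2d (q t : R) : 0 < q -> continuity_2d_pt ang q t.
Proof.
  intros Hq; unfold ang.
  assert (Hs : forall q t, continuity_2d_pt (fun _ t => sin t) q t).
  { intros q' t'; apply (continuity_1d_2d_pt_comp sin (fun _ t => t));
      [apply continuity_sin | apply continuity_2d_pt_id2]. }
  assert (Hc : forall q t, continuity_2d_pt (fun _ t => cos t) q t).
  { intros q' t'; apply (continuity_1d_2d_pt_comp cos (fun _ t => t));
      [apply continuity_cos | apply continuity_2d_pt_id2]. }
  apply continuity_2d_pt_minus; [apply continuity_2d_pt_id2|].
  apply (continuity_1d_2d_pt_comp atan).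
  { apply derivable_continuous_pt, derivable_pt_atan. }
  apply continuity_2d_pt_mult.
  - apply continuity_2d_pt_mult; [|now apply continuity_2d_pt_mult].
    apply continuity_2d_pt_minus; [apply continuity_2d_pt_const | apply continuity_2d_pt_id1].
  - apply continuity_2d_pt_inv; [|pose proof (ang_den_pos q t Hq); lra].
    apply continuity_2d_pt_plus; simpl.
    + apply continuity_2d_pt_mult; auto; apply continuity_2d_pt_mult; auto.
      apply continuity_2d_pt_const.
    + apply continuity_2d_pt_mult; [apply continuity_2d_pt_id1|].
      apply continuity_2d_pt_mult; auto; apply continuity_2d_pt_mult; auto.
      apply continuity_2d_pt_const.
Qed.

(** * One-sided derivatives and finite sums *)

Definition cont_within (I : R -> Prop) (h : R -> R) (x : R) : Prop :=
  forall eps : posreal, exists d : posreal,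
    forall t, I t -> Rabs (t - x) < d -> Rabs (h t - h x) < eps.

Lemma cont_within_continuous (I : R -> Prop) (h : R -> R) (x : R) :
  continuous h x -> cont_within I h x.
Proof.
  intros H eps.
  destruct (proj1 (continuity_pt_locally _ _) (proj2 (continuity_pt_filterlim _ _) H) eps)
    as [d Hd].
  exists d; intros t _ Ht; now apply Hd.
Qed.

Lemma cont_within_comp_2d (I : R -> Prop) (g : R -> R -> R) (p q : R -> R) (x : R) :
  continuity_2d_pt g (p x) (q x) -> cont_within I p x -> cont_within I q x ->
  cont_within I (fun t => g (p t) (q t)) x.
Proof.
  intros Hg Hp Hq eps; destruct (Hg eps) as [d Hd].
  destruct (Hp d) as [dp Hdp], (Hq d) as [dq Hdq].
  assert (Hm : 0 < Rmin dp dq) by (apply Rmin_glb_lt; apply cond_pos).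
  exists (mkposreal _ Hm); simpl; intros t It Ht; apply Rmin_Rgt in Ht.
  apply Hd; [apply Hdp | apply Hdq]; tauto.
Qed.

(** [filterdiff] quantifies over all limits of its filter; relative to a set that contains x, the
    point x is the only one. *)
Lemma within_lim_unique (I : R -> Prop) (x y : R) :
  I x -> is_filter_lim (within I (locally x)) y -> y = x.
Proof.
  intros Ix Hy; destruct (Req_dec y x) as [|Hn]; auto; exfalso.
  assert (Hp : 0 < Rabs (x - y)) by (apply Rabs_pos_lt; lra).
  assert (Hloc : locally y (fun z => Rabs (z - y) < Rabs (x - y)))
    by (exists (mkposreal _ Hp); intros z Hz; exact Hz).
  specialize (Hy _ Hloc); unfold within in Hy.
  pose proof (locally_singleton _ _ Hy Ix); simpl in *; lra.
Qed.

Lemma is_derive_in_intro (I : R -> Prop) (f : R -> R) (x l : R) : I x ->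
  (forall eps : posreal, exists d : posreal, forall t, I t -> Rabs (t - x) < d ->
     Rabs (f t - f x - (t - x) * l) <= eps * Rabs (t - x)) ->
  is_derive_in I f x l.
Proof.
  intros Ix H; split; [apply (is_linear_scal_l (K := R_AbsRing) (V := R_NormedModule))|].
  intros y Hy.
  rewrite (within_lim_unique I x y Ix Hy).
  intros eps; destruct (H eps) as [d Hd]; exists d; intros t Ht It.
  specialize (Hd t It Ht).
  unfold norm, minus, plus, opp, scal; simpl; unfold mult, abs; simpl.
  replace (f t + - f x + - ((t + - x) * l)) with (f t - f x - (t - x) * l) by ring.
  exact Hd.
Qed.

Lemma is_derive_in_sub (I I' : R -> Prop) (f : R -> R) (x l : R) :
  (forall t, I' t -> I t) -> I' x -> is_derive_in I f x l -> is_derive_in I' f x l.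
Proof.
  intros Hs Ix [Hl H]; split; auto; intros y Hy; rewrite (within_lim_unique I' x y Ix Hy).
  assert (Hle : filter_le (within I' (locally x)) (within I (locally x))).
  { intros P; unfold within; apply filter_imp; intros z HP Hz; apply HP, Hs, Hz. }
  eapply is_domin_le; [apply H|exact Hle].
  intros P HP; unfold within; generalize HP; apply filter_imp; auto.
Qed.

Lemma mvt_within (I : R -> Prop) (h h' : R -> R) (u v : R) : u < v ->
  (forall x, u <= x <= v -> I x) -> (forall x, u <= x <= v -> cont_within I h x) ->
  (forall x, u < x < v -> is_derive h x (h' x)) ->
  exists c, u <= c <= v /\ h v - h u = h' c * (v - u).
Proof.
  intros Huv HI Hc Hd.
  (* Clamping to [u, v] turns the continuity of h relative to I into the two-sided continuity that
     [MVT_gen] requires at u and v. *)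
  set (cl := fun z => Rmax u (Rmin v z)).
  assert (Hcl : forall z, u <= cl z <= v).
  { intros z; unfold cl, Rmax, Rmin; destruct (Rle_dec v z), (Rle_dec u _); lra. }
  assert (Hcl' : forall z, u <= z <= v -> cl z = z).
  { intros z Hz; unfold cl, Rmax, Rmin; destruct (Rle_dec v z), (Rle_dec u _); lra. }
  assert (Hcl1 : forall z x, u <= x <= v -> Rabs (cl z - x) <= Rabs (z - x)).
  { intros z x Hx; unfold cl, Rmax, Rmin, Rabs.
    destruct (Rle_dec v z), (Rle_dec u _); repeat destruct (Rcase_abs _); lra. }
  pose proof (MVT_gen (fun z => h (cl z)) u v h') as HM; simpl in HM.
  rewrite Rmin_left, Rmax_right in HM by lra.
  destruct HM as (c & Hcc & E).
  - intros x Hx; apply (is_derive_ext_loc h); [|now apply Hd].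
    generalize (locally_open_interval _ _ _ Hx); apply filter_imp; intros z Hz.
    rewrite Hcl'; auto; lra.
  - intros x Hx; apply continuity_pt_locally; intros eps.
    destruct (Hc x Hx eps) as [d Hdd]; exists d; intros z Hz.
    rewrite (Hcl' x Hx); apply Hdd; auto.
    eapply Rle_lt_trans; [apply Hcl1; auto | exact Hz].
  - exists c; split; auto; rewrite !Hcl' in E by lra; auto.
Qed.

(* A derivative that extends continuously to an end point or to the exceptional point [m]
   is a derivative there. *)
Lemma derive_in_closure (a m b : R) (h h' : R -> R) :
  (forall x, a <= x <= b -> cont_within (fun t => a <= t <= b) h x) ->
  (forall x, a <= x <= b -> cont_within (fun t => a <= t <= b) h' x) ->
  (forall x, a < x < b -> x <> m -> is_derive h x (h' x)) ->
  forall x, a <= x <= b -> is_derive_in (fun t => a <= t <= b) h x (h' x).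
Proof.
  intros Hc Hc' Hd x Hx; apply is_derive_in_intro; auto; intros eps.
  destruct (Hc' x Hx eps) as [d Hd'].
  (* The radius stops at m, so that m is never strictly between x and t and the mean value theorem
     applies on that interval. *)
  assert (Hd2 : exists d2 : posreal, d2 <= d /\ (m <> x -> d2 <= Rabs (m - x))).
  { destruct (Req_dec m x) as [E|Hn].
    - exists d; split; [lra | tauto].
    - assert (Hp : 0 < Rmin d (Rabs (m - x))).
      { apply Rmin_glb_lt; [apply cond_pos | apply Rabs_pos_lt; lra]. }
      exists (mkposreal _ Hp); simpl; split; [apply Rmin_l | intros _; apply Rmin_r]. }
  destruct Hd2 as (d2 & Hd2 & Hm); exists d2; intros t It Ht.
  assert (Hmvt : exists c, Rmin x t <= c <= Rmax x t /\ h t - h x = h' c * (t - x)).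
  { assert (Hm' : forall c, Rmin x t < c < Rmax x t -> c <> m).
    { intros c Hcx ->; unfold Rmin, Rmax in Hcx.
      destruct (Req_dec m x) as [->|Hn]; [destruct (Rle_dec x t); lra|].
      specialize (Hm Hn); revert Ht Hm; unfold Rabs.
      destruct (Rle_dec x t); repeat destruct (Rcase_abs _); lra. }
    unfold Rmin, Rmax in *; destruct (Rle_dec x t) as [Hle|Hle].
    - destruct (Req_dec x t) as [->|Hne]; [exists t; split; [lra|ring]|].
      apply (mvt_within (fun t => a <= t <= b)); try lra.
      + intros; lra.
      + intros y Hy; apply Hc; lra.
      + intros y Hy; apply Hd; [lra | auto].
    - destruct (mvt_within (fun t => a <= t <= b) h h' t x) as (c & Hcc & E); try lra.
      + intros; lra.
      + intros y Hy; apply Hc; lra.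
      + intros y Hy; apply Hd; [lra | auto].
      + exists c; split; auto; lra. }
  destruct Hmvt as (c & Hcc & E).
  replace (h t - h x - (t - x) * h' x) with ((h' c - h' x) * (t - x)) by lra.
  rewrite Rabs_mult; apply Rmult_le_compat_r; [apply Rabs_pos|]; left.
  revert Hcc; unfold Rmin, Rmax; destruct (Rle_dec x t); intros Hcc.
  - apply Hd'; [lra|]; rewrite Rabs_pos_eq in * by lra; lra.
  - apply Hd'; [lra|]; rewrite Rabs_left1 in * by lra; lra.
Qed.

Lemma smooth_on_ext (I : R -> Prop) (u v : R -> R -> R) :
  (forall rs ts, I ts -> u rs ts = v rs ts) -> smooth_on I u -> smooth_on I v.
Proof.
  intros E (g & H0 & H); exists g; split; auto.
  intros rs ts Hts; rewrite H0, E; auto.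
Qed.

Lemma smooth_on_sub (I I' : R -> Prop) (u : R -> R -> R) :
  (forall t, I' t -> I t) -> smooth_on I u -> smooth_on I' u.
Proof.
  intros Hs (g & H0 & H); exists g; split; [auto|]; intros i j.
  destruct (H i j) as [Hc Hd]; split.
  - intros p Hp; eapply filterlim_filter_le_1; [|apply Hc, Hs, Hp].
    intros P; unfold within; apply filter_imp; intros x HP Hx; apply HP, Hs, Hx.
  - intros rs ts Hts; destruct (Hd rs ts (Hs ts Hts)) as [H1 H2]; split; auto.
    now apply (is_derive_in_sub I).
Qed.

(** For f on [0, 1] and z = sin^2: f is continuous only relative to [0, 1], but sin^2 never leaves
    this interval, so the composition is continuous in the ordinary sense, also where sin^2 is 0 or
    1. *)
Lemma continuous_comp_within (D : R -> Prop) (g z : R -> R) (t : R) :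
  continuous_on D g -> (forall u, D (z u)) -> continuous z t -> continuous (fun u => g (z u)) t.
Proof.
  intros Hg HD Hz P HP; specialize (Hg (z t) (HD t) P HP).
  unfold filtermap, within in *.
  generalize (Hz _ Hg); unfold filtermap; apply filter_imp; auto.
Qed.

Lemma sum2_ext (l m n : nat) (h h' : nat -> nat -> R) :
  (forall k1 k2, h k1 k2 = h' k1 k2) -> sum2 l m n h = sum2 l m n h'.
Proof. intros E; unfold sum2; apply sum_n_m_ext; intros s; apply sum_n_m_ext; auto. Qed.

(** The constants of the finitely many terms are added up before the point p is chosen; an empty sum
    takes the constant 1. *)
Lemma sum_n_m_bounded (T : Type) (P : T -> Prop) (w : T -> R) (h : nat -> T -> R) (m n : nat) :
  (forall p, P p -> 0 <= w p) ->
  (forall i, (m <= i <= n)%nat -> exists C, 0 < C /\ forall p, P p -> h i p <= C * w p) ->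
  exists C, 0 < C /\ forall p, P p -> sum_n_m (fun i => h i p) m n <= C * w p.
Proof.
  intros Hw Hh.
  assert (Hz : forall n, (n < m)%nat ->
    exists C, 0 < C /\ forall p, P p -> sum_n_m (fun i => h i p) m n <= C * w p).
  { intros n' Hn; exists 1; split; [lra|]; intros p Hp.
    rewrite sum_n_m_zero by auto; specialize (Hw p Hp); unfold zero; simpl; lra. }
  induction n as [|n IH].
  - destruct m as [|m]; [|apply Hz; lia].
    destruct (Hh 0%nat ltac:(lia)) as (C & HC & H); exists C; split; auto.
    intros p Hp; rewrite sum_n_n; auto.
  - destruct (Nat.le_gt_cases m (S n)) as [Hle|Hgt]; [|now apply Hz].
    destruct (Hh (S n) ltac:(lia)) as (C & HC & H).
    assert (HIH : exists C, 0 < C /\ forall p, P p -> sum_n_m (fun i => h i p) m n <= C * w p).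
    { destruct (Nat.le_gt_cases m n) as [Hle'|Hgt']; [|now apply Hz].
      apply IH; intros i Hi; apply Hh; lia. }
    destruct HIH as (C' & HC' & H'); exists (C' + C); split; [lra|].
    intros p Hp; rewrite sum_n_Sm by auto; specialize (H p Hp); specialize (H' p Hp).
    unfold plus; simpl; lra.
Qed.

Lemma sum2_bounded (T : Type) (P : T -> Prop) (w : T -> R) (h : nat -> nat -> T -> R)
    (l m n : nat) :
  (forall p, P p -> 0 <= w p) ->
  (forall k1 k2, (l <= k1)%nat -> (m <= k1 + k2)%nat ->
     exists C, 0 < C /\ forall p, P p -> h k1 k2 p <= C * w p) ->
  exists C, 0 < C /\ forall p, P p -> sum2 l m n (fun k1 k2 => h k1 k2 p) <= C * w p.
Proof.
  intros Hw Hh; unfold sum2.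
  apply (sum_n_m_bounded T P w (fun s p => sum_n_m (fun k1 => h k1 (s - k1)%nat p) l s)); auto.
  intros s Hs; apply (sum_n_m_bounded T P w (fun k1 p => h k1 (s - k1)%nat p)); auto.
  intros k1 Hk1; apply Hh; lia.
Qed.

(** * The geometry of the interior region *)

Section Geometry.

Variables Lam M a e rn rm rp rc : R.
Hypothesis hLam : 0 < Lam.
Hypothesis ha : 0 < a.
Hypothesis hsub : subextremal Lam M a e rn rm rp rc.

Definition lam : R := Lam / 3 * a ^ 2.
Definition Q2 (r s : R) : R := (r ^ 2 + a ^ 2) ^ 2 - a ^ 2 * s * Delta_r Lam M a e r.
Definition Qs (r s : R) : R := sqrt (Q2 r s).
(* With q = tan th / tan ts and s = sin^2 ts one has w1 q s = cos^2 ts / cos^2 th,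
   P = a sin ts cos ts sqrt (w2 / w1) and dth / P = kq dq; [Q2] is Q^2. *)
Definition w2 (q : R) : R := 1 + lam - q ^ 2.
Definition kq (q s : R) : R := / (a * sqrt (w1 q s * w2 q)).
Definition Jq (q s : R) : R := - RInt (fun t => kq t s) 1 q.
Definition tau (r s : R) : R := - RInt (fun t => / Qs t s) rp r.

Lemma lam_pos : 0 < lam.
Proof. unfold lam; assert (0 < a ^ 2) by (apply pow_lt; lra); nra. Qed.

(* Divided differences of Delta_r at its three positive roots. *)
Lemma Delta_r_coefficients :
  1 - Lam / 3 * a ^ 2 =
    Lam / 3 * (rm ^ 2 + rp ^ 2 + rc ^ 2 + rm * rp + rm * rc + rp * rc) /\
  2 * M = Lam / 3 * ((rm + rp) * (rm + rc) * (rp + rc)) /\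
  a ^ 2 + e ^ 2 = Lam / 3 * (rm * rp * rc * (rm + rp + rc)).
Proof.
  destruct hsub as (H1 & H2 & H3 & H4 & _ & Em & Ep & Ec).
  unfold Delta_r in Em, Ep, Ec; set (k := Lam / 3) in *.
  assert (HV : (rp - rm) * (rc - rp) * (rc - rm) <> 0).
  { repeat apply Rmult_integral_contrapositive_currified; lra. }
  assert (K1 : 1 - k * a ^ 2 = k * (rm ^ 2 + rp ^ 2 + rc ^ 2 + rm * rp + rm * rc + rp * rc)).
  { apply Rmult_eq_reg_l with ((rp - rm) * (rc - rp) * (rc - rm)); auto.
    apply Rminus_diag_uniq.
    transitivity
     ((rc - rp) * ((rm ^ 2 + a ^ 2) * (1 - k * rm ^ 2) - 2 * M * rm + e ^ 2)
     + (rm - rc) * ((rp ^ 2 + a ^ 2) * (1 - k * rp ^ 2) - 2 * M * rp + e ^ 2)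
     + (rp - rm) * ((rc ^ 2 + a ^ 2) * (1 - k * rc ^ 2) - 2 * M * rc + e ^ 2)); [ring|].
    rewrite Em, Ep, Ec; ring. }
  assert (K2 : 2 * M = k * ((rm + rp) * (rm + rc) * (rp + rc))).
  { apply Rmult_eq_reg_l with (rp - rm); [|lra].
    transitivity ((1 - k * a ^ 2) * (rp ^ 2 - rm ^ 2) - k * (rp ^ 4 - rm ^ 4)).
    - apply Rminus_diag_uniq.
      transitivity (((rm ^ 2 + a ^ 2) * (1 - k * rm ^ 2) - 2 * M * rm + e ^ 2)
        - ((rp ^ 2 + a ^ 2) * (1 - k * rp ^ 2) - 2 * M * rp + e ^ 2)); [ring|].
      rewrite Em, Ep; ring.
    - rewrite K1; ring. }
  repeat split; auto.
  transitivity (2 * M * rm - (1 - k * a ^ 2) * rm ^ 2 + k * rm ^ 4); [|rewrite K1, K2; ring].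
  apply Rminus_diag_uniq; rewrite <- Em; ring.
Qed.

(** The quartic has no cubic term, so its fourth root is minus the sum of the other three. *)
Lemma Delta_r_factor (r : R) :
  Delta_r Lam M a e r =
    - (Lam / 3) * ((r - rm) * (r - rp) * (r - rc) * (r + rm + rp + rc)).
Proof.
  destruct Delta_r_coefficients as (K1 & K2 & K3).
  transitivity (- (Lam / 3) * r ^ 4 + (1 - Lam / 3 * a ^ 2) * r ^ 2 - 2 * M * r
                + (a ^ 2 + e ^ 2)); [unfold Delta_r; ring|].
  rewrite K1, K2, K3; ring.
Qed.

Lemma Delta_r_neg (r : R) : rm < r < rp -> Delta_r Lam M a e r < 0.
Proof.
  destruct hsub as (H1 & H2 & H3 & H4 & _); intros Hr; rewrite Delta_r_factor.
  assert (0 < (r - rm) * (rp - r)) by (apply Rmult_lt_0_compat; lra).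
  assert (0 < (rc - r) * (r + rm + rp + rc)) by (apply Rmult_lt_0_compat; lra).
  assert (0 < ((r - rm) * (rp - r)) * ((rc - r) * (r + rm + rp + rc)))
    by (apply Rmult_lt_0_compat; lra).
  nra.
Qed.

Lemma Delta_r_nonpos (r : R) : rm <= r <= rp -> Delta_r Lam M a e r <= 0.
Proof.
  destruct hsub as (_ & _ & _ & _ & _ & Em & Ep & _); intros Hr.
  destruct (Req_dec r rm) as [->|]; [lra|]; destruct (Req_dec r rp) as [->|]; [lra|].
  left; apply Delta_r_neg; lra.
Qed.

(** The left side is one of the positive terms whose sum is 1 - lam, and lam > 0. *)
Lemma outer_root_small : Lam / 3 * rp ^ 2 < 1.
Proof.
  destruct hsub as (H1 & H2 & H3 & H4 & _).
  destruct Delta_r_coefficients as (K1 & _ & _).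
  assert (0 < Lam / 3 * a ^ 2) by apply lam_pos.
  assert (0 < rm * rp) by nra; assert (0 < rm * rc) by nra; assert (0 < rp * rc) by nra.
  assert (0 <= Lam / 3 * (rm ^ 2 + rc ^ 2 + rm * rp + rm * rc + rp * rc)).
  { apply Rmult_le_pos; [lra|]; pose proof (pow2_ge_0 rm); pose proof (pow2_ge_0 rc); lra. }
  lra.
Qed.

Lemma Q2_ge (r s : R) : rm <= r <= rp -> 0 <= s -> (r ^ 2 + a ^ 2) ^ 2 <= Q2 r s.
Proof.
  intros Hr Hs; pose proof (Delta_r_nonpos r Hr); unfold Q2.
  assert (0 <= a ^ 2 * s * - Delta_r Lam M a e r).
  { repeat apply Rmult_le_pos; try lra; apply pow2_ge_0. }
  lra.
Qed.

Lemma Q2_pos (r s : R) : rm <= r <= rp -> 0 <= s -> 0 < Q2 r s.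
Proof.
  intros Hr Hs; eapply Rlt_le_trans; [|now apply Q2_ge].
  apply pow_lt; pose proof (pow2_ge_0 r); assert (0 < a ^ 2) by (apply pow_lt; lra); lra.
Qed.

Lemma Qs_ge (r s : R) : rm <= r <= rp -> 0 <= s -> r ^ 2 + a ^ 2 <= Qs r s.
Proof.
  intros Hr Hs; rewrite <- (sqrt_pow2 (r ^ 2 + a ^ 2)).
  - apply sqrt_le_1_alt, Q2_ge; auto.
  - pose proof (pow2_ge_0 r); pose proof (pow2_ge_0 a); lra.
Qed.

(* The solution of [dq/dr = a sqrt (w2 q) / (r^2 + a^2)], [q(rp) = 1], i.e. of the
   equation for [q = tan th / tan ts] in the limit [s = 0]; it is a lower bound
   for every [s]. *)
Definition qlow (r : R) : R :=
  cos (atan (rp / a) - atan (r / a)) - sqrt lam * sin (atan (rp / a) - atan (r / a)).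

Lemma qlow_angle (r : R) : rm <= r <= rp -> 0 <= atan (rp / a) - atan (r / a) < PI / 2.
Proof.
  destruct hsub as (H1 & H2 & H3 & H4 & _); intros Hr.
  assert (Hra : 0 < r / a) by (apply Rdiv_lt_0_compat; lra).
  assert (0 < atan (r / a)).
  { rewrite <- atan_0; now apply atan_increasing. }
  pose proof (atan_bound (rp / a)).
  assert (atan (r / a) <= atan (rp / a)).
  { destruct (Req_dec r rp) as [->|]; [lra|]; left; apply atan_increasing.
    apply Rmult_lt_compat_r; [now apply Rinv_0_lt_compat | lra]. }
  lra.
Qed.

(** With p the difference of arctangents, [qlow] is sqrt (1 + lam) cos (p + atan (sqrt lam)), and
    the right side is sqrt (1 + lam) times the sine of the same angle. It is nonnegative because p
    lies in [0, PI / 2). *)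
Lemma qlow_sqrt (r : R) : rm <= r <= rp ->
  sqrt (w2 (qlow r)) =
    sin (atan (rp / a) - atan (r / a)) + sqrt lam * cos (atan (rp / a) - atan (r / a)).
Proof.
  intros Hr; pose proof (qlow_angle r Hr) as Ha; unfold w2, qlow.
  set (p := atan (rp / a) - atan (r / a)) in *.
  pose proof PI_RGT_0 as Hpi.
  assert (0 <= sin p) by (apply sin_ge_0; lra).
  assert (0 <= cos p) by (apply cos_ge_0; lra).
  pose proof (sqrt_pos lam) as Hl; pose proof lam_pos as Hlp.
  rewrite <- (sqrt_pow2 (sin p + sqrt lam * cos p)).
  - f_equal.
    assert (Hll : sqrt lam * sqrt lam = lam) by (apply sqrt_sqrt; lra).
    pose proof (sin2_cos2 p) as Hsc; unfold Rsqr in Hsc.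
    transitivity (sin p * sin p + 2 * sqrt lam * sin p * cos p
                  + (sqrt lam * sqrt lam) * (cos p * cos p)); [|ring].
    transitivity ((1 + lam) - cos p * cos p + 2 * sqrt lam * sin p * cos p
                  - (sqrt lam * sqrt lam) * (sin p * sin p)); [ring|].
    rewrite Hll; nra.
  - apply Rplus_le_le_0_compat; auto; now apply Rmult_le_pos.
Qed.

Lemma qlow_le_1 (r : R) : rm <= r <= rp -> qlow r <= 1.
Proof.
  intros Hr; pose proof (qlow_angle r Hr) as Ha; unfold qlow.
  set (p := atan (rp / a) - atan (r / a)) in *.
  pose proof PI_RGT_0 as Hpi; pose proof (COS_bound p).
  assert (0 <= sqrt lam * sin p).
  { apply Rmult_le_pos; [apply sqrt_pos | apply sin_ge_0; lra]. }
  lra.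
Qed.

Lemma qlow_increasing (r r' : R) : rm <= r -> r <= r' -> r' <= rp -> qlow r <= qlow r'.
Proof.
  intros H1 H2 H3.
  pose proof (qlow_angle r ltac:(lra)) as Ha; pose proof (qlow_angle r' ltac:(lra)) as Ha'.
  assert (Hle : atan (r / a) <= atan (r' / a)).
  { destruct (Req_dec r r') as [->|]; [lra|]; left; apply atan_increasing.
    apply Rmult_lt_compat_r; [now apply Rinv_0_lt_compat | lra]. }
  unfold qlow; pose proof PI_RGT_0 as Hpi.
  set (p := atan (rp / a) - atan (r / a)) in *.
  set (p' := atan (rp / a) - atan (r' / a)) in *.
  assert (Hp : p' <= p) by (unfold p, p'; lra).
  assert (cos p <= cos p') by (apply cos_decr_1; lra).
  assert (sin p' <= sin p) by (apply sin_incr_1; lra).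
  assert (sqrt lam * sin p' <= sqrt lam * sin p)
    by (apply Rmult_le_compat_l; auto; apply sqrt_pos).
  lra.
Qed.

Lemma qlow_pos : 0 < qlow rm.
Proof.
  destruct hsub as (H1 & H2 & H3 & H4 & _).
  unfold qlow; rewrite cos_minus, sin_minus.
  set (al := atan (rp / a)); set (be := atan (rm / a)).
  assert (Hca : 0 < cos al) by (pose proof (atan_bound (rp / a)); apply cos_gt_0; unfold al; lra).
  assert (Hcb : 0 < cos be) by (pose proof (atan_bound (rm / a)); apply cos_gt_0; unfold be; lra).
  assert (Hsa : sin al = rp / a * cos al).
  { rewrite <- (tan_atan (rp / a)); fold al; unfold tan; field; lra. }
  assert (Hsb : sin be = rm / a * cos be).
  { rewrite <- (tan_atan (rm / a)); fold be; unfold tan; field; lra. }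
  rewrite Hsa, Hsb.
  assert (Hl : sqrt lam = sqrt (Lam / 3) * a).
  { unfold lam; rewrite sqrt_mult_alt by lra; rewrite sqrt_pow2 by lra; ring. }
  assert (Hrp : sqrt (Lam / 3) * rp < 1).
  { rewrite <- sqrt_1, <- (sqrt_pow2 rp) by lra.
    rewrite <- sqrt_mult_alt by lra; apply sqrt_lt_1_alt.
    pose proof outer_root_small; pose proof (pow2_ge_0 rp); split; [nra|lra]. }
  pose proof (sqrt_pos (Lam / 3)) as Hs0.
  rewrite Hl.
  (* In the last factor the only negative term is - sqrt (Lam / 3) rp, which is greater than -1. *)
  replace (cos al * cos be + rp / a * cos al * (rm / a * cos be) -
    sqrt (Lam / 3) * a * (rp / a * cos al * cos be - cos al * (rm / a * cos be)))
    with (cos al * cos be *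
      (1 + rp * rm / a ^ 2 - sqrt (Lam / 3) * rp + sqrt (Lam / 3) * rm)) by (field; lra).
  apply Rmult_lt_0_compat; [now apply Rmult_lt_0_compat|].
  assert (0 < rp * rm / a ^ 2).
  { apply Rdiv_lt_0_compat; [nra | apply pow_lt; lra]. }
  assert (0 <= sqrt (Lam / 3) * rm) by (apply Rmult_le_pos; lra).
  lra.
Qed.

Lemma qlow_derive (r : R) : rm <= r <= rp ->
  is_derive qlow r (a * sqrt (w2 (qlow r)) / (r ^ 2 + a ^ 2)).
Proof.
  intros Hr; rewrite qlow_sqrt by auto; unfold qlow.
  set (c0 := atan (rp / a)).
  evar_last.
  - apply (is_derive_minus (fun r => cos (c0 - atan (r / a)))
             (fun r => sqrt lam * sin (c0 - atan (r / a)))).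
    + auto_derive; [auto | reflexivity].
    + auto_derive; [auto | reflexivity].
  - unfold minus, plus, opp; simpl.
    assert (0 < a * a) by nra; pose proof (Rle_0_sqr r) as Hr2; unfold Rsqr in Hr2.
    unfold Rminus, Rdiv.
    generalize (sin (c0 + - atan (r * / a))) (cos (c0 + - atan (r * / a))); intros u v.
    field; split; [nra | lra].
Qed.

(** * Existence of q near the closed rectangle *)

Lemma smooth_Delta_r (B : box) : smooth B (fun r _ => Delta_r Lam M a e r).
Proof. unfold Delta_r; smooth_tac. Qed.

Lemma smooth_Q2 (B : box) : smooth B Q2.
Proof. unfold Q2; smooth_tac; apply smooth_Delta_r. Qed.

Lemma smooth_w1 (B : box) : smooth B w1.
Proof. unfold w1; smooth_tac. Qed.

Lemma smooth_w2 (B : box) : smooth B (fun q _ => w2 q).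
Proof. unfold w2; smooth_tac. Qed.

(** Any number strictly between 0 and [qlow rm] would serve: the strict gap lets the solution exist
    on a neighbourhood of the rectangle, and positivity leaves room for the margin [e0]. *)
Definition q0 : R := qlow rm / 2.

Lemma q0_bounds : 0 < q0 /\ q0 < qlow rm /\ qlow rm <= 1.
Proof.
  pose proof qlow_pos; destruct hsub as (H1 & H2 & H3 & _).
  pose proof (qlow_le_1 rm ltac:(lra)); unfold q0; lra.
Qed.

(** For s in [0, 1], [w1] vanishes only at q = 0, s = 1, and [w2] only where q^2 = 1 + lam; both are
    away from q0 <= q <= 1. Margins of at most q0 / 2 keep q positive. *)
Lemma base_chart_exists : exists e0, 0 < e0 /\ e0 < q0 /\
  (forall q s, inb (nbox q0 1 0 1 e0) q s -> 0 < w1 q s /\ 0 < w2 q) /\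
  (forall r s, inb (nbox rm rp 0 1 e0) r s -> 0 < Q2 r s).
Proof.
  destruct q0_bounds as (Hq0 & Hq1 & Hq2); destruct hsub as (_ & _ & Hr & _).
  pose proof lam_pos as Hl.
  destruct (positive_near_rectangle w1 q0 1 0 1 (q0 / 2)) as (e1 & He1 & P1); try lra.
  { intros x y Hxy; exact (smooth_continuous _ _ _ _ (smooth_w1 _) Hxy). }
  { intros q s Hq Hs; unfold w1; assert (0 < q ^ 2) by (apply pow_lt; lra);
    destruct (Rle_dec s (1 / 2)); nra. }
  destruct (positive_near_rectangle (fun q _ => w2 q) q0 1 0 1 (q0 / 2))
    as (e2 & He2 & P2); try lra.
  { intros x y Hxy; exact (smooth_continuous _ _ _ _ (smooth_w2 _) Hxy). }
  { intros q s Hq Hs; unfold w2; nra. }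
  destruct (positive_near_rectangle Q2 rm rp 0 1 (q0 / 2)) as (e3 & He3 & P3); try lra.
  { intros x y Hxy; exact (smooth_continuous _ _ _ _ (smooth_Q2 _) Hxy). }
  { intros r s Hr' Hs; apply Q2_pos; lra. }
  exists (Rmin e1 (Rmin e2 e3)).
  pose proof (Rmin_l e1 (Rmin e2 e3)); pose proof (Rmin_r e1 (Rmin e2 e3)).
  pose proof (Rmin_l e2 e3); pose proof (Rmin_r e2 e3).
  split; [repeat apply Rmin_glb_lt; lra|]; split; [lra|].
  split; intros x y [Hx Hy]; simpl in Hx, Hy; [split|].
  - apply P1; split; simpl; lra.
  - apply (P2 x y); split; simpl; lra.
  - apply P3; split; simpl; lra.
Qed.

(* A domain in q on which the integrand of [Jq] is regular and positive. *)
Definition good_q (Bq : box) : Prop :=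
  xl Bq < 1 < xr Bq /\ forall q s, inb Bq q s -> 0 < w1 q s /\ 0 < w2 q.

Lemma kq_pos (Bq : box) (q s : R) : good_q Bq -> inb Bq q s -> 0 < kq q s.
Proof.
  intros [_ Hw] H; destruct (Hw q s H); apply Rinv_0_lt_compat, Rmult_lt_0_compat; auto.
  apply sqrt_lt_R0, Rmult_lt_0_compat; auto.
Qed.

Lemma smooth_kq (Bq : box) : good_q Bq -> smooth Bq kq.
Proof.
  intros [_ Hw].
  assert (Hpos : forall q s, inb Bq q s -> 0 < w1 q s * w2 q).
  { intros q s H; destruct (Hw q s H); now apply Rmult_lt_0_compat. }
  unfold kq; apply smooth_inv.
  - intros q s H; pose proof (sqrt_lt_R0 _ (Hpos q s H)).
    apply Rmult_integral_contrapositive_currified; lra.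
  - apply smooth_mult; [apply smooth_const|].
    apply smooth_sqrt; auto; apply smooth_mult; [apply smooth_w1 | apply smooth_w2].
Qed.

Lemma smooth_Jq (Bq : box) : good_q Bq -> smooth Bq Jq.
Proof.
  intros HB; unfold Jq; apply smooth_opp, smooth_RInt; [apply HB | now apply smooth_kq].
Qed.

Lemma d1_Jq (Bq : box) (q s : R) : good_q Bq -> inb Bq q s -> d1 Jq q s = - kq q s.
Proof.
  intros HB H; apply is_derive_unique; unfold Jq.
  apply (is_derive_opp (fun t => RInt (fun z => kq z s) 1 t)).
  apply (RInt_primitive_x Bq 0); auto; [now apply smooth_kq | apply HB].
Qed.

Lemma d1_Jq_neg (Bq : box) (q s : R) : good_q Bq -> inb Bq q s -> d1 Jq q s < 0.
Proof.
  intros HB H; rewrite (d1_Jq Bq) by auto; pose proof (kq_pos Bq q s HB H); lra.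
Qed.

Section BaseChart.

Variable e0 : R.
Hypothesis He0 : 0 < e0.
Hypothesis He0q : e0 < q0.
Hypothesis Hw : forall q s, inb (nbox q0 1 0 1 e0) q s -> 0 < w1 q s /\ 0 < w2 q.
Hypothesis HQ : forall r s, inb (nbox rm rp 0 1 e0) r s -> 0 < Q2 r s.

Lemma good_q_nbox : good_q (nbox q0 1 0 1 e0).
Proof. split; auto; pose proof q0_bounds; simpl; lra. Qed.

Lemma inb_nbox_q (q s : R) : q0 <= q <= 1 -> 0 <= s <= 1 -> inb (nbox q0 1 0 1 e0) q s.
Proof. intros; split; simpl; lra. Qed.

Lemma inb_nbox_r (r s : R) : rm <= r <= rp -> 0 <= s <= 1 -> inb (nbox rm rp 0 1 e0) r s.
Proof. intros; split; simpl; lra. Qed.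

Lemma Qs_pos (r s : R) : inb (nbox rm rp 0 1 e0) r s -> 0 < Qs r s.
Proof. intros H; apply sqrt_lt_R0; auto. Qed.

Lemma smooth_Qs : smooth (nbox rm rp 0 1 e0) Qs.
Proof. apply smooth_sqrt; auto; apply smooth_Q2. Qed.

Lemma smooth_Qs_inv : smooth (nbox rm rp 0 1 e0) (fun r s => / Qs r s).
Proof.
  apply smooth_inv; [|apply smooth_Qs]; intros r s H; pose proof (Qs_pos r s H); lra.
Qed.

Lemma smooth_tau : smooth (nbox rm rp 0 1 e0) tau.
Proof.
  unfold tau; apply smooth_opp, (smooth_RInt _ (fun r s => / Qs r s)); [|apply smooth_Qs_inv].
  destruct hsub as (_ & _ & Hr & _); simpl; lra.
Qed.

Lemma d1_tau (r s : R) : inb (nbox rm rp 0 1 e0) r s -> d1 tau r s = - / Qs r s.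
Proof.
  intros H; apply is_derive_unique; unfold tau.
  apply (is_derive_opp (fun t => RInt (fun z => / Qs z s) rp t)).
  apply (RInt_primitive_x (nbox rm rp 0 1 e0) 0 (fun r s => / Qs r s)); auto.
  - apply smooth_Qs_inv.
  - destruct hsub as (_ & _ & Hr & _); simpl; lra.
Qed.

Lemma Jq_1 (s : R) : Jq 1 s = 0.
Proof. unfold Jq; rewrite RInt_point; unfold zero; simpl; ring. Qed.

Lemma tau_rp (s : R) : tau rp s = 0.
Proof. unfold tau; rewrite RInt_point; unfold zero; simpl; ring. Qed.

Lemma tau_decreasing (r r' s : R) :
  rm <= r -> r < r' -> r' <= rp -> 0 <= s <= 1 -> tau r' s < tau r s.
Proof.
  intros H1 H2 H3 Hs.
  apply (strictly_decreasing_of_derive (fun t => tau t s) (fun t => d1 tau t s)); auto.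
  intros x Hx; assert (Hb : inb (nbox rm rp 0 1 e0) x s) by (apply inb_nbox_r; lra).
  split; [apply (smooth_is_derive (nbox rm rp 0 1 e0)); auto; apply smooth_tau|].
  rewrite d1_tau by auto; pose proof (Rinv_0_lt_compat _ (Qs_pos x s Hb)); lra.
Qed.

Lemma tau_nonneg (r s : R) : rm <= r <= rp -> 0 <= s <= 1 -> 0 <= tau r s.
Proof.
  intros Hr Hs; rewrite <- (tau_rp s); destruct (Req_dec r rp) as [->|]; [lra|].
  left; apply tau_decreasing; lra.
Qed.

(* Jq (qlow r) s - tau r s is nonincreasing in r and vanishes at rp. *)
Lemma tau_le_Jq_qlow (s : R) : 0 <= s <= 1 -> tau rm s <= Jq (qlow rm) s.
Proof.
  intros Hs; destruct hsub as (_ & Hrm & Hrmp & _).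
  assert (Hb : forall r, rm <= r <= rp -> q0 <= qlow r <= 1).
  { intros r Hr; pose proof q0_bounds; pose proof (qlow_le_1 r Hr).
    pose proof (qlow_increasing rm r ltac:(lra) ltac:(lra) ltac:(lra)); lra. }
  destruct (mvt_closed (fun r => Jq (qlow r) s - tau r s)
    (fun r => (a * sqrt (w2 (qlow r)) / (r ^ 2 + a ^ 2)) * (- kq (qlow r) s) - (- / Qs r s))
    rm rp Hrmp) as (c & Hc & E).
  - intros r Hr.
    pose proof (inb_nbox_q _ s (Hb r Hr) Hs) as HV; pose proof (inb_nbox_r r s Hr Hs) as HB.
    apply (is_derive_minus (fun r => Jq (qlow r) s) (fun r => tau r s)).
    + rewrite <- (d1_Jq _ _ _ good_q_nbox HV).
      apply (is_derive_comp (fun q => Jq q s) qlow).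
      * apply (smooth_is_derive (nbox q0 1 0 1 e0)); auto; apply smooth_Jq, good_q_nbox.
      * now apply qlow_derive.
    + rewrite <- (d1_tau _ _ HB).
      apply (smooth_is_derive (nbox rm rp 0 1 e0)); auto; apply smooth_tau.
  - assert (E1 : qlow rp = 1).
    { unfold qlow; rewrite Rminus_eq_0, cos_0, sin_0; ring. }
    rewrite E1, Jq_1, tau_rp in E.
    pose proof (inb_nbox_q _ s (Hb c Hc) Hs) as HV; destruct (Hw _ _ HV) as [W1 W2].
    pose proof (Qs_ge c s Hc ltac:(lra)) as HQge.
    assert (HN : 0 < c ^ 2 + a ^ 2) by (pose proof (pow2_ge_0 c); pose proof (pow_lt a 2 ha); lra).
    assert (Hk : a * sqrt (w2 (qlow c)) / (c ^ 2 + a ^ 2) * kq (qlow c) s =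
              / ((c ^ 2 + a ^ 2) * sqrt (w1 (qlow c) s))).
    { unfold kq; rewrite sqrt_mult by lra; 
      pose proof (sqrt_lt_R0 _ W1); pose proof (sqrt_lt_R0 _ W2); field; repeat split; lra. }
    assert (Hs1 : sqrt (w1 (qlow c) s) <= 1).
    { rewrite <- sqrt_1; apply sqrt_le_1_alt; unfold w1.
      destruct (Hb c Hc); pose proof q0_bounds.
      assert (0 <= qlow c ^ 2 <= 1) by (split; [apply pow2_ge_0|]; nra); nra. }
    (* The comparison behind the lower bound: sqrt w1 <= 1 since q <= 1, and c^2 + a^2 <= Q since
       Delta_r <= 0. *)
    assert (Hle : / Qs c s <= / ((c ^ 2 + a ^ 2) * sqrt (w1 (qlow c) s))).
    { pose proof (sqrt_lt_R0 _ W1); apply Rinv_le_contravar; nra. }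
    assert (Hneg : a * sqrt (w2 (qlow c)) / (c ^ 2 + a ^ 2) * - kq (qlow c) s - - / Qs c s <= 0).
    { replace (a * sqrt (w2 (qlow c)) / (c ^ 2 + a ^ 2) * - kq (qlow c) s)
        with (- (a * sqrt (w2 (qlow c)) / (c ^ 2 + a ^ 2) * kq (qlow c) s)) by ring.
      rewrite Hk; lra. }
    nra.
Qed.

Lemma tau_lt_Jq_q0 (r s : R) : rm <= r <= rp -> 0 <= s <= 1 -> tau r s < Jq q0 s.
Proof.
  intros Hr Hs; pose proof q0_bounds.
  assert (tau r s <= tau rm s).
  { destruct (Req_dec r rm) as [->|]; [lra|]; left; apply tau_decreasing; lra. }
  pose proof (tau_le_Jq_qlow s Hs).
  assert (Jq (qlow rm) s < Jq q0 s).
  { apply (d1_neg_decreasing (nbox q0 1 0 1 e0)); try lra.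
    - apply smooth_Jq, good_q_nbox.
    - intros; apply (d1_Jq_neg (nbox q0 1 0 1 e0)); auto; apply good_q_nbox.
    - apply inb_nbox_q; lra.
    - apply inb_nbox_q; lra. }
  lra.
Qed.

(** The intermediate value theorem on [q0, 1 + e0 / 2]. The right end lies beyond 1 because the
    solution equals 1 at r = rp and has to exist on both sides of it. The two sign conditions are
    strict on the closed rectangle and hence persist on a margin. *)
Lemma q_solution_exists : exists e1 (qf : R -> R -> R), 0 < e1 <= e0 /\
  forall r s, inb (nbox rm rp 0 1 e1) r s ->
    q0 - e0 < qf r s < 1 + e0 /\ Jq (qf r s) s = tau r s.
Proof.
  pose proof q0_bounds; destruct hsub as (_ & Hrm & Hrmp & _).
  set (Bq := nbox q0 1 0 1 e0); set (Br := nbox rm rp 0 1 e0).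
  assert (Hside : forall u, q0 <= u < 1 + e0 -> smooth Br (fun _ s => Jq u s)).
  { intros u Hu; apply (smooth_comp Bq Br Jq (fun _ _ => u) (fun _ s => s)).
    - intros x y [Hx Hy]; simpl in Hx, Hy; split; simpl; lra.
    - apply smooth_Jq, good_q_nbox.
    - apply smooth_const.
    - apply smooth_snd. }
  destruct (positive_near_rectangle (fun r s => Jq q0 s - tau r s) rm rp 0 1 e0)
    as (e1 & He1 & P1); try lra.
  { intros x y Hxy; apply (smooth_continuous Br (fun r s => Jq q0 s - tau r s)); auto.
    apply smooth_minus; [apply Hside; lra | apply smooth_tau]. }
  { intros r s Hr Hs; pose proof (tau_lt_Jq_q0 r s Hr Hs); lra. }
  destruct (positive_near_rectangle (fun r s => tau r s - Jq (1 + e0 / 2) s) rm rp 0 1 e0)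
    as (e2 & He2 & P2); try lra.
  { intros x y Hxy; apply (smooth_continuous Br (fun r s => tau r s - Jq (1 + e0 / 2) s)); auto.
    apply smooth_minus; [apply smooth_tau | apply Hside; lra]. }
  { intros r s Hr Hs; pose proof (tau_nonneg r s Hr Hs).
    assert (Jq (1 + e0 / 2) s < Jq 1 s).
    { apply (d1_neg_decreasing Bq); try lra.
      - apply smooth_Jq, good_q_nbox.
      - intros; apply (d1_Jq_neg (nbox q0 1 0 1 e0)); auto; apply good_q_nbox.
      - split; simpl; lra.
      - split; simpl; lra. }
    rewrite Jq_1 in *; lra. }
  pose proof (Rmin_l e1 e2); pose proof (Rmin_r e1 e2).
  assert (Hm : 0 < Rmin e1 e2) by (apply Rmin_glb_lt; lra).
  assert (Hex : forall r s, exists q, inb (nbox rm rp 0 1 (Rmin e1 e2)) r s ->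
            q0 - e0 < q < 1 + e0 /\ Jq q s = tau r s).
  { intros r s; destruct (classic (inb (nbox rm rp 0 1 (Rmin e1 e2)) r s)) as [Hin|Hn];
      [|exists 0; tauto].
    destruct Hin as [Hr Hs]; simpl in Hr, Hs.
    specialize (P1 r s ltac:(split; simpl; lra)); specialize (P2 r s ltac:(split; simpl; lra)).
    simpl in P1, P2.
    destruct (IVT_interv (fun q => tau r s - Jq q s) q0 (1 + e0 / 2)) as (q & Hq & Eq);
      try lra.
    { intros q Hq; apply continuity_pt_minus; [apply continuity_pt_const; intros ? ?; auto|].
      apply continuity_pt_filterlim, (continuity_2d_pt_slice1 Jq), (smooth_continuous Bq);
        [apply smooth_Jq, good_q_nbox | split; simpl; lra]. }
    exists q; intros _; split; lra. }
  (* A pointwise choice, arbitrary outside the box; its regularity comes afterwards from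
     [implicit_smooth]. *)
  exists (Rmin e1 e2), (fun r s => epsilon (inhabits 0) (fun q =>
    inb (nbox rm rp 0 1 (Rmin e1 e2)) r s -> q0 - e0 < q < 1 + e0 /\ Jq q s = tau r s)).
  split; [lra|]; intros r s Hrs.
  exact (epsilon_spec (inhabits 0) _ (Hex r s) Hrs).
Qed.

(* P / (sin ts cos ts) and Delta_th, as functions of (q, s). *)
Definition ww (q s : R) : R := a * sqrt (w2 q / w1 q s).
Definition Dq (q s : R) : R := 1 + lam * (1 - s) / w1 q s.

(** * P, Delta_th and F in terms of q *)

Lemma Delta_th_ang (q t : R) : 0 < q -> Delta_th Lam a (ang q t) = Dq q (sin t ^ 2).
Proof.
  intros Hq; pose proof (w1_sin_pos q t Hq) as Hw1; pose proof (sin2_cos2_pow t) as Hsc.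
  unfold Delta_th, Dq; rewrite cos_ang by auto.
  unfold Rdiv at 2; rewrite Rpow_mult_distr, pow_inv, pow2_sqrt by lra.
  replace (1 - sin t ^ 2) with (cos t ^ 2) by lra; unfold lam; field; lra.
Qed.

Lemma P_pot_ang (q t : R) : 0 < q -> 0 <= t <= PI / 2 ->
  P_pot Lam a (ang q t) t = sin t * cos t * ww q (sin t ^ 2).
Proof.
  intros Hq Ht; unfold P_pot; rewrite Delta_th_ang, sin_ang by auto.
  pose proof (w1_sin_pos q t Hq) as Hw1; pose proof (sin2_cos2_pow t) as Hsc.
  assert (Hs : 0 <= sin t) by (apply sin_ge_0; lra).
  assert (Hc : 0 <= cos t) by (apply cos_ge_0; lra).
  unfold Rdiv at 1; rewrite Rpow_mult_distr, pow_inv, pow2_sqrt by lra.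
  replace (sin t ^ 2 * Dq q (sin t ^ 2) - (q * sin t) ^ 2 * / w1 q (sin t ^ 2))
    with ((sin t * cos t) ^ 2 * (w2 q / w1 q (sin t ^ 2))).
  - assert (0 <= sin t * cos t) by now apply Rmult_le_pos.
    rewrite sqrt_mult_alt by apply pow2_ge_0.
    rewrite sqrt_pow2 by auto; unfold ww; ring.
  - unfold Dq, w2; apply Rmult_eq_reg_r with (w1 q (sin t ^ 2)); [|lra].
    field_simplify; try lra.
    rewrite w1_sin; replace (sin t ^ 4) with (sin t ^ 2 * sin t ^ 2) by ring.
    replace (cos t ^ 2) with (1 - sin t ^ 2) by lra; ring.
Qed.

(** For an arbitrary th the ratio tan th / tan ts may lie below q0, so a second domain with every q
    > 0 is needed. There [w1] is positive because s < 1, which is the case for ts < PI / 2. *)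
Lemma good_q_open : good_q (Box 0 (1 + e0) 0 1).
Proof.
  split; [simpl; lra|]; intros q s [Hq Hs]; simpl in Hq, Hs; split.
  - unfold w1; assert (0 < q ^ 2) by (apply pow_lt; lra); nra.
  - destruct (Rle_dec q 1) as [H1|H1].
    + pose proof lam_pos; unfold w2; nra.
    + apply (Hw q 0); pose proof q0_bounds; split; simpl; lra.
Qed.

Lemma P_pot_pos (t th : R) : 0 < t < PI / 2 -> 0 < th < PI / 2 -> tan th / tan t < 1 + e0 ->
  0 < P_pot Lam a th t /\
  / P_pot Lam a th t = kq (tan th / tan t) (sin t ^ 2) / (cos th ^ 2 * tan t).
Proof.
  intros Ht Hth Hq; set (q := tan th / tan t) in *.
  assert (Hct : 0 < cos t) by (apply cos_gt_0; lra).
  assert (Hst : 0 < sin t) by (apply sin_gt_0; lra).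
  assert (Hq0 : 0 < q) by (apply Rdiv_lt_0_compat; apply tan_gt_0; lra).
  pose proof (ang_tan t th Ht Hth) as Ea; fold q in Ea; rewrite <- Ea.
  assert (Hs2 : 0 < sin t ^ 2 < 1).
  { pose proof (sin2_cos2_pow t); pose proof (pow_lt _ 2 Hct); pose proof (pow_lt _ 2 Hst); lra. }
  destruct (proj2 good_q_open q (sin t ^ 2)) as [W1 W2]; [split; simpl; lra|].
  rewrite P_pot_ang, cos_ang by lra.
  pose proof (sqrt_lt_R0 _ W1) as S1; pose proof (sqrt_lt_R0 _ W2) as S2.
  unfold ww, kq, tan.
  rewrite sqrt_div_alt, sqrt_mult by lra.
  split.
  - assert (0 < sqrt (w2 q) / sqrt (w1 q (sin t ^ 2))) by now apply Rdiv_lt_0_compat.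
    repeat (apply Rmult_lt_0_compat; auto).
  - field; repeat split; lra.
Qed.

Lemma tan_ratio_between (t th x : R) :
  0 < t < PI / 2 -> 0 < th < PI / 2 -> Rmin t th <= x <= Rmax t th ->
  tan th / tan t < 1 + e0 ->
  0 < x < PI / 2 /\ 0 < tan x / tan t < 1 + e0.
Proof.
  intros Ht Hth Hx Hq.
  assert (Hx' : 0 < x < PI / 2).
  { revert Hx; unfold Rmin, Rmax; destruct (Rle_dec t th); lra. }
  assert (Htt : 0 < tan t) by (apply tan_gt_0; lra).
  split; auto; split; [apply Rdiv_lt_0_compat; auto; apply tan_gt_0; lra|].
  assert (Hmono : forall u v, 0 < u -> u <= v -> v < PI / 2 -> tan u / tan t <= tan v / tan t).
  { intros u v H1 H2 H3; apply Rmult_le_compat_r; [left; now apply Rinv_0_lt_compat|].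
    destruct (Req_dec u v) as [->|]; [lra|]; left; apply tan_increasing; lra. }
  assert (E1 : tan t / tan t = 1) by (field; lra).
  revert Hx; unfold Rmin, Rmax; destruct (Rle_dec t th); intros Hx.
  - pose proof (Hmono x th); lra.
  - pose proof (Hmono x t); lra.
Qed.

(** Instead of a change of variables, the fundamental theorem: x -> - Jq (tan x / tan t) (sin t ^ 2)
    is a primitive of 1/P and vanishes at x = t. *)
Lemma is_RInt_P (t th : R) :
  0 < t < PI / 2 -> 0 < th < PI / 2 -> tan th / tan t < 1 + e0 ->
  is_RInt (fun th' => / P_pot Lam a th' t) t th (- Jq (tan th / tan t) (sin t ^ 2)).
Proof.
  intros Ht Hth Hq.
  assert (Hct : 0 < cos t) by (apply cos_gt_0; lra).
  assert (Hst : 0 < sin t) by (apply sin_gt_0; lra).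
  assert (Htt : 0 < tan t) by (apply tan_gt_0; lra).
  assert (Hs2 : 0 < sin t ^ 2 < 1).
  { pose proof (sin2_cos2_pow t); pose proof (pow_lt _ 2 Hct); pose proof (pow_lt _ 2 Hst); lra. }
  replace (- Jq (tan th / tan t) (sin t ^ 2))
    with (minus (- Jq (tan th / tan t) (sin t ^ 2)) (- Jq (tan t / tan t) (sin t ^ 2))).
  2: { replace (tan t / tan t) with 1 by (field; lra); rewrite Jq_1.
       unfold minus, plus, opp; simpl; ring. }
  apply (is_RInt_derive (fun x => - Jq (tan x / tan t) (sin t ^ 2))).
  - intros x Hx; destruct (tan_ratio_between t th x Ht Hth Hx Hq) as [Hx0 Hqx].
    destruct (P_pot_pos t x Ht Hx0 ltac:(lra)) as [_ ->].
    assert (Hcx : 0 < cos x) by (apply cos_gt_0; lra).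
    assert (HV : inb (Box 0 (1 + e0) 0 1) (tan x / tan t) (sin t ^ 2)) by (split; simpl; lra).
    evar_last.
    + apply (is_derive_opp (fun x => Jq (tan x / tan t) (sin t ^ 2))).
      apply (is_derive_comp (fun q => Jq q (sin t ^ 2)) (fun x => tan x / tan t)).
      * exact (proj1 (smooth_is_derive _ Jq _ _ (smooth_Jq _ good_q_open) HV)).
      * unfold Rdiv; apply (is_derive_scal_l tan x (tan x ^ 2 + 1) (/ tan t)).
        apply is_derive_tan; lra.
    + rewrite (d1_Jq _ _ _ good_q_open HV).
      unfold opp, scal; simpl; unfold mult; simpl; unfold tan at 1 2.
      pose proof (sin2_cos2_pow x) as Hsc.
      field_simplify_eq; [|repeat split; lra].
      replace (sin x ^ 2) with (1 - cos x ^ 2) by lra; ring.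
  - intros x Hx; destruct (tan_ratio_between t th x Ht Hth Hx Hq) as [Hx0 Hqx].
    destruct (P_pot_pos t x Ht Hx0 ltac:(lra)) as [HP _].
    apply continuous_Rinv_comp; [|lra].
    unfold P_pot, Delta_th.
    apply (continuous_scal_r a (fun x => sqrt _)), continuous_sqrt_comp.
    apply (ex_derive_continuous (K := R_AbsRing) (V := R_NormedModule)); auto_derive; auto.
Qed.

Lemma F_eik_eq (r th t : R) :
  rm <= r <= rp -> 0 < t < PI / 2 -> 0 < th < PI / 2 -> tan th / tan t < 1 + e0 ->
  F_eik Lam M a e rp r th t = tau r (sin t ^ 2) - Jq (tan th / tan t) (sin t ^ 2).
Proof.
  intros Hr Ht Hth Hq; unfold F_eik.
  rewrite (is_RInt_unique _ _ _ _ (is_RInt_P t th Ht Hth Hq)).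
  change (fun r' => / Q_pot Lam M a e r' t) with (fun r' => / Qs r' (sin t ^ 2)).
  rewrite <- (opp_RInt_swap (fun r' => / Qs r' (sin t ^ 2)) rp r).
  - unfold tau, opp; simpl; ring.
  - pose proof (sin2_bounds t) as Hs; destruct hsub as (_ & _ & Hrr & _).
    apply (Cn_ex_RInt (nbox rm rp 0 1 e0) 0 (fun r s => / Qs r s)).
    + apply smooth_Qs_inv.
    + simpl; lra.
    + now apply inb_nbox_r.
Qed.

(** * Smoothness of q, and the derivative G *)

Section QChart.

Variable e1 : R.
Variable qf : R -> R -> R.
Hypothesis He1 : 0 < e1 <= e0.
Hypothesis Hqf : forall r s, inb (nbox rm rp 0 1 e1) r s ->
  q0 - e0 < qf r s < 1 + e0 /\ Jq (qf r s) s = tau r s.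

Definition qbox : box := Box (q0 - e0) (1 + e0) (- e1) (1 + e1).
Definition rbox : box := nbox rm rp 0 1 e1.

Lemma good_q_qbox : good_q qbox.
Proof.
  split; [pose proof q0_bounds; simpl; lra|].
  intros q s [H1 H2]; simpl in H1, H2; apply Hw; split; simpl; lra.
Qed.

Lemma rbox_sub (r s : R) : inb rbox r s -> inb (nbox rm rp 0 1 e0) r s.
Proof. intros [H1 H2]; simpl in H1, H2; split; simpl; lra. Qed.

Lemma inb_rbox (r s : R) : rm <= r <= rp -> 0 <= s <= 1 -> inb rbox r s.
Proof. intros; split; simpl; lra. Qed.

Lemma qf_in_qbox (r s : R) : inb rbox r s -> inb qbox (qf r s) s.
Proof.
  intros H; destruct (Hqf r s H); destruct H as [Hr Hs]; simpl in Hr, Hs; split; simpl; lra.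
Qed.

Lemma qf_pos (r s : R) : inb rbox r s -> 0 < qf r s.
Proof. intros H; destruct (Hqf r s H); lra. Qed.

Lemma qf_w (r s : R) : inb rbox r s -> 0 < w1 (qf r s) s /\ 0 < w2 (qf r s).
Proof. intros H; now apply good_q_qbox, qf_in_qbox. Qed.

Lemma smooth_tau_rbox : smooth rbox tau.
Proof. apply (smooth_sub (nbox rm rp 0 1 e0)); [apply rbox_sub | apply smooth_tau]. Qed.

Lemma smooth_Qs_rbox : smooth rbox Qs.
Proof. apply (smooth_sub (nbox rm rp 0 1 e0)); [apply rbox_sub | apply smooth_Qs]. Qed.

Lemma smooth_qf : smooth rbox qf.
Proof.
  apply (implicit_smooth qbox rbox Jq tau qf).
  - simpl; ring.
  - simpl; ring.
  - apply smooth_Jq, good_q_qbox.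
  - intros; apply (d1_Jq_neg qbox); auto; apply good_q_qbox.
  - apply smooth_tau_rbox.
  - exact Hqf.
Qed.

Lemma smooth_of_qf (g : R -> R -> R) : smooth qbox g -> smooth rbox (fun r s => g (qf r s) s).
Proof.
  intros Hg; apply (smooth_comp qbox rbox g qf (fun _ s => s)); auto.
  - apply qf_in_qbox.
  - apply smooth_qf.
  - apply smooth_snd.
Qed.

Lemma d1_qf (r s : R) : inb rbox r s -> d1 qf r s = / (Qs r s * kq (qf r s) s).
Proof.
  intros H; pose proof (qf_in_qbox r s H) as HV.
  assert (E : d1 qf r s = d1 tau r s / d1 Jq (qf r s) s).
  { apply is_derive_unique.
    apply (implicit_derive_x qbox rbox Jq tau qf); auto; try (simpl; ring).
    - apply smooth_Jq, good_q_qbox.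
    - intros; apply (d1_Jq_neg qbox); auto; apply good_q_qbox.
    - apply smooth_tau_rbox. }
  rewrite E, (d1_Jq qbox), d1_tau by (auto using good_q_qbox, rbox_sub).
  pose proof (kq_pos qbox _ _ good_q_qbox HV); pose proof (Qs_pos r s (rbox_sub _ _ H)).
  field; lra.
Qed.

(** The implicit derivative in s, cleared of its denominator: the left side is the combination that
    arises when F is differentiated in ts. *)
Lemma d2_qf (r s : R) : inb rbox r s ->
  d2 tau r s - d2 Jq (qf r s) s = - kq (qf r s) s * d2 qf r s.
Proof.
  intros H; pose proof (qf_in_qbox r s H) as HV.
  assert (E : d2 qf r s = (d2 tau r s - d2 Jq (qf r s) s) / d1 Jq (qf r s) s).
  { apply is_derive_unique.
    apply (implicit_derive_y qbox rbox Jq tau qf); auto; try (simpl; ring).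
    - apply smooth_Jq, good_q_qbox.
    - intros; apply (d1_Jq_neg qbox); auto; apply good_q_qbox.
    - apply smooth_tau_rbox. }
  rewrite E, (d1_Jq qbox) by (auto using good_q_qbox).
  pose proof (kq_pos qbox _ _ good_q_qbox HV); field; lra.
Qed.

Lemma qf_le_1 (r s : R) : rm <= r <= rp -> 0 <= s <= 1 -> qf r s <= 1.
Proof.
  intros Hr Hs; pose proof (inb_rbox r s Hr Hs) as H; pose proof (qf_in_qbox r s H) as HV.
  destruct (Rle_dec (qf r s) 1) as [|Hn]; auto.
  assert (Hlt : Jq (qf r s) s < Jq 1 s).
  { apply (d1_neg_decreasing qbox); auto; try lra.
    - apply smooth_Jq, good_q_qbox.
    - intros; apply (d1_Jq_neg qbox); auto; apply good_q_qbox.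
    - pose proof q0_bounds; split; simpl; lra. }
  rewrite Jq_1 in Hlt; destruct (Hqf r s H) as [_ E]; pose proof (tau_nonneg r s Hr Hs); lra.
Qed.

Lemma qf_lt_1 (r s : R) : rm <= r < rp -> 0 <= s <= 1 -> qf r s < 1.
Proof.
  intros Hr Hs; destruct (qf_le_1 r s ltac:(lra) Hs) as [|E]; auto.
  destruct (Hqf r s (inb_rbox r s ltac:(lra) Hs)) as [_ E']; rewrite E, Jq_1 in E'.
  pose proof (tau_decreasing r rp s); rewrite tau_rp in *; lra.
Qed.

(** The ratio tan th / tan t and [qf] both solve Jq(q, s) = tau(r, s), and [Jq] is strictly
    decreasing in q. They are compared on the box with all q > 0, as the ratio has no lower bound
    beforehand. *)
Lemma theta_eq_ang (r th t : R) :
  rm <= r <= rp -> 0 < t < PI / 2 -> 0 < th <= t -> F_eik Lam M a e rp r th t = 0 ->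
  th = ang (qf r (sin t ^ 2)) t.
Proof.
  intros Hr Ht Hth HF; pose proof (sin2_bounds t) as Hs.
  assert (Htt : 0 < tan t) by (apply tan_gt_0; lra).
  assert (Hth' : 0 < tan th) by (apply tan_gt_0; lra).
  assert (Hq1 : tan th / tan t <= 1).
  { apply Rmult_le_reg_r with (tan t); auto; unfold Rdiv; rewrite Rmult_assoc, Rinv_l by lra.
    destruct (Req_dec th t) as [->|]; [lra|].
    pose proof (tan_increasing th t ltac:(lra) ltac:(lra) ltac:(lra)); lra. }
  assert (Hq0 : 0 < tan th / tan t) by now apply Rdiv_lt_0_compat.
  rewrite (F_eik_eq r th t) in HF by lra.
  assert (Hct : 0 < cos t) by (apply cos_gt_0; lra).
  assert (Hst : 0 < sin t) by (apply sin_gt_0; lra).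
  assert (Hs2 : 0 < sin t ^ 2 < 1).
  { pose proof (sin2_cos2_pow t); pose proof (pow_lt _ 2 Hct); pose proof (pow_lt _ 2 Hst); lra. }
  pose proof (inb_rbox r (sin t ^ 2) Hr Hs) as HB.
  destruct (Hqf r _ HB) as [Hqb E].
  rewrite <- (ang_tan t th) at 1 by lra; f_equal.
  apply (d1_neg_injective (Box 0 (1 + e0) 0 1) Jq _ _ (sin t ^ 2)).
  - apply smooth_Jq, good_q_open.
  - intros; apply (d1_Jq_neg (Box 0 (1 + e0) 0 1)); auto; apply good_q_open.
  - split; cbn [xl xr yl yr]; lra.
  - split; cbn [xl xr yl yr]; lra.
  - lra.
Qed.

(* The derivative of th with respect to ts at fixed r. *)
Definition Thp (r s : R) : R := (qf r s + 2 * s * (1 - s) * d2 qf r s) / w1 (qf r s) s.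

(** The right side is - (1 / P) d th / d ts, as differentiating F(r, th(r, ts), ts) = 0 suggests. It
    is derived from the closed form of F with th frozen; [d2_qf] brings in the derivative of q. *)
Lemma G_eik_eq (r t : R) : rm < r < rp -> 0 < t < PI / 2 ->
  G_eik Lam M a e rp r (ang (qf r (sin t ^ 2)) t) t =
  - (kq (qf r (sin t ^ 2)) (sin t ^ 2) / (sin t * cos t) *
     (qf r (sin t ^ 2) + 2 * sin t ^ 2 * (1 - sin t ^ 2) * d2 qf r (sin t ^ 2))).
Proof.
  intros Hr Ht; set (s := sin t ^ 2); set (q := qf r s); set (th := ang q t).
  pose proof (sin2_bounds t) as Hs.
  assert (Hct : 0 < cos t) by (apply cos_gt_0; lra).
  assert (Hst : 0 < sin t) by (apply sin_gt_0; lra).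
  assert (Htt : 0 < tan t) by (apply tan_gt_0; lra).
  assert (HB : inb rbox r s) by (apply inb_rbox; unfold s; lra).
  pose proof (qf_in_qbox r s HB) as HV; pose proof (qf_pos r s HB) as Hq.
  assert (Hq1 : q < 1) by (apply qf_lt_1; unfold s; lra).
  assert (Hth : 0 < th < t) by now apply ang_bounds_strict.
  assert (Eth : tan th = q * tan t) by now apply tan_ang.
  assert (Ep : tan th / tan t = q) by (rewrite Eth; field; lra).
  unfold G_eik.
  assert (Hp : is_derive (fun u => tan th / tan u) t (- q / (sin t * cos t))).
  { evar_last.
    - apply (is_derive_scal (fun u => / tan u) t (tan th)).
      apply (is_derive_inv tan t (tan t ^ 2 + 1)); [apply is_derive_tan; lra | lra].
    - rewrite Eth; unfold tan; pose proof (sin2_cos2_pow t) as Hsc.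
      field_simplify_eq; [|repeat split; lra].
      replace (cos t ^ 3) with (cos t * cos t ^ 2) by ring.
      replace (cos t ^ 2) with (1 - sin t ^ 2) by lra; ring. }
  assert (Hz : is_derive (fun u => sin u ^ 2) t (2 * (sin t * cos t))).
  { auto_derive; auto; ring. }
  (* The closed form of F is available only for u near t, which is enough for the derivative. *)
  rewrite (Derive_ext_loc _ (fun u => tau r (sin u ^ 2) - Jq (tan th / tan u) (sin u ^ 2))).
  - apply is_derive_unique.
    replace (- (kq q s / (sin t * cos t) * (q + 2 * s * (1 - s) * d2 qf r s)))
      with (2 * (sin t * cos t) * d2 tau r s
            - (- kq q s * (- q / (sin t * cos t)) + d2 Jq q s * (2 * (sin t * cos t)))).
    2: { pose proof (d2_qf r s HB) as E; fold q in E.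
         transitivity (2 * (sin t * cos t) * (d2 tau r s - d2 Jq q s)
                       - kq q s * q / (sin t * cos t)); [field; lra|].
         rewrite E; replace (1 - s) with (cos t ^ 2)
           by (pose proof (sin2_cos2_pow t); unfold s; lra).
         unfold s; field; lra. }
    apply (is_derive_minus (fun u => tau r (sin u ^ 2))
             (fun u => Jq (tan th / tan u) (sin u ^ 2))).
    + apply (is_derive_comp (fun z => tau r z) (fun u => sin u ^ 2)); auto.
      apply (smooth_is_derive rbox); auto; apply smooth_tau_rbox.
    + apply is_derive_Reals.
      apply (derivable_pt_lim_comp_2d Jq (fun u => tan th / tan u) (fun u => sin u ^ 2)).
      * pose proof (d1_Jq _ _ _ good_q_qbox HV) as Ed; fold q in Ed.
        rewrite Ep; fold s; rewrite <- Ed.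
        apply (smooth_differentiable qbox); auto; apply smooth_Jq, good_q_qbox.
      * now apply is_derive_Reals.
      * now apply is_derive_Reals.
  - assert (Hc : continuous (fun u => tan th / tan u) t).
    { apply (ex_derive_continuous (K := R_AbsRing) (V := R_NormedModule)).
      exists (- q / (sin t * cos t)); exact Hp. }
    assert (Hl1 : locally t (fun u => 0 < u < PI / 2)) by now apply locally_open_interval.
    assert (Hl2 : locally t (fun u => tan th / tan u < 1 + e0)).
    { apply (Hc (fun z => z < 1 + e0)), (open_lt (1 + e0)); lra. }
    generalize (filter_and _ _ Hl1 Hl2); apply filter_imp; intros u [Hu1 Hu2].
    apply F_eik_eq; lra.
Qed.

Lemma L_at (r t : R) : rm < r < rp -> 0 < t < PI / 2 ->
  - (G_eik Lam M a e rp r (ang (qf r (sin t ^ 2)) t) t *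
     P_pot Lam a (ang (qf r (sin t ^ 2)) t) t * Q_pot Lam M a e r t) =
  Qs r (sin t ^ 2) * Thp r (sin t ^ 2).
Proof.
  intros Hr Ht; pose proof (sin2_bounds t) as Hs.
  assert (HB : inb rbox r (sin t ^ 2)) by (apply inb_rbox; lra).
  assert (Hct : 0 < cos t) by (apply cos_gt_0; lra).
  assert (Hst : 0 < sin t) by (apply sin_gt_0; lra).
  destruct (qf_w _ _ HB) as [W1 W2].
  rewrite G_eik_eq, P_pot_ang by (auto; try lra; now apply qf_pos).
  change (Q_pot Lam M a e r t) with (Qs r (sin t ^ 2)).
  pose proof (sqrt_lt_R0 _ W1); pose proof (sqrt_lt_R0 _ W2).
  unfold Thp, kq, ww; rewrite sqrt_div_alt, sqrt_mult by lra.
  set (s := sin t ^ 2) in *; set (q := qf r s) in *.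
  replace (w1 q s) with (sqrt (w1 q s) ^ 2) at 3 by (apply pow2_sqrt; lra).
  field; repeat split; lra.
Qed.

(** * The integrals that make up rstar *)

Definition N (r : R) : R := r ^ 2 + a ^ 2.

Lemma N_pos (r : R) : 0 < N r.
Proof. unfold N; pose proof (pow2_ge_0 r); pose proof (pow_lt a 2 ha); lra. Qed.

(* (r^2 + a^2 - Q) / Delta_r without the removable singularity at rp. *)
Definition rad_integrand (r s : R) : R := a ^ 2 * s / (N r + Qs r s).
Definition rad_part (r s : R) : R := - RInt (fun r' => rad_integrand r' s) rp r.
Definition ang_integrand (th t : R) : R := P_pot Lam a th t / Delta_th Lam a th.
Definition ang_part (x t : R) : R := RInt (fun th => ang_integrand th t) 0 x.
Definition Th (r t : R) : R := ang (qf r (sin t ^ 2)) t.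

Definition fD (r s : R) : R := Dq (qf r s) s.
Definition fww (r s : R) : R := ww (qf r s) s.
(** This is Q^2 Delta_th + P^2 Delta_r along the solution, since P^2 = s (1 - s) fww^2 there. *)
Definition Den (r s : R) : R :=
  Q2 r s * fD r s + s * (1 - s) * fww r s ^ 2 * Delta_r Lam M a e r.
(* [AA] is d rstar / d r at fixed ts, and [Ups] is (1 / sin (2 ts)) d rstar / d ts at
   fixed r. *)
Definition AA (r s : R) : R := Den r s / (Delta_r Lam M a e r * Qs r s * fD r s).
Definition Ups (r s : R) : R := fww r s * Thp r s / (2 * fD r s).

Lemma Qs_sqr (r s : R) : inb rbox r s -> Qs r s * Qs r s = Q2 r s.
Proof. intros H; apply sqrt_sqrt; left; apply HQ, rbox_sub, H. Qed.

Lemma Qs_pos' (r s : R) : inb rbox r s -> 0 < Qs r s.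
Proof. intros H; apply Qs_pos, rbox_sub, H. Qed.

Lemma smooth_rad_integrand : smooth rbox rad_integrand.
Proof.
  apply smooth_div.
  - intros r s H; pose proof (N_pos r); pose proof (Qs_pos' r s H); lra.
  - smooth_tac.
  - apply smooth_plus; [unfold N; smooth_tac | apply smooth_Qs_rbox].
Qed.

Lemma rp_in_rbox : xl rbox < rp < xr rbox.
Proof. destruct hsub as (_ & _ & H & _); simpl; lra. Qed.

Lemma smooth_rad_part : smooth rbox rad_part.
Proof. apply smooth_opp, smooth_RInt; [apply rp_in_rbox | apply smooth_rad_integrand]. Qed.

Lemma rad_part_r (r s : R) : inb rbox r s ->
  is_derive (fun r => rad_part r s) r (- rad_integrand r s).
Proof.
  intros H; apply (is_derive_opp (fun r => RInt (fun r' => rad_integrand r' s) rp r)).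
  apply (RInt_primitive_x rbox 0); auto; [apply smooth_rad_integrand | apply rp_in_rbox].
Qed.

(** Where Delta_r is not 0 the integrand is (N - Q) / Delta_r, and Q has s-derivative - a^2 Delta_r
    / (2 Q). The rationalised form gives the same value at the roots of Delta_r. *)
Lemma rad_integrand_s (r s : R) : inb rbox r s ->
  is_derive (fun s => rad_integrand r s) s (a ^ 2 / 2 * / Qs r s).
Proof.
  intros H; pose proof (Qs_pos' r s H) as HQp; pose proof (Qs_sqr r s H) as Hsq.
  pose proof (N_pos r) as HN; pose proof (HQ r s (rbox_sub r s H)) as HQ2.
  unfold rad_integrand, Qs, Q2 in *; fold (N r) in *.
  set (D := Delta_r Lam M a e r) in *.
  auto_derive.
  - repeat split; try lra.
    replace (N r * (N r * 1) + - (a * (a * 1) * s * D)) with (N r ^ 2 - a ^ 2 * s * D) by ring; lra.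
  - replace (N r * (N r * 1) + - (a * (a * 1) * s * D)) with (N r ^ 2 - a ^ 2 * s * D) by ring.
    set (z := sqrt (N r ^ 2 - a ^ 2 * s * D)) in *.
    apply Rmult_eq_reg_r with (2 * z * (N r + z) ^ 2).
    + transitivity (2 * z * (a ^ 2) * (N r + z) + a ^ 2 * (a ^ 2 * s * D)); [field; lra|].
      transitivity (a ^ 2 * (N r + z) ^ 2); [|field; lra].
      replace (a ^ 2 * s * D) with (N r ^ 2 - z * z) by lra; ring.
    + apply Rmult_integral_contrapositive_currified; [lra | apply pow_nonzero; lra].
Qed.

Lemma rad_part_s (r s : R) : inb rbox r s ->
  is_derive (fun s => rad_part r s) s (a ^ 2 / 2 * tau r s).
Proof.
  intros H.
  assert (E : RInt (fun t => a ^ 2 / 2 * / Qs t s) rp r = a ^ 2 / 2 * - tau r s).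
  { unfold tau; rewrite Ropp_involutive.
    apply (RInt_scal (fun t => / Qs t s) rp r (a ^ 2 / 2)).
    apply (Cn_ex_RInt rbox 0 (fun r s => / Qs r s)); auto using rp_in_rbox.
    apply (smooth_sub (nbox rm rp 0 1 e0)); [apply rbox_sub | apply smooth_Qs_inv]. }
  replace (a ^ 2 / 2 * tau r s) with (- RInt (fun t => a ^ 2 / 2 * / Qs t s) rp r)
    by (rewrite E; ring).
  apply (is_derive_opp (fun s => RInt (fun r' => rad_integrand r' s) rp r)).
  apply (RInt_derive_param rbox rad_integrand (fun r s => a ^ 2 / 2 * / Qs r s)); auto.
  - apply rp_in_rbox.
  - apply smooth_rad_integrand.
  - apply (smooth_mult rbox (fun _ _ => a ^ 2 / 2)); [apply smooth_const|].
    apply (smooth_sub (nbox rm rp 0 1 e0)); [apply rbox_sub | apply smooth_Qs_inv].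
  - apply rad_integrand_s.
Qed.

Lemma Delta_th_ge_1 (th : R) : 1 <= Delta_th Lam a th.
Proof.
  unfold Delta_th; pose proof lam_pos as Hl; unfold lam in Hl.
  pose proof (Rmult_le_pos _ _ (Rlt_le _ _ Hl) (pow2_ge_0 (cos th))); lra.
Qed.

(** Valid on the whole plane: where the radicand is negative, [sqrt] is 0 and still continuous. *)
Lemma P_pot_continuous (th t : R) : continuity_2d_pt (P_pot Lam a) th t.
Proof.
  unfold P_pot.
  apply continuity_2d_pt_mult; [apply continuity_2d_pt_const|].
  apply (continuity_1d_2d_pt_comp sqrt).
  { apply continuity_pt_filterlim, continuous_sqrt. }
  assert (Hs2 : forall u, continuity_pt (fun u => sin u ^ 2) u) by (intros u; reg).
  assert (HD : forall u, continuity_pt (fun u => Delta_th Lam a u) u)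
    by (intros u; unfold Delta_th; reg).
  apply continuity_2d_pt_minus; [apply continuity_2d_pt_mult|].
  - apply (continuity_1d_2d_pt_comp (fun u => sin u ^ 2) (fun _ t => t));
      [apply Hs2 | apply continuity_2d_pt_id2].
  - apply (continuity_1d_2d_pt_comp (Delta_th Lam a) (fun th _ => th));
      [apply HD | apply continuity_2d_pt_id1].
  - apply (continuity_1d_2d_pt_comp (fun u => sin u ^ 2) (fun th _ => th));
      [apply Hs2 | apply continuity_2d_pt_id1].
Qed.

Lemma Cn_0_ang_integrand (Bx : box) : Cn Bx 0 ang_integrand.
Proof.
  intros th t _; apply continuity_2d_pt_mult; [apply P_pot_continuous|].
  apply continuity_2d_pt_inv; [|pose proof (Delta_th_ge_1 th); lra].
  apply (continuity_1d_2d_pt_comp (Delta_th Lam a) (fun th _ => th));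
    [unfold Delta_th; reg | apply continuity_2d_pt_id1].
Qed.

Lemma ang_part_x (x t : R) : is_derive (fun x => ang_part x t) x (ang_integrand x t).
Proof.
  set (Bx := Box (Rmin 0 x - 1) (Rmax 0 x + 1) (t - 1) (t + 1)).
  pose proof (Rmin_l 0 x); pose proof (Rmin_r 0 x).
  pose proof (Rmax_l 0 x); pose proof (Rmax_r 0 x).
  apply (RInt_primitive_x Bx 0); [apply Cn_0_ang_integrand | simpl; lra | split; simpl; lra].
Qed.

Lemma ww_kq (q s : R) : 0 < w1 q s -> 0 < w2 q -> / (kq q s * w1 q s) = ww q s.
Proof.
  intros W1 W2; pose proof (sqrt_lt_R0 _ W1); pose proof (sqrt_lt_R0 _ W2).
  unfold kq, ww; rewrite sqrt_div_alt, sqrt_mult by lra.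
  replace (w1 q s) with (sqrt (w1 q s) ^ 2) at 2 by (apply pow2_sqrt; lra).
  field; repeat split; lra.
Qed.

Lemma fD_ge_1 (r s : R) : rm <= r <= rp -> 0 <= s <= 1 -> 1 <= fD r s.
Proof.
  intros Hr Hs; destruct (qf_w r s (inb_rbox r s Hr Hs)) as [W1 _].
  unfold fD, Dq; assert (0 <= lam * (1 - s) / w1 (qf r s) s).
  { apply Rdiv_le_0_compat; auto; apply Rmult_le_pos; [left; apply lam_pos | lra]. }
  lra.
Qed.

Lemma ang_integrand_Th (r t : R) : rm <= r <= rp -> 0 <= t <= PI / 2 ->
  ang_integrand (Th r t) t = sin t * cos t * fww r (sin t ^ 2) / fD r (sin t ^ 2).
Proof.
  intros Hr Ht; pose proof (qf_pos _ _ (inb_rbox r _ Hr (sin2_bounds t))).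
  unfold ang_integrand, Th; now rewrite P_pot_ang, Delta_th_ang.
Qed.

Lemma Th_t (r t : R) : rm <= r <= rp ->
  is_derive (fun t => Th r t) t (Thp r (sin t ^ 2)).
Proof.
  intros Hr; pose proof (inb_rbox r _ Hr (sin2_bounds t)) as HB.
  evar_last.
  - unfold Th; apply (is_derive_ang (fun t => qf r (sin t ^ 2)) (fun t => t)).
    + now apply qf_pos.
    + apply (is_derive_comp (fun s => qf r s) (fun t => sin t ^ 2)).
      * exact (proj2 (smooth_is_derive _ qf _ _ smooth_qf HB)).
      * apply is_derive_sin2.
    + apply (is_derive_id (K := R_AbsRing)).
  - unfold Thp, scal, one; simpl; unfold mult; simpl.
    fold (sin t ^ 2); change (sin t * (sin t * 1)) with (sin t ^ 2).
    unfold Rdiv; f_equal.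
    replace (1 - sin t ^ 2) with (cos t ^ 2) by (pose proof (sin2_cos2_pow t); lra); ring.
Qed.

Lemma Th_range (r t : R) : rm <= r < rp -> 0 < t < PI / 2 -> 0 < Th r t < t.
Proof.
  intros Hr Ht; pose proof (sin2_bounds t) as Hs; apply ang_bounds_strict; auto; split.
  - apply qf_pos, inb_rbox; lra.
  - now apply qf_lt_1.
Qed.

Lemma P_pot_pos_near (t1 x t : R) : - t1 < x < t1 -> t1 < t < PI / 2 ->
  0 < sin t ^ 2 * Delta_th Lam a x - sin x ^ 2.
Proof.
  intros Hx Ht; pose proof (sin2_lt x t1 t Hx Ht) as Hlt.
  pose proof (Delta_th_ge_1 x); pose proof (sin2_bounds t); nra.
Qed.

Lemma ang_integrand_t (t1 x t : R) : - t1 < x < t1 -> t1 < t < PI / 2 ->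
  is_derive (fun t => ang_integrand x t) t (a ^ 2 * (sin t * cos t) * / P_pot Lam a x t).
Proof.
  intros Hx Ht; pose proof (P_pot_pos_near t1 x t Hx Ht) as Hp.
  pose proof (Delta_th_ge_1 x) as HD.
  unfold ang_integrand, P_pot; set (D := Delta_th Lam a x) in *.
  auto_derive.
  - replace (sin t * (sin t * 1) * D + - (sin x * (sin x * 1)))
      with (sin t ^ 2 * D - sin x ^ 2) by ring; auto.
  - replace (sin t * (sin t * 1) * D + - (sin x * (sin x * 1)))
      with (sin t ^ 2 * D - sin x ^ 2) by ring.
    pose proof (sqrt_lt_R0 _ Hp); field; repeat split; lra.
Qed.

(** The threshold t1 separates th from ts and so keeps the radicand of P positive on the box. In the
    ts-derivative of P / Delta_th the factor Delta_th of the radicand cancels, leaving a^2 sin ts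
    cos ts / P. *)
Lemma ang_part_t (t1 x t : R) : - t1 < x < t1 -> t1 < t < PI / 2 ->
  differentiable_pt_lim ang_part x t (ang_integrand x t)
    (a ^ 2 * (sin t * cos t) * RInt (fun th => / P_pot Lam a th t) 0 x) /\
  ex_RInt (fun th => / P_pot Lam a th t) 0 x.
Proof.
  intros Hx Ht.
  set (Bt := Box (- t1) t1 t1 (PI / 2)).
  assert (Hb : forall u v, inb Bt u v -> - t1 < u < t1 /\ t1 < v < PI / 2) by auto.
  assert (Hxt : inb Bt x t) by (split; auto).
  assert (H0 : xl Bt < 0 < xr Bt) by (simpl; lra).
  assert (HiP : Cn Bt 0 (fun x t => / P_pot Lam a x t)).
  { intros u v Huv; apply continuity_2d_pt_inv; [apply P_pot_continuous|].
    destruct (Hb u v Huv) as [Hu Hv]; pose proof (sqrt_lt_R0 _ (P_pot_pos_near t1 u v Hu Hv)).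
    unfold P_pot; apply Rmult_integral_contrapositive_currified; lra. }
  assert (Hex : forall u v, inb Bt u v -> ex_RInt (fun th => / P_pot Lam a th v) 0 u).
  { intros u v Huv; now apply (Cn_ex_RInt Bt 0 (fun x t => / P_pot Lam a x t)). }
  split; [|now apply Hex].
  apply (partials_differentiable Bt ang_part ang_integrand
    (fun x t => a ^ 2 * (sin t * cos t) * RInt (fun th => / P_pot Lam a th t) 0 x));
    auto; [|now apply (Cn_0_ang_integrand Bt)].
  intros u v Huv; split; [apply ang_part_x|].
  replace (a ^ 2 * (sin v * cos v) * RInt (fun th => / P_pot Lam a th v) 0 u)
    with (RInt (fun th => a ^ 2 * (sin v * cos v) * / P_pot Lam a th v) 0 u)
    by (apply (RInt_scal (fun th => / P_pot Lam a th v) 0 u); auto).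
  apply (RInt_derive_param Bt ang_integrand
           (fun x t => a ^ 2 * (sin t * cos t) * / P_pot Lam a x t)); auto.
  - apply Cn_0_ang_integrand.
  - intros u' v' Huv'; apply continuity_2d_pt_mult; [|now apply HiP].
    apply (continuity_1d_2d_pt_comp (fun t => a ^ 2 * (sin t * cos t)) (fun _ t => t));
      [reg | apply continuity_2d_pt_id2].
  - intros u' v' Huv'; destruct (Hb u' v' Huv'); now apply (ang_integrand_t t1).
Qed.

Lemma fww_sqr (r s : R) : inb rbox r s ->
  fww r s ^ 2 = a ^ 2 * (w2 (qf r s) / w1 (qf r s) s).
Proof.
  intros H; destruct (qf_w r s H); unfold fww, ww; rewrite Rpow_mult_distr, pow2_sqrt; auto.
  left; now apply Rdiv_lt_0_compat.
Qed.

(** The two summands of [Den] have opposite signs, but after expansion they combine to (r^2 + a^2)^2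
    Delta_th - a^2 sin^2 th Delta_r, where sin^2 th = s q^2 / w1. Both terms have the right sign
    since Delta_r <= 0. *)
Lemma Den_pos (r s : R) : rm <= r <= rp -> 0 <= s <= 1 -> 0 < Den r s.
Proof.
  intros Hr Hs; pose proof (inb_rbox r s Hr Hs) as HB; destruct (qf_w r s HB) as [W1 W2].
  pose proof (Delta_r_nonpos r Hr) as HD; pose proof (fD_ge_1 r s Hr Hs) as HfD.
  replace (Den r s) with (N r ^ 2 * fD r s
    + a ^ 2 * s * qf r s ^ 2 * - Delta_r Lam M a e r / w1 (qf r s) s).
  - pose proof (pow_lt _ 2 (N_pos r)).
    assert (0 < N r ^ 2 * fD r s) by (apply Rmult_lt_0_compat; lra).
    assert (0 <= a ^ 2 * s * qf r s ^ 2 * - Delta_r Lam M a e r / w1 (qf r s) s).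
    { apply Rdiv_le_0_compat; auto; apply Rmult_le_pos; [|lra].
      pose proof (pow2_ge_0 (qf r s)); pose proof (pow2_ge_0 a).
      apply Rmult_le_pos; [apply Rmult_le_pos; lra | lra]. }
    lra.
  - unfold Den, Q2; rewrite fww_sqr by auto; fold (N r); unfold fD, Dq.
    apply Rmult_eq_reg_r with (w1 (qf r s) s); [|lra]; field_simplify; try lra.
    unfold w1, w2; ring.
Qed.

Lemma smooth_w1_qf : smooth rbox (fun r s => w1 (qf r s) s).
Proof. apply smooth_of_qf, smooth_w1. Qed.

Lemma smooth_fD : smooth rbox fD.
Proof.
  apply smooth_plus; [apply smooth_const|]; apply smooth_div.
  - intros r s H; destruct (qf_w r s H); lra.
  - smooth_tac.
  - apply smooth_w1_qf.
Qed.

Lemma smooth_fww : smooth rbox fww.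
Proof.
  apply smooth_mult; [apply smooth_const|]; apply smooth_sqrt.
  - intros r s H; destruct (qf_w r s H); now apply Rdiv_lt_0_compat.
  - apply smooth_div.
    + intros r s H; destruct (qf_w r s H); lra.
    + apply (smooth_of_qf (fun q s => w2 q)), smooth_w2.
    + apply smooth_w1_qf.
Qed.

Lemma smooth_Den : smooth rbox Den.
Proof.
  apply smooth_plus; apply smooth_mult.
  - apply smooth_Q2.
  - apply smooth_fD.
  - apply smooth_mult; [smooth_tac | apply smooth_pow, smooth_fww].
  - apply smooth_Delta_r.
Qed.

Lemma smooth_Thp : smooth rbox Thp.
Proof.
  apply smooth_div.
  - intros r s H; destruct (qf_w r s H); lra.
  - apply smooth_plus; [apply smooth_qf|].
    apply smooth_mult; [smooth_tac | apply smooth_d2, smooth_qf].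
  - apply smooth_w1_qf.
Qed.

Lemma den_chart_exists : exists e2, 0 < e2 <= e1 /\
  forall r s, inb (nbox rm rp 0 1 e2) r s -> 0 < fD r s /\ 0 < Den r s.
Proof.
  destruct hsub as (_ & _ & Hr & _).
  destruct (positive_near_rectangle fD rm rp 0 1 e1) as (e2 & He2 & P2); try lra.
  { intros x y Hxy; exact (smooth_continuous _ _ _ _ smooth_fD Hxy). }
  { intros r s Hr' Hs; pose proof (fD_ge_1 r s Hr' Hs); lra. }
  destruct (positive_near_rectangle Den rm rp 0 1 e1) as (e3 & He3 & P3); try lra.
  { intros x y Hxy; exact (smooth_continuous _ _ _ _ smooth_Den Hxy). }
  { apply Den_pos. }
  exists (Rmin e2 e3); pose proof (Rmin_l e2 e3); pose proof (Rmin_r e2 e3).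
  split; [split; [apply Rmin_glb_lt; lra | lra]|].
  intros r s [H1 H2]; simpl in H1, H2; split; [apply P2 | apply P3]; split; simpl; lra.
Qed.

(** * The two vector fields in the variables (r, s) *)

Section DenChart.

Variable e2 : R.
Hypothesis He2 : 0 < e2 <= e1.
Hypothesis HDen : forall r s, inb (nbox rm rp 0 1 e2) r s -> 0 < fD r s /\ 0 < Den r s.

Definition dbox : box := nbox rm rp 0 1 e2.

Lemma dbox_sub (r s : R) : inb dbox r s -> inb rbox r s.
Proof. intros [H1 H2]; simpl in H1, H2; split; simpl; lra. Qed.

Lemma inb_dbox (r s : R) : rm <= r <= rp -> 0 <= s <= 1 -> inb dbox r s.
Proof. intros; split; simpl; lra. Qed.

Lemma smooth_dbox (g : R -> R -> R) : smooth rbox g -> smooth dbox g.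
Proof. apply smooth_sub, dbox_sub. Qed.

(* [Xc] and [Yc] are the derivatives of r along d/drs and (1 / sin (2 ts)) d/dts; [X] and
   [Y] are these two operators acting on functions of (r, s). *)
Definition Phi (r s : R) : R := Qs r s * fD r s / Den r s.
Definition Xc (r s : R) : R := Delta_r Lam M a e r * Phi r s.
Definition Yc (r s : R) : R := - (Ups r s * Xc r s).

Definition X (g : R -> R -> R) : R -> R -> R := fun r s => Xc r s * d1 g r s.
Definition Y (g : R -> R -> R) : R -> R -> R := fun r s => d2 g r s + Yc r s * d1 g r s.

Lemma smooth_Phi : smooth dbox Phi.
Proof.
  apply smooth_div.
  - intros r s H; destruct (HDen r s H); lra.
  - apply smooth_mult; apply smooth_dbox; [apply smooth_Qs_rbox | apply smooth_fD].
  - apply smooth_dbox, smooth_Den.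
Qed.

Lemma smooth_Ups : smooth dbox Ups.
Proof.
  apply smooth_div.
  - intros r s H; destruct (HDen r s H); lra.
  - apply smooth_mult; apply smooth_dbox; [apply smooth_fww | apply smooth_Thp].
  - apply smooth_mult; [apply smooth_const | apply smooth_dbox, smooth_fD].
Qed.

Lemma smooth_Xc : smooth dbox Xc.
Proof. apply smooth_mult; [apply smooth_Delta_r | apply smooth_Phi]. Qed.

Lemma smooth_Yc : smooth dbox Yc.
Proof. apply smooth_opp, smooth_mult; [apply smooth_Ups | apply smooth_Xc]. Qed.

Lemma smooth_X (g : R -> R -> R) : smooth dbox g -> smooth dbox (X g).
Proof. intros H; apply smooth_mult; [apply smooth_Xc | now apply smooth_d1]. Qed.

Lemma smooth_Y (g : R -> R -> R) : smooth dbox g -> smooth dbox (Y g).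
Proof.
  intros H; apply smooth_plus; [now apply smooth_d2|].
  apply smooth_mult; [apply smooth_Yc | now apply smooth_d1].
Qed.

Lemma smooth_iter_X (n : nat) (g : R -> R -> R) : smooth dbox g -> smooth dbox (Nat.iter n X g).
Proof. intros H; induction n; [auto | now apply smooth_X]. Qed.

Lemma smooth_iter_Y (n : nat) (g : R -> R -> R) : smooth dbox g -> smooth dbox (Nat.iter n Y g).
Proof. intros H; induction n; [auto | now apply smooth_Y]. Qed.

(** [AA] blows up at the horizons, whereas its inverse [Xc], the derivative of r along d/drs, is
    smooth across them and vanishes there. *)
Lemma AA_inv (r s : R) : rm < r < rp -> 0 <= s <= 1 -> AA r s < 0 /\ / AA r s = Xc r s.
Proof.
  intros Hr Hs; pose proof (Delta_r_neg r Hr) as HD.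
  assert (HB : inb rbox r s) by (apply inb_rbox; lra).
  pose proof (Qs_pos' r s HB) as HQp; pose proof (Den_pos r s ltac:(lra) Hs) as Hd.
  pose proof (fD_ge_1 r s ltac:(lra) Hs) as HfD.
  assert (E : / AA r s = Xc r s) by (unfold AA, Xc, Phi; field; repeat split; lra).
  split; auto.
  assert (Xc r s < 0).
  { unfold Xc, Phi; assert (0 < Qs r s * fD r s / Den r s).
    { apply Rdiv_lt_0_compat; auto; apply Rmult_lt_0_compat; lra. }
    nra. }
  rewrite <- (Rinv_inv (AA r s)), E; now apply Rinv_lt_0_compat.
Qed.

Lemma smooth_AA : smooth (Box rm rp (- e2) (1 + e2)) AA.
Proof.
  assert (Hsub : forall r s, inb (Box rm rp (- e2) (1 + e2)) r s -> inb dbox r s).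
  { intros r s [H1 H2]; simpl in H1, H2; split; simpl; lra. }
  apply smooth_div.
  - intros r s H; pose proof (Delta_r_neg r (proj1 H)).
    pose proof (Qs_pos' r s (dbox_sub _ _ (Hsub r s H))); destruct (HDen r s (Hsub r s H)).
    repeat apply Rmult_integral_contrapositive_currified; lra.
  - apply (smooth_sub dbox); auto; apply smooth_dbox, smooth_Den.
  - apply (smooth_sub dbox); auto; apply smooth_mult; [apply smooth_mult|].
    + apply smooth_Delta_r.
    + apply smooth_dbox, smooth_Qs_rbox.
    + apply smooth_dbox, smooth_fD.
Qed.

(* In the coordinates (rs, ts): [Tq] is d th / d ts, [Tx] is
   (1 / sin (2 ts)) d th / d rs and [Lg] is L. *)
Definition Tq (r s : R) : R :=
  (qf r s + 2 * s * (1 - s) * Y qf r s) / w1 (qf r s) s.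
Definition Tx (r s : R) : R := X qf r s / (2 * w1 (qf r s) s).
Definition Lg (r s : R) : R := Qs r s * Thp r s.

Lemma smooth_Tq : smooth dbox Tq.
Proof.
  pose proof (smooth_dbox _ smooth_qf) as Hq; apply smooth_div.
  - intros r s H; destruct (qf_w r s (dbox_sub _ _ H)); lra.
  - apply smooth_plus; auto; apply smooth_mult; [smooth_tac | now apply smooth_Y].
  - apply smooth_dbox, smooth_w1_qf.
Qed.

Lemma smooth_Lg : smooth dbox Lg.
Proof. apply smooth_dbox, smooth_mult; [apply smooth_Qs_rbox | apply smooth_Thp]. Qed.

(** * The ideal generated by Delta_r *)

Definition vanishing (g : R -> R -> R) : Prop :=
  exists h, smooth dbox h /\
    forall r s, inb dbox r s -> g r s = Delta_r Lam M a e r * h r s.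

Lemma vanishing_smooth (g : R -> R -> R) : vanishing g -> smooth dbox g.
Proof.
  intros (h & Hh & E); apply (smooth_ext dbox (fun r s => Delta_r Lam M a e r * h r s)).
  - intros r s H; symmetry; auto.
  - apply smooth_mult; auto; apply smooth_Delta_r.
Qed.

Lemma vanishing_X (g : R -> R -> R) : smooth dbox g -> vanishing (X g).
Proof.
  intros Hg; exists (fun r s => Phi r s * d1 g r s); split.
  - apply smooth_mult; [apply smooth_Phi | now apply smooth_d1].
  - intros r s _; unfold X, Xc; ring.
Qed.

Lemma vanishing_iter_X (n : nat) (g : R -> R -> R) :
  smooth dbox g -> (1 <= n)%nat -> vanishing (Nat.iter n X g).
Proof.
  intros Hg Hn; destruct n as [|n]; [lia|]; now apply vanishing_X, smooth_iter_X.
Qed.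

(** For g = Delta_r h, the term d2 g keeps the factor because Delta_r does not depend on s, and in
    the other term the coefficient [Yc] is itself a multiple of Delta_r. *)
Lemma vanishing_Y (g : R -> R -> R) : vanishing g -> vanishing (Y g).
Proof.
  intros Hg; pose proof (vanishing_smooth g Hg) as Hgs; destruct Hg as (h & Hh & E).
  exists (fun r s => d2 h r s + - (Ups r s * Phi r s) * d1 g r s); split.
  - apply smooth_plus; [now apply smooth_d2|].
    apply smooth_mult; [apply smooth_opp, smooth_mult | now apply smooth_d1].
    + apply smooth_Ups.
    + apply smooth_Phi.
  - intros r s H; unfold Y, Yc, Xc.
    assert (E2 : d2 g r s = Delta_r Lam M a e r * d2 h r s).
    { apply is_derive_unique.
      apply (is_derive_ext_loc (fun s => Delta_r Lam M a e r * h r s)).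
      - generalize (inb_locally_y _ _ _ H); apply filter_imp; intros v Hv; symmetry; auto.
      - apply (is_derive_scal (fun s => h r s) s (Delta_r Lam M a e r)).
        exact (proj2 (smooth_is_derive _ _ _ _ Hh H)). }
    rewrite E2; ring.
Qed.

(** The function r is not in the ideal, but its first derivatives [Xc] and [Yc] are. If an [X]
    occurs, it is outermost and maps into the ideal; otherwise [Y] preserves it. *)
Lemma vanishing_mixed_r (k1 k2 : nat) : (1 <= k1 + k2)%nat ->
  vanishing (Nat.iter k1 X (Nat.iter k2 Y (fun r _ => r))).
Proof.
  intros Hk; destruct k1 as [|k1].
  - destruct k2 as [|k2]; [simpl in Hk; lia|]; clear Hk; simpl Nat.iter at 1.
    induction k2 as [|k2 IH]; [|now apply vanishing_Y].
    exists (fun r s => - (Ups r s * Phi r s)); split.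
    + apply smooth_opp, smooth_mult; [apply smooth_Ups | apply smooth_Phi].
    + intros r s H; simpl; unfold Y, Yc, Xc.
      replace (d1 (fun r _ => r) r s) with 1 by (symmetry; exact (Derive_id r)).
      replace (d2 (fun r _ => r) r s) with 0 by (symmetry; exact (Derive_const r s)).
      ring.
  - apply vanishing_iter_X; [apply smooth_iter_Y, smooth_fst | lia].
Qed.

Lemma vanishing_Tx : vanishing Tx.
Proof.
  pose proof (smooth_dbox _ smooth_qf) as Hq.
  assert (Hw0 : forall r s, inb dbox r s -> 2 * w1 (qf r s) s <> 0).
  { intros r s H; destruct (qf_w r s (dbox_sub _ _ H)); lra. }
  exists (fun r s => Phi r s * d1 qf r s / (2 * w1 (qf r s) s)); split.
  - apply smooth_div; auto.
    + apply smooth_mult; [apply smooth_Phi | now apply smooth_d1].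
    + apply smooth_mult; [apply smooth_const | apply smooth_dbox, smooth_w1_qf].
  - intros r s H; unfold Tx, X, Xc, Rdiv; ring.
Qed.

Lemma vanishing_iter_Tx (n : nat) : vanishing (Nat.iter n X Tx).
Proof.
  destruct n as [|n]; [apply vanishing_Tx|].
  apply vanishing_X, smooth_iter_X, vanishing_smooth, vanishing_Tx.
Qed.

(** * Uniform bounds on the rectangle *)

Lemma smooth_bounded (g : R -> R -> R) : smooth dbox g ->
  exists C, 0 < C /\ forall r s, rm <= r <= rp -> 0 <= s <= 1 -> Rabs (g r s) <= C.
Proof.
  intros Hg; destruct (bounded_on_rectangle g rm rp 0 1) as (C & HC & H).
  - intros r s Hr Hs; apply (smooth_continuous dbox); auto; now apply inb_dbox.
  - exists C; auto.
Qed.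

Lemma vanishing_bounded (g : R -> R -> R) : vanishing g ->
  exists C, 0 < C /\ forall r s, rm <= r <= rp -> 0 <= s <= 1 ->
    Rabs (g r s) <= C * Rabs (Delta_r Lam M a e r).
Proof.
  intros (h & Hh & E); destruct (smooth_bounded h Hh) as (C & HC & H).
  exists C; split; auto; intros r s Hr Hs.
  rewrite E, Rabs_mult, Rmult_comm by now apply inb_dbox.
  apply Rmult_le_compat_r; [apply Rabs_pos | auto].
Qed.

Definition region (p : R * R) : Prop := rm < fst p < rp /\ 0 < snd p < PI / 2.

Definition at_point (g : R -> R -> R) (p : R * R) : R := g (fst p) (sin (snd p) ^ 2).

Lemma bounded_at (g : R -> R -> R) : smooth dbox g ->
  exists C, 0 < C /\ forall p, region p -> Rabs (at_point g p) <= C * 1.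
Proof.
  intros Hg; destruct (smooth_bounded g Hg) as (C & HC & H); exists C; split; auto.
  intros p [Hr Ht]; rewrite Rmult_1_r; apply H; [lra | apply sin2_bounds].
Qed.

Lemma vanishing_at (g : R -> R -> R) : vanishing g ->
  exists C, 0 < C /\ forall p, region p ->
    Rabs (at_point g p) <= C * Rabs (Delta_r Lam M a e (fst p)).
Proof.
  intros Hg; destruct (vanishing_bounded g Hg) as (C & HC & H); exists C; split; auto.
  intros p [Hr Ht]; apply H; [lra | apply sin2_bounds].
Qed.

(** The estimates at points (r, ts), before any coordinate function is introduced; this is what
    makes C independent of the choice of [r0], f, [rr] and [tt]. The shift [pred k1] is there
    because one derivative d/drs already turns th into sin (2 ts) [Tx]. *)
Definition uniform_bound (k : nat) (C : R) : Prop := forall p, region p ->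
  let Dl := Rabs (Delta_r Lam M a e (fst p)) in
  let mixed g k1 k2 := Rabs (at_point (Nat.iter k1 X (Nat.iter k2 Y g)) p) in
  sum2 0 1 k (mixed (fun r _ => r)) <= C * Dl /\
  sum_n_m (fun k1 => Rabs (sin (2 * snd p) * at_point (Nat.iter (pred k1) X Tx) p)) 1 k
    <= C * (Dl * sin (2 * snd p)) /\
  (sum_n_m (fun k1 => mixed Tq 0%nat k1) 0 (k - 1) <= C /\
   sum2 1 1 (k - 1) (mixed Tq) <= C * Dl) /\
  (sum_n_m (fun k1 => mixed Lg 0%nat k1) 0 (k - 1) <= C /\
   sum2 1 1 (k - 1) (mixed Lg) <= C * Dl).

Lemma uniform_bound_exists (k : nat) : exists C, 0 < C /\ uniform_bound k C.
Proof.
  assert (HD0 : forall p, region p -> 0 <= Rabs (Delta_r Lam M a e (fst p)))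
    by (intros; apply Rabs_pos).
  assert (Hs0 : forall p, region p -> 0 < sin (2 * snd p))
    by (intros p [_ Hp]; apply sin_gt_0; lra).
  assert (Hgen : forall g, smooth dbox g -> exists C, 0 < C /\ forall p, region p ->
    sum_n_m (fun k1 => Rabs (at_point (Nat.iter k1 Y g) p)) 0 (k - 1) <= C * 1 /\
    sum2 1 1 (k - 1) (fun k1 k2 => Rabs (at_point (Nat.iter k1 X (Nat.iter k2 Y g)) p))
      <= C * Rabs (Delta_r Lam M a e (fst p))).
  { intros g Hg.
    destruct (sum_n_m_bounded (R * R) region (fun _ => 1)
      (fun k1 p => Rabs (at_point (Nat.iter k1 Y g) p)) 0 (k - 1)) as (C1 & HC1 & B1).
    { intros; lra. }
    { intros i _; now apply bounded_at, smooth_iter_Y. }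
    destruct (sum2_bounded (R * R) region (fun p => Rabs (Delta_r Lam M a e (fst p)))
      (fun k1 k2 p => Rabs (at_point (Nat.iter k1 X (Nat.iter k2 Y g)) p)) 1 1 (k - 1))
      as (C2 & HC2 & B2); auto.
    { intros k1 k2 Hk1 _; apply vanishing_at, vanishing_iter_X; auto; now apply smooth_iter_Y. }
    exists (C1 + C2); split; [lra|]; intros p Hp.
    specialize (B1 p Hp); specialize (B2 p Hp); pose proof (HD0 p Hp); split; nra. }
  destruct (sum2_bounded (R * R) region (fun p => Rabs (Delta_r Lam M a e (fst p)))
    (fun k1 k2 p => Rabs (at_point (Nat.iter k1 X (Nat.iter k2 Y (fun r _ => r))) p)) 0 1 k)
    as (C1 & HC1 & B1); auto.
  { intros k1 k2 _ Hk; now apply vanishing_at, vanishing_mixed_r. }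
  destruct (sum_n_m_bounded (R * R) region
    (fun p => Rabs (Delta_r Lam M a e (fst p)) * sin (2 * snd p))
    (fun k1 p => Rabs (sin (2 * snd p) * at_point (Nat.iter (pred k1) X Tx) p)) 1 k)
    as (C2 & HC2 & B2).
  { intros p Hp; apply Rmult_le_pos; auto; left; auto. }
  { intros i _; destruct (vanishing_at _ (vanishing_iter_Tx (pred i))) as (C & HC & H).
    exists C; split; auto; intros p Hp; pose proof (Hs0 p Hp).
    rewrite Rabs_mult, (Rabs_pos_eq (sin _)) by lra; specialize (H p Hp); nra. }
  destruct (Hgen Tq smooth_Tq) as (C3 & HC3 & B3).
  destruct (Hgen Lg smooth_Lg) as (C4 & HC4 & B4).
  exists (C1 + C2 + C3 + C4); split; [lra|]; intros p Hp; cbv zeta.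
  specialize (B1 p Hp); specialize (B2 p Hp).
  destruct (B3 p Hp) as [B31 B32]; destruct (B4 p Hp) as [B41 B42].
  pose proof (HD0 p Hp) as HDp; pose proof (Hs0 p Hp) as Hsp.
  assert (Hle : forall C x w, C <= C1 + C2 + C3 + C4 -> 0 <= w -> x <= C * w ->
            x <= (C1 + C2 + C3 + C4) * w).
  { intros C x w HC Hw0 Hx; apply Rle_trans with (1 := Hx); now apply Rmult_le_compat_r. }
  split; [|split; [|split; split]].
  - apply (Hle C1); auto; lra.
  - apply (Hle C2); auto; [lra | apply Rmult_le_pos; lra].
  - rewrite <- (Rmult_1_r (_ + C4)); apply (Hle C3); auto; lra.
  - apply (Hle C3); auto; lra.
  - rewrite <- (Rmult_1_r (_ + C4)); apply (Hle C4); auto; lra.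
  - apply (Hle C4); auto; lra.
Qed.
(** * The coordinates (rs, ts) *)

Section Coordinates.

Variable r0 : R.
Variable f : R -> R.
Hypothesis Hr0 : rm < r0 < rp.
Hypothesis Hf : is_f Lam a f.

(** rstar as a function of r and ts, with th replaced by [Th r t]; see [rstar_eq_rho]. *)
Definition rho (r t : R) : R :=
  RInt (fun r' => (r' ^ 2 + a ^ 2) / Delta_r Lam M a e r') r0 r
  + rad_part r (sin t ^ 2) + ang_part (Th r t) t + a ^ 2 / 2 * f (sin t ^ 2).

(** The two radial integrals contribute Q / Delta_r. The angular one contributes (P / Delta_th) d th
    / d r, and d th / d r = P / Q. The sum is [AA]. *)
Lemma rho_r (r t : R) : rm < r < rp -> 0 <= t <= PI / 2 ->
  is_derive (fun r => rho r t) r (AA r (sin t ^ 2)).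
Proof.
  intros Hr Ht; pose proof (sin2_bounds t) as Hs.
  assert (HB : inb rbox r (sin t ^ 2)) by (apply inb_rbox; lra).
  pose proof (Delta_r_neg r Hr) as HD; pose proof (Qs_pos' _ _ HB) as HQp.
  pose proof (fD_ge_1 r (sin t ^ 2) ltac:(lra) Hs) as HfD.
  destruct (qf_w _ _ HB) as [W1 W2]; pose proof (qf_pos _ _ HB) as Hq.
  evar_last.
  - unfold rho; apply (is_derive_plus (fun r => _ + ang_part (Th r t) t) (fun _ => _));
      [|apply (is_derive_const (a ^ 2 / 2 * f (sin t ^ 2)))].
    apply (is_derive_plus (fun r => _ + rad_part r (sin t ^ 2))
             (fun r => ang_part (Th r t) t)).
    + apply (is_derive_plus (fun r => RInt _ r0 r) (fun r => rad_part r (sin t ^ 2)));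
        [|now apply rad_part_r].
      apply (RInt_primitive_x (Box rm rp 0 1) 0
               (fun r' _ => (r' ^ 2 + a ^ 2) / Delta_r Lam M a e r') r0 r (1 / 2)).
      * apply smooth_div; [|smooth_tac | apply smooth_Delta_r].
        intros u v [Hu _]; apply Rlt_not_eq, Delta_r_neg, Hu.
      * exact Hr0.
      * split; simpl; lra.
    + apply (is_derive_comp (fun x => ang_part x t) (fun r => Th r t)); [apply ang_part_x|].
      unfold Th; apply (is_derive_ang (fun r => qf r (sin t ^ 2)) (fun _ => t)); auto.
      * exact (proj1 (smooth_is_derive _ qf _ _ smooth_qf HB)).
      * apply (is_derive_const t).
  - rewrite ang_integrand_Th, d1_qf by (auto; lra).
    unfold plus, scal, zero; simpl; unfold mult; simpl.
    pose proof (ww_kq _ _ W1 W2) as Hwk; pose proof (sin2_cos2_pow t) as Hsc.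
    pose proof (kq_pos qbox _ _ good_q_qbox (qf_in_qbox _ _ HB)) as Hk.
    fold (sin t ^ 2) in *; change (sin t * (sin t * 1)) with (sin t ^ 2).
    change (r * (r * 1) + a * (a * 1)) with (N r).
    set (s := sin t ^ 2) in *; set (q := qf r s) in *.
    set (D := Delta_r Lam M a e r) in *.
    assert (E1 : (sin t * cos t * / (Qs r s * kq q s) + q * 0) / w1 q s
                 = sin t * cos t * fww r s / Qs r s).
    { unfold fww; fold q; rewrite <- Hwk; field; repeat split; lra. }
    rewrite E1; unfold AA, Den, rad_integrand; fold D.
    pose proof (Qs_sqr _ _ HB) as Hsq; unfold Q2 in Hsq; fold (N r) D in Hsq.
    pose proof (N_pos r) as HN.
    assert (E2 : N r / D + - (a ^ 2 * s / (N r + Qs r s)) = Qs r s / D).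
    { apply Rmult_eq_reg_r with (D * (N r + Qs r s));
        [|apply Rmult_integral_contrapositive_currified; lra].
      transitivity (N r * (N r + Qs r s) - a ^ 2 * s * D); [field; lra|].
      transitivity (Qs r s * N r + Qs r s * Qs r s); [rewrite Hsq; ring | field; lra]. }
    rewrite E2, <- Qs_sqr by auto.
    replace (1 - s) with (cos t ^ 2) by lra.
    replace (s * cos t ^ 2) with ((sin t * cos t) ^ 2) by (unfold s; ring).
    field; lra.
Qed.
(* The integrals of 1/P cancel because F = 0; this is what the choice of f is for. *)
Lemma rho_t (r t : R) : rm < r < rp -> 0 < t < PI / 2 ->
  is_derive (fun t => rho r t) t (sin (2 * t) * Ups r (sin t ^ 2)).
Proof.
  intros Hr Ht; pose proof (sin2_bounds t) as Hs.
  assert (HB : inb rbox r (sin t ^ 2)) by (apply inb_rbox; lra).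
  pose proof (Th_range r t ltac:(lra) Ht) as HTh.
  (* Such a separating value exists because th < ts strictly, which holds since r < rp. *)
  set (t1 := (Th r t + t) / 2).
  destruct (ang_part_t t1 (Th r t) t) as [HT3 Hex]; try (unfold t1; lra).
  evar_last.
  - unfold rho; apply (is_derive_plus (fun t => _ + ang_part (Th r t) t)
             (fun t => a ^ 2 / 2 * f (sin t ^ 2))).
    + apply (is_derive_plus (fun t => _ + rad_part r (sin t ^ 2))
               (fun t => ang_part (Th r t) t)).
      * apply (is_derive_plus (fun _ => _) (fun t => rad_part r (sin t ^ 2)));
          [apply (is_derive_const (V := R_NormedModule))|].
        apply (is_derive_comp (fun s => rad_part r s) (fun t => sin t ^ 2));
          [now apply rad_part_s | apply is_derive_sin2].
      * apply is_derive_Reals.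
        apply (derivable_pt_lim_comp_2d ang_part (fun t => Th r t) (fun t => t)); [exact HT3 | |].
        -- apply is_derive_Reals, Th_t; lra.
        -- apply derivable_pt_lim_id.
    + apply (is_derive_scal (fun t => f (sin t ^ 2)) t (a ^ 2 / 2)).
      apply (is_derive_comp f (fun t => sin t ^ 2)); [|apply is_derive_sin2].
      destruct Hf as (_ & _ & Hf3); now apply Hf3.
  - unfold plus, scal, zero; simpl; unfold mult; simpl.
    change (sin t * (sin t * 1)) with (sin t ^ 2).
    rewrite ang_integrand_Th, sin_2a by lra.
    (* F = 0 as a relation between integrals. In the derivative, tau, the integral up to [Th r t]
       and the integral up to t occur with the coefficient a^2 sin t cos t times 1, 1 and -1. *)
    assert (HC : RInt (fun th => / P_pot Lam a th t) 0 t =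
                 RInt (fun th => / P_pot Lam a th t) 0 (Th r t) + tau r (sin t ^ 2)).
    { assert (Htan : tan (Th r t) / tan t = qf r (sin t ^ 2)).
      { unfold Th; rewrite tan_ang by now apply qf_pos.
        field; apply Rgt_not_eq, tan_gt_0; lra. }
      assert (Hq1 : qf r (sin t ^ 2) < 1) by (apply qf_lt_1; lra).
      pose proof (is_RInt_P t (Th r t) Ht ltac:(lra) ltac:(lra)) as Hi.
      rewrite Htan in Hi; apply is_RInt_swap in Hi.
      destruct (Hqf r _ HB) as [_ E]; rewrite E in Hi.
      rewrite <- (RInt_Chasles _ 0 (Th r t) t Hex (ex_intro _ _ Hi)).
      rewrite (is_RInt_unique _ _ _ _ Hi); unfold plus, opp; simpl; ring. }
    rewrite HC; unfold Ups.
    pose proof (fD_ge_1 r (sin t ^ 2) ltac:(lra) Hs).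
    field; lra.
Qed.

(** At ts = 0 and ts = PI / 2 only the continuity of f is at hand; it is enough to make [rr]
    continuous up to these values. *)
Lemma rho_t_continuous (r t : R) : rm < r < rp -> 0 <= t <= PI / 2 ->
  continuous (fun t => rho r t) t.
Proof.
  intros Hr Ht; pose proof (sin2_bounds t) as Hs.
  assert (HB : inb rbox r (sin t ^ 2)) by (apply inb_rbox; lra).
  assert (Hsin : continuous (fun t => sin t ^ 2) t).
  { apply (ex_derive_continuous (K := R_AbsRing) (V := R_NormedModule)).
    eexists; apply is_derive_sin2. }
  assert (HTc : continuous (fun t => Th r t) t).
  { apply (ex_derive_continuous (K := R_AbsRing) (V := R_NormedModule)).
    eexists; apply Th_t; lra. }
  assert (HT : 0 <= Th r t <= t).
  { apply ang_bounds; auto; split; [now apply qf_pos | apply qf_le_1; lra]. }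
  unfold rho.
  apply (continuous_plus (fun t => _ + ang_part (Th r t) t)
             (fun t => a ^ 2 / 2 * f (sin t ^ 2))).
  - apply (continuous_plus (fun t => _ + rad_part r (sin t ^ 2))
               (fun t => ang_part (Th r t) t)).
    + apply (continuous_plus (fun _ => _) (fun t => rad_part r (sin t ^ 2)));
        [apply continuous_const|].
      apply (continuous_comp (fun t => sin t ^ 2) (fun s => rad_part r s)); auto.
      apply (continuity_2d_pt_slice2 rad_part), (smooth_continuous rbox);
        auto; apply smooth_rad_part.
    + apply (continuous_comp_2 (fun t => Th r t) (fun t => t) ang_part); auto.
      * apply continuous_id.
      * pose proof PI_4; apply continuity_2d_pt_filterlim.
        apply (Cn_RInt (Box (-10) 10 (t - 1) (t + 1)) 0 ang_integrand 0); 
          [simpl; lra | apply Cn_0_ang_integrand |].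
        split; simpl; lra.
  - apply (continuous_scal_r (a ^ 2 / 2) (fun t => f (sin t ^ 2))).
    destruct Hf as (_ & Hf2 & _).
    apply (continuous_comp_within (fun x => 0 <= x <= 1) f (fun t => sin t ^ 2)); auto.
    intros u; apply sin2_bounds.
Qed.

Lemma rstar_eq_rho (thstar : R -> R -> R) (r th t : R) :
  rm < r < rp -> thstar r th = t -> th = Th r t ->
  rstar Lam M a e rp r0 f thstar r th = rho r t.
Proof.
  intros Hr Et Eth; unfold rstar, rho; rewrite Et, <- Eth.
  pose proof (sin2_bounds t) as Hs.
  assert (HB : inb rbox r (sin t ^ 2)) by (apply inb_rbox; lra).
  do 2 f_equal; f_equal.
  unfold rad_part; rewrite <- (opp_RInt_swap (fun r' => rad_integrand r' (sin t ^ 2)) r rp).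
  - match goal with |- _ = - opp ?z => change (opp z) with (- z) end.
    (* [RInt_ext] compares the integrands on the open interval only, where Delta_r < 0 and the
       quotient may be rationalised. *)
    rewrite Ropp_involutive; apply RInt_ext; intros x Hx.
    rewrite Rmin_left, Rmax_right in Hx by lra.
    change (Q_pot Lam M a e x t) with (Qs x (sin t ^ 2)).
    assert (HBx : inb rbox x (sin t ^ 2)) by (apply inb_rbox; lra).
    pose proof (Qs_sqr _ _ HBx) as Hsq; pose proof (Qs_pos' _ _ HBx) as HQp.
    pose proof (Delta_r_neg x ltac:(lra)) as HD; pose proof (N_pos x) as HN.
    unfold rad_integrand, Q2 in *; fold (N x) in *; set (z := Qs x (sin t ^ 2)) in *.
    set (D := Delta_r Lam M a e x) in *.
    apply Rmult_eq_reg_r with (D * (N x + z));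
      [|apply Rmult_integral_contrapositive_currified; lra].
    transitivity (N x ^ 2 - z * z); [field; lra|].
    rewrite Hsq; field; lra.
  - apply ex_RInt_swap; apply (Cn_ex_RInt rbox 0 rad_integrand); auto using rp_in_rbox.
    apply smooth_rad_integrand.
Qed.

Variables thstar rr tt : R -> R -> R.
Hypothesis Hts : is_theta_star Lam M a e rm rp thstar.
Hypothesis Hinv : is_inverse_coords Lam M a e rm rp r0 f thstar rr tt.

(** Condenses the hypotheses on [thstar] and the inverse: for fixed ts, [rr] solves rho(r, ts) = rs,
    and [tt] is then explicit. At th = 0 and th = PI / 2, where F is not imposed, the values of
    [ang] agree. *)
Lemma coords_spec (rs ts : R) : 0 <= ts <= PI / 2 ->
  rm < rr rs ts < rp /\ rho (rr rs ts) ts = rs /\ tt rs ts = Th (rr rs ts) ts.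
Proof.
  intros Ht; destruct Hinv as (_ & H2 & _).
  destruct (H2 rs ts Ht) as (Hr & Hth & Ers & Ets).
  set (r := rr rs ts) in *; set (th := tt rs ts) in *.
  pose proof PI_RGT_0 as Hpi.
  assert (E : th = Th r ts).
  { destruct (Hts r ltac:(lra)) as (T0 & T1 & Tm).
    destruct (Req_dec th 0) as [E0|N0].
    { rewrite E0, T0 in Ets; rewrite E0, <- Ets; symmetry; apply ang_0. }
    destruct (Req_dec th (PI / 2)) as [E1|N1].
    { rewrite E1, T1 in Ets; rewrite E1, <- Ets; symmetry; apply ang_PI2. }
    destruct (Tm th ltac:(lra)) as [[Hle HF] _].
    rewrite Ets in Hle, HF; apply theta_eq_ang; auto; lra. }
  split; auto; split; auto.
  now rewrite <- (rstar_eq_rho thstar r th ts).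
Qed.

Lemma rho_decreasing (r r' t : R) :
  rm < r -> r < r' -> r' < rp -> 0 <= t <= PI / 2 -> rho r' t < rho r t.
Proof.
  intros H1 H2 H3 Ht; pose proof (sin2_bounds t) as Hs.
  apply (strictly_decreasing_of_derive (fun r => rho r t) (fun r => AA r (sin t ^ 2))); auto.
  intros x Hx; split; [apply rho_r; lra | apply AA_inv; lra].
Qed.

Lemma rr_lt_of_rho (r rs t : R) : rm < r < rp -> 0 <= t <= PI / 2 ->
  (rho r t < rs -> rr rs t < r) /\ (rs < rho r t -> r < rr rs t).
Proof.
  intros Hr Ht; destruct (coords_spec rs t Ht) as (Hrr & E & _).
  pose proof (rho_decreasing r (rr rs t) t); pose proof (rho_decreasing (rr rs t) r t).
  split; intros Hlt.
  - destruct (Rtotal_order (rr rs t) r) as [|[E'|]]; [auto | rewrite E' in E; lra | lra].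
  - destruct (Rtotal_order (rr rs t) r) as [|[E'|]]; [lra | rewrite E' in E; lra | auto].
Qed.

Lemma rr_continuous (rs0 t0 : R) : 0 <= t0 <= PI / 2 ->
  forall eps : posreal, exists d : posreal, forall rs t, 0 <= t <= PI / 2 ->
    Rabs (rs - rs0) < d -> Rabs (t - t0) < d -> Rabs (rr rs t - rr rs0 t0) < eps.
Proof.
  intros Ht0 eps; destruct (coords_spec rs0 t0 Ht0) as (Hr & E & _).
  set (r1 := rr rs0 t0) in *; pose proof (cond_pos eps) as Heps.
  set (up := Rmin (r1 + eps) ((r1 + rp) / 2)).
  set (dn := Rmax (r1 - eps) ((r1 + rm) / 2)).
  assert (Hup : r1 < up /\ up <= r1 + eps /\ up < rp).
  { unfold up, Rmin; destruct (Rle_dec _ _); lra. }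
  assert (Hdn : rm < dn /\ r1 - eps <= dn /\ dn < r1).
  { unfold dn, Rmax; destruct (Rle_dec _ _); lra. }
  (* As rho decreases in r, rho up t0 < rs0 < rho dn t0. Half of each gap is spent on the variation
     of rho in t and half on the variation of rs. *)
  assert (H1 : 0 < (rs0 - rho up t0) / 2).
  { pose proof (rho_decreasing r1 up t0); lra. }
  assert (H2 : 0 < (rho dn t0 - rs0) / 2).
  { pose proof (rho_decreasing dn r1 t0); lra. }
  assert (Hc : forall r e', rm < r < rp -> 0 < e' ->
            exists d : posreal, forall t, Rabs (t - t0) < d -> Rabs (rho r t - rho r t0) < e').
  { intros r e' Hr' He'.
    destruct (proj1 (continuity_pt_locally _ _) (proj2 (continuity_pt_filterlim _ _)
      (rho_t_continuous r t0 Hr' Ht0)) (mkposreal _ He')) as [d Hd].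
    exists d; exact Hd. }
  destruct (Hc up _ ltac:(lra) H1) as [d1 Hd1]; destruct (Hc dn _ ltac:(lra) H2) as [d2 Hd2].
  assert (Hm : 0 < Rmin (Rmin d1 d2)
                 (Rmin ((rs0 - rho up t0) / 2) ((rho dn t0 - rs0) / 2))).
  { repeat apply Rmin_glb_lt; auto; apply cond_pos. }
  exists (mkposreal _ Hm); simpl; intros rs t Ht Hrs Htt.
  apply Rmin_Rgt in Hrs; destruct Hrs as [_ Hrs]; apply Rmin_Rgt in Hrs.
  apply Rmin_Rgt in Htt; destruct Htt as [Htt _]; apply Rmin_Rgt in Htt.
  specialize (Hd1 t ltac:(lra)); specialize (Hd2 t ltac:(lra)).
  destruct Hrs as [Hrs1 Hrs2]; apply Rabs_def2 in Hrs1; apply Rabs_def2 in Hrs2.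
  apply Rabs_def2 in Hd1; apply Rabs_def2 in Hd2.
  assert (rr rs t < up) by (apply rr_lt_of_rho; lra).
  assert (dn < rr rs t) by (apply rr_lt_of_rho; lra).
  apply Rabs_def1; lra.
Qed.

Lemma rr_rs (rs t : R) : 0 <= t <= PI / 2 ->
  is_derive (fun rs => rr rs t) rs (Xc (rr rs t) (sin t ^ 2)).
Proof.
  intros Ht; destruct (coords_spec rs t Ht) as (Hr & E & _).
  pose proof (sin2_bounds t) as Hs.
  destruct (AA_inv _ _ Hr Hs) as [Hneg <-].
  replace (/ AA (rr rs t) (sin t ^ 2)) with (- (-1) / AA (rr rs t) (sin t ^ 2)) by (field; lra).
  set (Bh := Box rm rp (rs - 1) (rs + 1)).
  apply (implicit_is_derive (fun u x => rho u t - x) (fun rs => rr rs t) rs).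
  - apply (partials_differentiable Bh (fun u x => rho u t - x)
             (fun u _ => AA u (sin t ^ 2)) (fun _ _ => -1)).
    + intros u x [Hu _]; split.
      * replace (AA u (sin t ^ 2)) with (minus (AA u (sin t ^ 2)) 0)
          by (unfold minus, plus, opp; simpl; ring).
        apply (is_derive_minus (fun u => rho u t) (fun _ => x)); [now apply rho_r|].
        apply (is_derive_const x).
      * auto_derive; auto; ring.
    + split; simpl; auto; lra.
    + apply (smooth_continuous Bh (fun u _ => AA u (sin t ^ 2))).
      * apply (smooth_comp (Box rm rp (- e2) (1 + e2)) Bh AA (fun u _ => u) (fun _ _ => sin t ^ 2));
          [|apply smooth_AA | apply smooth_fst | apply smooth_const].
        intros u x [Hu _]; split; [exact Hu | cbn [yl yr]; lra].
      * split; simpl; auto; lra.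
  - lra.
  - apply continuity_pt_filterlim, continuity_pt_locally; intros eps.
    destruct (rr_continuous rs t Ht eps) as [d Hd]; exists d; intros u Hu.
    apply Hd; auto; rewrite Rminus_eq_0, Rabs_R0; apply cond_pos.
  - apply filter_forall; intros x.
    destruct (coords_spec x t Ht) as (_ & -> & _); rewrite E; ring.
Qed.

(** Implicit differentiation of rho(rr, ts) = rs, with the partials [AA] and sin (2 ts) [Ups]. The
    end points are left out because rho is differentiated in ts only inside the interval. *)
Lemma rr_t (rs t : R) : 0 < t < PI / 2 ->
  is_derive (fun t => rr rs t) t (sin (2 * t) * Yc (rr rs t) (sin t ^ 2)).
Proof.
  intros Ht; destruct (coords_spec rs t ltac:(lra)) as (Hr & E & _).
  pose proof (sin2_bounds t) as Hs.
  destruct (AA_inv _ _ Hr Hs) as [Hneg EX].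
  unfold Yc; rewrite <- EX.
  replace (sin (2 * t) * - (Ups (rr rs t) (sin t ^ 2) * / AA (rr rs t) (sin t ^ 2)))
    with (- (sin (2 * t) * Ups (rr rs t) (sin t ^ 2)) / AA (rr rs t) (sin t ^ 2))
    by (field; lra).
  set (Bh := Box rm rp 0 (PI / 2)).
  assert (Hin : inb Bh (rr rs t) t) by (split; auto).
  apply (implicit_is_derive rho (fun t => rr rs t) t).
  - apply (partials_differentiable Bh rho (fun u v => AA u (sin v ^ 2))
             (fun u v => sin (2 * v) * Ups u (sin v ^ 2))); auto.
    + intros u v [Hu Hv]; cbn [xl xr yl yr Bh] in Hu, Hv.
      split; [apply rho_r; lra | now apply rho_t].
    + apply continuity_2d_pt_filterlim.
      apply (continuous_comp_2 (fun z : R * R => fst z) (fun z : R * R => sin (snd z) ^ 2) AA).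
      * apply continuous_fst.
      * apply (continuous_comp (fun z : R * R => snd z) (fun v => sin v ^ 2)).
        -- apply continuous_snd.
        -- apply (ex_derive_continuous (K := R_AbsRing) (V := R_NormedModule)).
           eexists; apply is_derive_sin2.
      * apply continuity_2d_pt_filterlim, (smooth_continuous _ _ _ _ smooth_AA).
        split; [exact Hr | cbn [yl yr fst snd]; lra].
  - lra.
  - apply continuity_pt_filterlim, continuity_pt_locally; intros eps.
    destruct (rr_continuous rs t ltac:(lra) eps) as [d Hd].
    assert (Hl : locally t (fun u => 0 < u < PI / 2)) by now apply locally_open_interval.
    generalize (filter_and _ _ Hl (locally_ball t d)); apply filter_imp; intros u [Hu Hb].
    apply Hd; [lra | rewrite Rminus_eq_0, Rabs_R0; apply cond_pos | exact Hb].
  - assert (Hl : locally t (fun u => 0 < u < PI / 2)) by now apply locally_open_interval.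
    revert Hl; apply filter_imp; intros x Hx.
    destruct (coords_spec rs x ltac:(lra)) as (_ & -> & _); auto.
Qed.

(** * Reflection to [0, PI], and functions of (r, s) read in the coordinates *)

Lemma rr_reflect (rs t : R) : 0 <= t <= PI -> rr rs t = rr rs (Rmin t (PI - t)).
Proof.
  intros Ht; destruct Hinv as (_ & _ & H3); unfold Rmin; destruct (Rle_dec t (PI - t)); auto.
  apply H3; lra.
Qed.

Lemma reflect_range (t : R) : 0 <= t <= PI -> 0 <= Rmin t (PI - t) <= PI / 2.
Proof. intros Ht; unfold Rmin; destruct (Rle_dec t (PI - t)); lra. Qed.

Lemma sin2_reflect (t : R) : sin (Rmin t (PI - t)) ^ 2 = sin t ^ 2.
Proof. unfold Rmin; destruct (Rle_dec t (PI - t)); [auto | now rewrite sin_PI_x]. Qed.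

Lemma rr_range (rs t : R) : 0 <= t <= PI -> rm < rr rs t < rp.
Proof.
  intros Ht; rewrite rr_reflect by auto; apply coords_spec, reflect_range, Ht.
Qed.

Lemma in_dbox (rs t : R) : 0 <= t <= PI -> inb dbox (rr rs t) (sin t ^ 2).
Proof. intros Ht; pose proof (rr_range rs t Ht); apply inb_dbox; [lra | apply sin2_bounds]. Qed.

(** One formula covers both halves, since [ang] commutes with the reflection and q depends on ts
    through sin^2 ts alone. *)
Lemma tt_eq (rs t : R) : 0 <= t <= PI -> tt rs t = ang (qf (rr rs t) (sin t ^ 2)) t.
Proof.
  intros Ht; destruct (Rle_dec t (PI / 2)) as [Hle|Hgt].
  - apply coords_spec; lra.
  - destruct Hinv as (_ & _ & H3); destruct (H3 rs t ltac:(lra)) as [E1 E2].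
    destruct (coords_spec rs (PI - t) ltac:(lra)) as (_ & _ & E3).
    rewrite E2, E3, E1; unfold Th; rewrite ang_reflect, sin_PI_x; ring.
Qed.

(** The pullback of a function of (r, s); under it [X] and [Y] become d/drs and (1 / sin (2 ts))
    d/dts. *)
Definition comp (g : R -> R -> R) (rs t : R) : R := g (rr rs t) (sin t ^ 2).

Lemma comp_reflect (g : R -> R -> R) (rs t : R) :
  0 <= t <= PI -> comp g rs t = comp g rs (Rmin t (PI - t)).
Proof. intros Ht; unfold comp; now rewrite sin2_reflect, <- rr_reflect. Qed.

Lemma rr_rs_full (rs t : R) : 0 <= t <= PI ->
  is_derive (fun rs => rr rs t) rs (Xc (rr rs t) (sin t ^ 2)).
Proof.
  intros Ht; rewrite <- sin2_reflect, rr_reflect by auto.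
  apply (is_derive_ext (fun rs => rr rs (Rmin t (PI - t)))).
  - intros x; symmetry; now apply rr_reflect.
  - now apply rr_rs, reflect_range.
Qed.

(** Beyond PI / 2 the sign from the chain rule for PI - t cancels against sin (2 (PI - t)) = - sin
    (2 t). *)
Lemma rr_t_full (rs t : R) : 0 < t < PI -> t <> PI / 2 ->
  is_derive (fun t => rr rs t) t (sin (2 * t) * Yc (rr rs t) (sin t ^ 2)).
Proof.
  intros Ht Hn; destruct (Rlt_dec t (PI / 2)) as [Hlt|Hgt]; [apply rr_t; lra|].
  apply (is_derive_ext_loc (fun t => rr rs (PI - t))).
  - assert (Hl : locally t (fun u => PI / 2 < u < PI)) by (apply locally_open_interval; lra).
    revert Hl; apply filter_imp; intros u Hu; rewrite (rr_reflect rs u) by lra.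
    f_equal; rewrite Rmin_right; lra.
  - evar_last.
    + apply (is_derive_comp (fun t => rr rs t) (fun t => PI - t)).
      * apply rr_t; lra.
      * auto_derive; auto.
    + unfold scal; simpl; unfold mult; simpl.
      replace (2 * (PI - t)) with (- (2 * t) + 2 * PI) by ring.
      pose proof (sin_period (- (2 * t)) 1) as Hp; simpl in Hp; rewrite Rmult_1_r in Hp.
      rewrite Hp, sin_neg, sin_PI_x, (rr_reflect rs t), Rmin_right by lra.
      change (sin t * (sin t * 1)) with (sin t ^ 2); ring.
Qed.

Lemma rr_continuous_full (rs0 t0 : R) : 0 <= t0 <= PI ->
  forall eps : posreal, exists d : posreal, forall rs t, 0 <= t <= PI ->
    Rabs (rs - rs0) < d -> Rabs (t - t0) < d -> Rabs (rr rs t - rr rs0 t0) < eps.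
Proof.
  intros Ht0 eps; destruct (rr_continuous rs0 _ (reflect_range t0 Ht0) eps) as [d Hd].
  exists d; intros rs t Ht Hrs Htt; rewrite (rr_reflect rs t), (rr_reflect rs0 t0) by auto.
  apply Hd; auto; [now apply reflect_range|].
  eapply Rle_lt_trans; [|exact Htt]; unfold Rmin, Rabs.
  destruct (Rle_dec t _), (Rle_dec t0 _); repeat destruct (Rcase_abs _); lra.
Qed.

Lemma comp_continuous_eps (g : R -> R -> R) (rs0 t0 : R) : smooth dbox g -> 0 <= t0 <= PI ->
  forall eps : posreal, exists d : posreal, forall rs t, 0 <= t <= PI ->
    Rabs (rs - rs0) < d -> Rabs (t - t0) < d -> Rabs (comp g rs t - comp g rs0 t0) < eps.
Proof.
  intros Hg Ht0 eps.
  destruct (smooth_continuous _ _ _ _ Hg (in_dbox rs0 t0 Ht0) eps) as [d Hd].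
  destruct (rr_continuous_full rs0 t0 Ht0 d) as [d1 Hd1].
  assert (Hsin : continuous (fun t => sin t ^ 2) t0).
  { apply (ex_derive_continuous (K := R_AbsRing) (V := R_NormedModule)).
    eexists; apply is_derive_sin2. }
  destruct (cont_within_continuous (fun _ => True) _ _ Hsin d) as [d2 Hd2].
  assert (Hm : 0 < Rmin d1 d2) by (apply Rmin_glb_lt; apply cond_pos).
  exists (mkposreal _ Hm); intros rs t Ht Hrs Htt; cbn [pos] in Hrs, Htt.
  apply Rmin_Rgt in Hrs; apply Rmin_Rgt in Htt.
  apply Hd; [apply Hd1; tauto | apply Hd2; tauto].
Qed.

Lemma comp_continuous_on (g : R -> R -> R) : smooth dbox g ->
  continuous_on (fun p : R * R => 0 <= snd p <= PI) (fun p : R * R => comp g (fst p) (snd p)).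
Proof.
  intros Hg [rs0 t0] Ht0; cbn [fst snd] in *; intros P [eps HP].
  destruct (comp_continuous_eps g rs0 t0 Hg Ht0 eps) as [d Hd].
  unfold filtermap, within.
  apply (locally_2d_locally (fun rs t => 0 <= t <= PI -> P (comp g rs t))).
  exists d; intros rs t Hrs Ht Hin; apply HP; now apply Hd.
Qed.

Lemma comp_cont_within (g : R -> R -> R) (rs t : R) : smooth dbox g -> 0 <= t <= PI ->
  cont_within (fun t => 0 <= t <= PI) (comp g rs) t.
Proof.
  intros Hg Ht eps; destruct (comp_continuous_eps g rs t Hg Ht eps) as [d Hd].
  exists d; intros u Hu Hut; apply Hd; auto.
  rewrite Rminus_eq_0, Rabs_R0; apply cond_pos.
Qed.

Lemma comp_continuity_2d (g : R -> R -> R) (rs t : R) : smooth dbox g -> 0 < t < PI ->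
  continuity_2d_pt (comp g) rs t.
Proof.
  intros Hg Ht eps; destruct (comp_continuous_eps g rs t Hg ltac:(lra) eps) as [d Hd].
  destruct (open_interval_nbhd _ _ _ Ht) as [d' Hd'].
  assert (Hm : 0 < Rmin d d') by (apply Rmin_glb_lt; apply cond_pos).
  exists (mkposreal _ Hm); intros u v Hu Hv; cbn [pos] in Hu, Hv.
  apply Rmin_Rgt in Hu; apply Rmin_Rgt in Hv; pose proof (Hd' v (proj2 Hv)).
  apply Hd; lra.
Qed.

Lemma comp_rs (g : R -> R -> R) (rs t : R) : smooth dbox g -> 0 <= t <= PI ->
  is_derive (fun rs => comp g rs t) rs (comp (X g) rs t).
Proof.
  intros Hg Ht; pose proof (in_dbox rs t Ht) as HB.
  apply (is_derive_comp (fun r => g r (sin t ^ 2)) (fun rs => rr rs t)).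
  - exact (proj1 (smooth_is_derive _ _ _ _ Hg HB)).
  - now apply rr_rs_full.
Qed.

Lemma comp_t (g : R -> R -> R) (rs t : R) : smooth dbox g -> 0 < t < PI -> t <> PI / 2 ->
  is_derive (fun t => comp g rs t) t (sin (2 * t) * comp (Y g) rs t).
Proof.
  intros Hg Ht Hn; pose proof (in_dbox rs t ltac:(lra)) as HB.
  replace (sin (2 * t) * comp (Y g) rs t) with
    (d1 g (rr rs t) (sin t ^ 2) * (sin (2 * t) * Yc (rr rs t) (sin t ^ 2))
     + d2 g (rr rs t) (sin t ^ 2) * (2 * (sin t * cos t)))
    by (unfold comp, Y; rewrite sin_2a; ring).
  apply is_derive_Reals.
  apply (derivable_pt_lim_comp_2d g (fun t => rr rs t) (fun t => sin t ^ 2)).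
  - exact (smooth_differentiable _ _ _ _ Hg HB).
  - now apply is_derive_Reals, rr_t_full.
  - apply is_derive_Reals, is_derive_sin2.
Qed.

(** At 0, PI / 2 and PI differentiability comes from [derive_in_closure]: the derivative at the
    other points extends continuously. *)
Lemma comp_t_in (g : R -> R -> R) (rs t : R) : smooth dbox g -> 0 <= t <= PI ->
  is_derive_in (fun t => 0 <= t <= PI) (fun t => comp g rs t) t (sin (2 * t) * comp (Y g) rs t).
Proof.
  intros Hg.
  apply (derive_in_closure 0 (PI / 2) PI (comp g rs) (fun t => sin (2 * t) * comp (Y g) rs t)).
  - intros x Hx; now apply comp_cont_within.
  - intros x Hx.
    apply (cont_within_comp_2d _ Rmult (fun t => sin (2 * t)) (comp (Y g) rs)).
    + apply continuity_2d_pt_mult; [apply continuity_2d_pt_id1 | apply continuity_2d_pt_id2].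
    + apply cont_within_continuous.
      apply (ex_derive_continuous (K := R_AbsRing) (V := R_NormedModule)); auto_derive; auto.
    + apply comp_cont_within; auto; now apply smooth_Y.
  - intros x Hx Hn; now apply comp_t.
Qed.

(* Equality of mixed partial derivatives in the coordinates (rs, ts); an algebraic check
   that the vector fields commute would need the explicit derivatives of [qf]. *)
Lemma comp_commute_interior (g : R -> R -> R) (rs t : R) : smooth dbox g -> 0 < t < PI / 2 ->
  comp (Y (X g)) rs t = comp (X (Y g)) rs t.
Proof.
  intros Hg Ht.
  assert (Hs : 0 < sin (2 * t)) by (apply sin_gt_0; lra).
  assert (EX : forall z v, 0 <= v <= PI -> Derive (fun z => comp g z v) z = comp (X g) z v).
  { intros z v Hv; now apply is_derive_unique, comp_rs. }
  assert (EY : forall z v, 0 < v < PI / 2 ->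
            Derive (fun v => comp g z v) v = sin (2 * v) * comp (Y g) z v).
  { intros z v Hv; apply is_derive_unique, comp_t; auto; lra. }
  assert (EXY : forall z v, 0 < v < PI / 2 ->
            is_derive (fun z => Derive (fun v => comp g z v) v) z
              (sin (2 * v) * comp (X (Y g)) z v)).
  { intros z v Hv; apply (is_derive_ext (fun z => sin (2 * v) * comp (Y g) z v)).
    - intros u; symmetry; now apply EY.
    - apply (is_derive_scal (fun z => comp (Y g) z v) z (sin (2 * v))).
      apply comp_rs; [now apply smooth_Y | lra]. }
  assert (EYX : forall z v, 0 < v < PI / 2 ->
            is_derive (fun v => Derive (fun z => comp g z v) z) v
              (sin (2 * v) * comp (Y (X g)) z v)).
  { intros z v Hv; apply (is_derive_ext_loc (fun v => comp (X g) z v)).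
    - assert (Hl : locally v (fun u => 0 < u < PI / 2)) by now apply locally_open_interval.
      revert Hl; apply filter_imp; intros u Hu; symmetry; apply EX; lra.
    - apply comp_t; [now apply smooth_X | lra | lra]. }
  assert (Hloc : locally_2d (fun _ v => 0 < v < PI / 2) rs t).
  { destruct (open_interval_nbhd _ _ _ Ht) as [d Hd]; exists d; auto. }
  assert (Hcont : forall h, smooth dbox h ->
            continuity_2d_pt (fun u v => sin (2 * v) * comp h u v) rs t).
  { intros h Hh; apply continuity_2d_pt_mult; [|apply comp_continuity_2d; auto; lra].
    apply (continuity_1d_2d_pt_comp (fun v => sin (2 * v)) (fun _ v => v));
      [reg | apply continuity_2d_pt_id2]. }
  assert (HS : Derive (fun z => Derive (fun v => comp g z v) t) rs =
               Derive (fun v => Derive (fun z => comp g z v) rs) t).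
  { apply Schwarz.
    - destruct Hloc as [d Hd]; exists d; intros u v Hu Hv; specialize (Hd u v Hu Hv).
      split; [|split; [|split]].
      + exists (comp (X g) u v); apply comp_rs; auto; lra.
      + exists (sin (2 * v) * comp (Y g) u v); apply comp_t; auto; lra.
      + eexists; now apply EXY.
      + eexists; now apply EYX.
    - apply (continuity_2d_pt_ext_loc (fun u v => sin (2 * v) * comp (X (Y g)) u v)).
      + destruct Hloc as [d Hd]; exists d; intros u v Hu Hv; symmetry.
        apply is_derive_unique, EXY; eauto.
      + now apply Hcont, smooth_X, smooth_Y.
    - apply (continuity_2d_pt_ext_loc (fun u v => sin (2 * v) * comp (Y (X g)) u v)).
      + destruct Hloc as [d Hd]; exists d; intros u v Hu Hv; symmetry.
        apply is_derive_unique, EYX; eauto.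
      + now apply Hcont, smooth_Y, smooth_X. }
  apply Rmult_eq_reg_l with (sin (2 * t)); [|lra].
  etransitivity; [symmetry; exact (is_derive_unique _ _ _ (EYX rs t Ht))|].
  etransitivity; [symmetry; exact HS | exact (is_derive_unique _ _ _ (EXY rs t Ht))].
Qed.

(** Reflection reduces to [0, PI / 2], where the open interval is dense and both sides are
    continuous. *)
Lemma comp_eq_closure (g h : R -> R -> R) (rs t : R) : smooth dbox g -> smooth dbox h ->
  (forall t, 0 < t < PI / 2 -> comp g rs t = comp h rs t) ->
  0 <= t <= PI -> comp g rs t = comp h rs t.
Proof.
  intros Hg Hh E Ht; rewrite (comp_reflect g), (comp_reflect h) by auto.
  pose proof (reflect_range t Ht) as Ht'; set (t0 := Rmin t (PI - t)) in *; clearbody t0.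
  clear t Ht; pose proof PI_RGT_0 as Hpi.
  destruct (Req_dec (comp g rs t0) (comp h rs t0)) as [|Hn]; auto; exfalso.
  assert (Hp : 0 < Rabs (comp g rs t0 - comp h rs t0)) by (apply Rabs_pos_lt; lra).
  assert (Hm : smooth dbox (fun r s => g r s - h r s)) by now apply smooth_minus.
  destruct (comp_cont_within _ rs t0 Hm ltac:(lra) (mkposreal _ Hp)) as [d Hd].
  assert (Hex : exists t, 0 < t < PI / 2 /\ Rabs (t - t0) < d).
  { pose proof (cond_pos d) as Hd0.
    assert (Hmin : 0 < Rmin (d / 2) (PI / 8)) by (apply Rmin_glb_lt; lra).
    pose proof (Rmin_l (d / 2) (PI / 8)); pose proof (Rmin_r (d / 2) (PI / 8)).
    set (x := Rmin (d / 2) (PI / 8)) in *.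
    destruct (Rle_dec t0 (PI / 4)); [exists (t0 + x) | exists (t0 - x)];
      (split; [lra|]); apply Rabs_def1; lra. }
  destruct Hex as (t & Ht & Htd); specialize (Hd t ltac:(lra) Htd); cbn [pos] in Hd.
  unfold comp in *; rewrite (E t Ht) in Hd.
  replace (h (rr rs t) (sin t ^ 2) - h (rr rs t) (sin t ^ 2) -
     (g (rr rs t0) (sin t0 ^ 2) - h (rr rs t0) (sin t0 ^ 2)))
    with (- (g (rr rs t0) (sin t0 ^ 2) - h (rr rs t0) (sin t0 ^ 2))) in Hd by ring.
  rewrite Rabs_Ropp in Hd; lra.
Qed.

(** In [smooth_on] the family is indexed by the two orders, so d/dts applied to the entry with i
    times [X] outside has to be moved past all of them. The equality holds after composition with
    the coordinates; the induction differentiates it in rs. *)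
Lemma comp_commute (n : nat) (g : R -> R -> R) (rs t : R) : smooth dbox g -> 0 <= t <= PI ->
  comp (Y (Nat.iter n X g)) rs t = comp (Nat.iter n X (Y g)) rs t.
Proof.
  intros Hg; revert rs t; induction n as [|n IH]; intros rs t Ht; [reflexivity|].
  pose proof (smooth_iter_X n g Hg) as Hn.
  change (Nat.iter (S n) X g) with (X (Nat.iter n X g)).
  rewrite (comp_eq_closure (Y (X (Nat.iter n X g))) (X (Y (Nat.iter n X g)))); auto.
  - change (Nat.iter (S n) X (Y g)) with (X (Nat.iter n X (Y g))).
    rewrite <- (is_derive_unique _ _ _ (comp_rs _ rs t (smooth_Y _ Hn) Ht)).
    rewrite <- (is_derive_unique _ _ _ (comp_rs _ rs t (smooth_iter_X n _ (smooth_Y _ Hg)) Ht)).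
    apply Derive_ext; intros z; now apply IH.
  - now apply smooth_Y, smooth_X.
  - now apply smooth_X, smooth_Y.
  - intros u Hu; now apply comp_commute_interior.
Qed.

Lemma smooth_on_comp (g : R -> R -> R) : smooth dbox g ->
  smooth_on (fun ts => 0 <= ts <= PI) (comp g).
Proof.
  intros Hg; exists (fun i j => comp (Nat.iter i X (Nat.iter j Y g))); split; [auto|].
  intros i j.
  pose proof (smooth_iter_Y j g Hg) as Hj; pose proof (smooth_iter_X i _ Hj) as Hij.
  split; [now apply comp_continuous_on|].
  intros rs ts Ht; split; [now apply comp_rs|].
  change (Nat.iter (S j) Y g) with (Y (Nat.iter j Y g)).
  rewrite <- comp_commute by auto; now apply comp_t_in.
Qed.

(** * Derivatives of th and L, and the estimates *)

Lemma tt_t (rs t : R) : 0 < t < PI -> t <> PI / 2 ->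
  is_derive (fun t => tt rs t) t (comp Tq rs t).
Proof.
  intros Ht Hn; apply (is_derive_ext_loc (fun t => ang (comp qf rs t) t)).
  - generalize (locally_open_interval _ _ _ Ht); apply filter_imp; intros u Hu; symmetry.
    apply tt_eq; lra.
  - evar_last.
    + apply (is_derive_ang (fun t => comp qf rs t) (fun t => t)).
      * apply qf_pos, dbox_sub, in_dbox; lra.
      * apply comp_t; auto; apply smooth_dbox, smooth_qf.
      * apply (is_derive_id (K := R_AbsRing)).
    + unfold comp, Tq, one; simpl; change (sin t * (sin t * 1)) with (sin t ^ 2).
      unfold Rdiv; f_equal; rewrite sin_2a.
      replace (1 - sin t ^ 2) with (cos t ^ 2) by (pose proof (sin2_cos2_pow t); lra); ring.
Qed.

Lemma tt_t_in (rs t : R) : 0 <= t <= PI ->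
  is_derive_in (fun t => 0 <= t <= PI) (fun t => tt rs t) t (comp Tq rs t).
Proof.
  apply (derive_in_closure 0 (PI / 2) PI (tt rs) (comp Tq rs)).
  - intros x Hx eps.
    destruct (cont_within_comp_2d (fun t => 0 <= t <= PI) ang (comp qf rs) (fun t => t) x)
      with (eps := eps) as [d Hd].
    + apply ang_continuity_2d, qf_pos, dbox_sub, in_dbox, Hx.
    + apply comp_cont_within; auto; apply smooth_dbox, smooth_qf.
    + apply cont_within_continuous, continuous_id.
    + exists d; intros u Hu Hux; rewrite !tt_eq by auto; now apply Hd.
  - intros x Hx; apply comp_cont_within; auto; apply smooth_Tq.
  - intros x Hx Hn; now apply tt_t.
Qed.

Lemma tt_rs (rs t : R) : 0 <= t <= PI ->
  is_derive (fun rs => tt rs t) rs (sin (2 * t) * comp Tx rs t).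
Proof.
  intros Ht; apply (is_derive_ext (fun rs => ang (comp qf rs t) t)).
  - intros u; symmetry; now apply tt_eq.
  - evar_last.
    + apply (is_derive_ang (fun rs => comp qf rs t) (fun _ => t)).
      * apply qf_pos, dbox_sub, in_dbox, Ht.
      * apply comp_rs; auto; apply smooth_dbox, smooth_qf.
      * apply (is_derive_const t).
    + pose proof (qf_w _ _ (dbox_sub _ _ (in_dbox rs t Ht))) as [W1 _].
      unfold comp, Tx, zero; simpl; change (sin t * (sin t * 1)) with (sin t ^ 2).
      rewrite sin_2a; field; lra.
Qed.

(** The factor sin (2 ts) is constant along d/drs, so further derivatives act on [Tx] alone; hence
    the factor sin (2 ts) in the bound for th. *)
Lemma D_rs_iter_tt (n : nat) (rs t : R) : 0 <= t <= PI ->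
  Nat.iter (S n) D_rs tt rs t = sin (2 * t) * comp (Nat.iter n X Tx) rs t.
Proof.
  intros Ht; revert rs; induction n as [|n IH]; intros rs.
  - now apply is_derive_unique, tt_rs.
  - change (Nat.iter (S (S n)) D_rs tt rs t)
      with (Derive (fun s => Nat.iter (S n) D_rs tt s t) rs).
    apply is_derive_unique.
    apply (is_derive_ext (fun s => sin (2 * t) * comp (Nat.iter n X Tx) s t)); [auto|].
    apply (is_derive_scal (fun s => comp (Nat.iter n X Tx) s t) rs (sin (2 * t))).
    apply comp_rs; auto; apply smooth_iter_X, vanishing_smooth, vanishing_Tx.
Qed.

Lemma Derive_n_tt (n : nat) (rs t : R) :
  Derive_n (fun s => tt s t) n rs = Nat.iter n D_rs tt rs t.
Proof.
  revert rs; induction n as [|n IH]; intros rs; [reflexivity|].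
  simpl; unfold D_rs at 1; now apply Derive_ext.
Qed.

Lemma ex_derive_n_tt (n : nat) (rs t : R) : 0 <= t <= PI -> ex_derive_n (fun s => tt s t) n rs.
Proof.
  intros Ht; destruct n as [|[|n]]; simpl; auto.
  - eexists; now apply tt_rs.
  - apply (ex_derive_ext (fun s => sin (2 * t) * comp (Nat.iter n X Tx) s t)).
    + intros s; rewrite <- D_rs_iter_tt by auto; symmetry; apply (Derive_n_tt (S n)).
    + eexists; apply (is_derive_scal (fun s => comp (Nat.iter n X Tx) s t) rs (sin (2 * t))).
      apply comp_rs; auto; apply smooth_iter_X, vanishing_smooth, vanishing_Tx.
Qed.

Lemma L_eik_eq (rs t : R) : 0 < t < PI / 2 ->
  L_eik Lam M a e rp rr tt rs t = comp Lg rs t.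
Proof.
  intros Ht; unfold L_eik; cbv zeta; rewrite tt_eq by lra.
  unfold comp, Lg; apply L_at; auto; apply rr_range; lra.
Qed.

(** Agreement on the open interval (0, PI / 2) suffices, as derivatives are local, and there sin (2
    ts) > 0 can be divided out. *)
Lemma D_mixed_eq (u g : R -> R -> R) (k1 k2 : nat) (rs t : R) : smooth dbox g ->
  (forall rs t, 0 < t < PI / 2 -> u rs t = comp g rs t) -> 0 < t < PI / 2 ->
  D_mixed k1 k2 u rs t = comp (Nat.iter k1 X (Nat.iter k2 Y g)) rs t.
Proof.
  intros Hg Hu Ht; unfold D_mixed.
  assert (HY : forall rs t, 0 < t < PI / 2 ->
            Nat.iter k2 D_ts u rs t = comp (Nat.iter k2 Y g) rs t).
  { induction k2 as [|k2 IH]; [auto|]; intros rs' t' Ht'; simpl; unfold D_ts at 1.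
    assert (Hs : 0 < sin (2 * t')) by (apply sin_gt_0; lra).
    rewrite (is_derive_unique _ _ (sin (2 * t') * comp (Y (Nat.iter k2 Y g)) rs' t')).
    - field; lra.
    - apply (is_derive_ext_loc (fun t => comp (Nat.iter k2 Y g) rs' t)).
      + generalize (locally_open_interval _ _ _ Ht'); apply filter_imp.
        intros v Hv; symmetry; now apply IH.
      + apply comp_t; [now apply smooth_iter_Y | lra | lra]. }
  pose proof (smooth_iter_Y k2 g Hg) as Hgy.
  revert rs; induction k1 as [|k1 IH]; intros rs; [now apply HY|]; simpl; unfold D_rs at 1.
  apply is_derive_unique, (is_derive_ext (fun s => comp (Nat.iter k1 X (Nat.iter k2 Y g)) s t)).
  - intros s; symmetry; apply IH.
  - apply comp_rs; [now apply smooth_iter_X | lra].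
Qed.

Lemma regularity :
  smooth_on (fun ts => 0 <= ts <= PI) rr /\
  (exists dtt : R -> R -> R,
     (forall rs ts, 0 <= ts <= PI ->
        is_derive_in (fun t => 0 <= t <= PI) (fun t => tt rs t) ts (dtt rs ts)) /\
     smooth_on (fun ts => 0 <= ts <= PI) dtt) /\
  (forall (n : nat) (rs ts : R), 0 < ts < PI / 2 -> ex_derive_n (fun s => tt s ts) n rs) /\
  smooth_on (fun ts => 0 < ts < PI / 2) (L_eik Lam M a e rp rr tt).
Proof.
  split; [|split; [|split]].
  - apply (smooth_on_comp (fun r _ => r)), smooth_fst.
  - exists (comp Tq); split; [intros; now apply tt_t_in | apply smooth_on_comp, smooth_Tq].
  - intros n rs ts Ht; apply ex_derive_n_tt; lra.
  - apply (smooth_on_ext _ (comp Lg)).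
    + intros rs ts Ht; symmetry; now apply L_eik_eq.
    + apply (smooth_on_sub (fun ts => 0 <= ts <= PI)); [intros; lra|].
      apply smooth_on_comp, smooth_Lg.
Qed.

Lemma dth_eq (rs t : R) : 0 < t < PI / 2 -> dth tt rs t = comp Tq rs t.
Proof. intros Ht; apply is_derive_unique, tt_t; lra. Qed.

Lemma estimates (k : nat) (C rs ts : R) :
  uniform_bound k C ->
  0 < ts < PI / 2 ->
  let Dl := Rabs (Delta_r Lam M a e (rr rs ts)) in
  sum2 0 1 k (fun k1 k2 => Rabs (D_mixed k1 k2 rr rs ts)) <= C * Dl /\
  sum_n_m (fun k1 => Rabs (D_mixed k1 0 tt rs ts)) 1 k <= C * (Dl * sin (2 * ts)) /\
  sum_n_m (fun k1 => Rabs (D_mixed 0 k1 (dth tt) rs ts)) 0 (k - 1) <= C /\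
  sum2 1 1 (k - 1) (fun k1 k2 => Rabs (D_mixed k1 k2 (dth tt) rs ts)) <= C * Dl /\
  sum_n_m (fun k1 => Rabs (D_mixed 0 k1 (L_eik Lam M a e rp rr tt) rs ts)) 0 (k - 1) <= C /\
  sum2 1 1 (k - 1) (fun k1 k2 => Rabs (D_mixed k1 k2 (L_eik Lam M a e rp rr tt) rs ts))
    <= C * Dl.
Proof.
  intros H Ht Dl.
  assert (Hp : region (rr rs ts, ts)) by (split; auto; apply rr_range; lra).
  destruct (H _ Hp) as (B1 & B2 & (B3 & B4) & B5 & B6); cbn [fst snd] in *.
  assert (Hmix : forall u g k1 k2, smooth dbox g ->
            (forall rs t, 0 < t < PI / 2 -> u rs t = comp g rs t) ->
            Rabs (D_mixed k1 k2 u rs ts) =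
            Rabs (at_point (Nat.iter k1 X (Nat.iter k2 Y g)) (rr rs ts, ts))).
  { intros u g k1 k2 Hg Hu; f_equal; now apply D_mixed_eq. }
  pose proof (fun k1 k2 => Hmix rr (fun r _ => r) k1 k2 (smooth_fst _)
                (fun _ _ _ => eq_refl)) as M1.
  pose proof (fun k1 k2 => Hmix (dth tt) Tq k1 k2 smooth_Tq dth_eq) as M2.
  pose proof (fun k1 k2 => Hmix (L_eik Lam M a e rp rr tt) Lg k1 k2 smooth_Lg L_eik_eq) as M3.
  split; [|split; [|split; [|split; [|split]]]].
  - rewrite (sum2_ext _ _ _ _ _ M1); exact B1.
  - rewrite (sum_n_m_ext_loc _
      (fun k1 => Rabs (sin (2 * ts) * at_point (Nat.iter (pred k1) X Tx) (rr rs ts, ts))));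
      [exact B2|].
    intros k1 Hk1; destruct k1 as [|k1]; [lia|]; f_equal.
    unfold D_mixed; simpl (Nat.iter 0 _ _); rewrite D_rs_iter_tt by lra; reflexivity.
  - rewrite (sum_n_m_ext _ _ _ _ (M2 0%nat)); exact B3.
  - rewrite (sum2_ext _ _ _ _ _ M2); exact B4.
  - rewrite (sum_n_m_ext _ _ _ _ (M3 0%nat)); exact B5.
  - rewrite (sum2_ext _ _ _ _ _ M3); exact B6.
Qed.

End Coordinates.
End DenChart.
End QChart.
End BaseChart.
End Geometry.

Theorem lemma2p11 (Lam M a e rn rm rp rc : R)
    (hLam : 0 < Lam) (hM : 0 < M) (ha : 0 < a)
    (hsub : subextremal Lam M a e rn rm rp rc) :
  (forall (r0 : R) (rr tt : R -> R -> R),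
     coordinates Lam M a e rm rp r0 rr tt ->
     smooth_on (fun ts => 0 <= ts <= PI) rr /\
     (exists dtt : R -> R -> R,
        (forall rs ts, 0 <= ts <= PI ->
           is_derive_in (fun t => 0 <= t <= PI) (fun t => tt rs t) ts
             (dtt rs ts)) /\
        smooth_on (fun ts => 0 <= ts <= PI) dtt) /\
     (forall (n : nat) (rs ts : R), 0 < ts < PI / 2 ->
        ex_derive_n (fun s => tt s ts) n rs) /\
     smooth_on (fun ts => 0 < ts < PI / 2) (L_eik Lam M a e rp rr tt)) /\
  (forall k : nat, (2 <= k)%nat ->
     exists C : R, 0 < C /\
       forall (r0 : R) (rr tt : R -> R -> R),
         coordinates Lam M a e rm rp r0 rr tt ->
         forall rs ts : R, 0 < ts < PI / 2 ->
           let Dl := Rabs (Delta_r Lam M a e (rr rs ts)) in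
           sum2 0 1 k (fun k1 k2 => Rabs (D_mixed k1 k2 rr rs ts)) <= C * Dl /\
           sum_n_m (fun k1 => Rabs (D_mixed k1 0 tt rs ts)) 1 k
             <= C * (Dl * sin (2 * ts)) /\
           sum_n_m (fun k1 => Rabs (D_mixed 0 k1 (dth tt) rs ts)) 0 (k - 1) <= C /\
           sum2 1 1 (k - 1) (fun k1 k2 => Rabs (D_mixed k1 k2 (dth tt) rs ts))
             <= C * Dl /\
           sum_n_m (fun k1 => Rabs (D_mixed 0 k1 (L_eik Lam M a e rp rr tt) rs ts))
             0 (k - 1) <= C /\
           sum2 1 1 (k - 1)
             (fun k1 k2 => Rabs (D_mixed k1 k2 (L_eik Lam M a e rp rr tt) rs ts))
             <= C * Dl).
Proof.
  destruct (base_chart_exists Lam M a e rn rm rp rc hLam ha hsub)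
    as (e0 & He0 & He0q & Hw & HQ).
  destruct (q_solution_exists Lam M a e rn rm rp rc hLam ha hsub e0 He0 He0q Hw HQ)
    as (e1 & qf & He1 & Hqf).
  destruct (den_chart_exists Lam M a e rn rm rp rc hLam ha hsub e0 He0 Hw HQ e1 qf He1 Hqf)
    as (e2 & He2 & HDen).
  split.
  - intros r0 rr tt (Hr0 & f & thstar & Hf & Hts & Hinv).
    exact (regularity Lam M a e rn rm rp rc hLam ha hsub e0 He0 He0q Hw HQ e1 qf He1 Hqf
             e2 He2 HDen r0 f Hr0 Hf thstar rr tt Hts Hinv).
  - intros k _.
    (* C is extracted while only the parameters, the roots and the chart are in scope, so it serves
       all choices of coordinates. *)
    destruct (uniform_bound_exists Lam M a e rn rm rp rc hLam ha hsub e0 He0 Hw HQ e1 qf He1 Hqf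
                e2 He2 HDen k) as (C & HC & Hbound).
    exists C; split; auto.
    intros r0 rr tt (Hr0 & f & thstar & Hf & Hts & Hinv) rs ts Ht.
    exact (estimates Lam M a e rn rm rp rc hLam ha hsub e0 He0 He0q Hw HQ e1 qf He1 Hqf
             e2 He2 HDen r0 f Hr0 Hf thstar rr tt Hts Hinv k C rs ts Hbound Ht).
Qed.
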